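(* For every integer $n \ge 2$, the set \[\left\{ \sum_{j=1}^\infty \lambda^j J u^j \colon u^j \in W^{1,n}(\mathbb{R}^n,\mathbb{R}^n) \text{ and } \|u^j\|_{W^{1,n}} \le 1 \text{ for every } j \in \mathbb{N}, \ \lambda^j \in \mathbb{R}, \ \sum_{j=1}^\infty |\lambda^j| < \infty \right\}\] is of the first category in $\mathcal{H}^1(\mathbb{R}^n)$.
   Context: For $u = (u_1,\dots,u_n)$, $Ju = \det(\partial_j u_i)_{i,j=1}^n$ is the Jacobian determinant. $W^{1,n}(\mathbb{R}^n,\mathbb{R}^n)$ is the usual inhomogeneous Sobolev space, with $\|u\|_{W^{1,n}}^n = \int_{\mathbb{R}^n} |u|^n + \sum_{i,j=1}^n \int_{\mathbb{R}^n} |\partial_j u_i|^n$. Fix $\eta \in C_c^\infty(\mathbb{R}^n)$ with $\int \eta \ne 0$ and let $\eta_t(x) = t^{-n}\eta(x/t)$ for $t>0$. The real Hardy space is $\mathcal{H}^1(\mathbb{R}^n) = \{h \in \mathcal{S}'(\mathbb{R}^n) : \sup_{t>0}|h*\eta_t| \in L^1(\mathbb{R}^n)\}$ with norm $\|h\|_{\mathcal{H}^1} = \|\sup_{t>0}|h*\eta_t|\|_{L^1}$ (different choices of $\eta$ give equivalent norms). It is known that $Ju \in \mathcal{H}^1(\mathbb{R}^n)$ with $\|Ju\|_{\mathcal{H}^1} \le C_n \prod_{j=1}^n\|\nabla u_j\|_{L^n}$, so the series converge in $\mathcal{H}^1(\mathbb{R}^n)$. A set is of the first category if it is a countable union of nowhere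 dense sets. *)

(* Defs.v *)
From HB Require Import structures.
From mathcomp Require Import all_boot all_order all_algebra.
From mathcomp Require Import all_classical all_reals all_analysis.
Set Implicit Arguments.
Unset Strict Implicit.
Unset Printing Implicit Defensive.
Import Order.TTheory GRing.Theory Num.Theory.
Import numFieldNormedType.Exports.
Local Open Scope classical_set_scope.
Local Open Scope ring_scope.

Definition rV_display : measure_display := default_measure_display.

Section measurable_rV.
Context (R : realType) (n : nat).

Let coords : 'I_n -> 'rV[R]_n -> R := fun i x => x ord0 i.

Let rV_set0 : g_sigma_preimage coords set0.
Proof. exact: sigma_algebra0. Qed.

Let rV_setC A : g_sigma_preimage coords A -> g_sigma_preimage coords (~` A).
Proof. exact: sigma_algebraC. Qed.

Let rV_bigcup (F : (set _)^nat) : (forall i, g_sigma_preimage coords (F i)) ->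
  g_sigma_preimage coords (\bigcup_i (F i)).
Proof. exact: sigma_algebra_bigcup. Qed.

(* The product sigma-algebra, which is the Borel sigma-algebra of R^n. *)
HB.instance Definition _ := @isMeasurable.Build rV_display
  'rV[R]_n (g_sigma_preimage coords) rV_set0 rV_setC rV_bigcup.

End measurable_rV.

Section lebesgue_rV.
Context (R : realType).

Lemma measurable_coord n (i : 'I_n) :
  measurable_fun setT (fun x : 'rV[R]_n => x ord0 i).
Proof.
move=> _ Y mY; rewrite setTI; apply: sub_sigma_algebra => /=.
rewrite -bigcup_seq/=; exists i => /=; first by rewrite mem_index_enum.
by exists Y => //; rewrite setTI.
Qed.

Lemma measurable_rV d (T : measurableType d) n (f : T -> 'rV[R]_n) :
  (forall i, measurable_fun setT (fun x => f x ord0 i)) ->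
  measurable_fun setT f.
Proof.
move=> mf _ A mA; rewrite setTI; move: A mA.
change ((measurable : set_system 'rV[R]_n) `<=`
  [set B | measurable (f @^-1` B)]).
apply: smallest_sub.
- split => /=; first by rewrite preimage_set0.
  + by move=> B mB; rewrite setTD -preimage_setC; exact: measurableC.
  + by move=> F mF; rewrite preimage_bigcup; exact: bigcupT_measurable.
- rewrite -bigcup_seq/= => B [i _ [C mC <-]] /=.
  by rewrite setTI -comp_preimage -[X in measurable X]setTI; exact: mf.
Qed.

Definition rV_cons n (p : R * 'rV[R]_n) : 'rV[R]_n.+1 :=
  row_mx (\row_(_ < 1) p.1) p.2.

Lemma rV_cons0 n (p : R * 'rV[R]_n) : rV_cons p ord0 ord0 = p.1.
Proof.
have e : ord0 = lshift n ord0 :> 'I_(1 + n) by exact/val_inj.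
by rewrite /rV_cons [X in fun_of_matrix _ _ X]e; apply: etrans (row_mxEl _ _ _ _) _; rewrite mxE.
Qed.

Lemma rV_consS n (p : R * 'rV[R]_n) i : rV_cons p ord0 (lift ord0 i) = p.2 ord0 i.
Proof.
have e : lift ord0 i = rshift 1 i :> 'I_(1 + n) by exact/val_inj.
by rewrite /rV_cons [X in fun_of_matrix _ _ X]e; exact: row_mxEr.
Qed.

Definition rV_uncons n (x : 'rV[R]_n.+1) : R * 'rV[R]_n :=
  (x ord0 ord0, \row_i x ord0 (lift ord0 i)).

Lemma rV_consK n : cancel (@rV_cons n) (@rV_uncons n).
Proof.
move=> p; rewrite /rV_uncons rV_cons0 [RHS]surjective_pairing.
by congr pair; apply/rowP => i; rewrite mxE rV_consS.
Qed.

Lemma rV_unconsK n : cancel (@rV_uncons n) (@rV_cons n).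
Proof.
move=> x; apply/rowP => i; rewrite (_ : 0 = ord0)//.
by case: (unliftP ord0 i) => [j|] ->; rewrite ?rV_consS ?rV_cons0//= mxE.
Qed.

Lemma measurable_rV_cons n : measurable_fun setT (@rV_cons n).
Proof.
apply: measurable_rV => i; case: (unliftP ord0 i) => [j|] ->.
  under eq_fun do rewrite rV_consS.
  exact: (measurableT_comp (measurable_coord j) measurable_snd).
by under eq_fun do rewrite rV_cons0; exact: measurable_fst.
Qed.

Lemma measurable_rV_uncons n : measurable_fun setT (@rV_uncons n).
Proof.
apply/measurable_fun_pairP; split; first exact: measurable_coord.
apply: measurable_rV => i; rewrite /comp/=.
under eq_fun do rewrite mxE.
exact: measurable_coord.
Qed.

Section lebesgue_rV_succ.
Context n (mu : {sigma_finite_measure set 'rV[R]_n -> \bar R}).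
Local Open Scope ereal_scope.

(* Product of the one-dimensional Lebesgue measure and [mu], carried over by
   the identification of [R * R^n] with [R^(n+1)]. *)
Definition lebesgue_rV_succ : set 'rV[R]_n.+1 -> \bar R :=
  pushforward (lebesgue_measure \x mu) (@rV_cons n).

Let lebesgue_rV_succ0 : lebesgue_rV_succ set0 = 0.
Proof. by rewrite /lebesgue_rV_succ /pushforward preimage_set0 measure0. Qed.

Let lebesgue_rV_succ_ge0 A : 0 <= lebesgue_rV_succ A.
Proof. have mf := @measurable_rV_cons n; exact: measure_ge0. Qed.

Let lebesgue_rV_succ_sigma_additive : semi_sigma_additive lebesgue_rV_succ.
Proof.
have mf := @measurable_rV_cons n; exact: measure_semi_sigma_additive.
Qed.

HB.instance Definition _ := isMeasure.Build _ _ _ lebesgue_rV_succ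
  lebesgue_rV_succ0 lebesgue_rV_succ_ge0 lebesgue_rV_succ_sigma_additive.

Let lebesgue_rV_succ_sigma_finite : sigma_finite setT lebesgue_rV_succ.
Proof.
have /sigma_finiteP[F [TF ndF Foo]] := sigma_finiteT (@lebesgue_measure R).
have /sigma_finiteP[G [TG ndG Goo]] := sigma_finiteT mu.
exists (fun k => @rV_uncons n @^-1` (F k `*` G k)).
  rewrite -preimage_bigcup (_ : \bigcup_i _ = setT) ?preimage_setT//.
  rewrite -subTset => -[x y] _.
  have [k _ Fx] : (\bigcup_i F i) x by rewrite -TF.
  have [l _ Gy] : (\bigcup_i G i) y by rewrite -TG.
  exists (maxn k l) => //; split => /=.
    by move: x Fx; exact/subsetPset/ndF/leq_maxl.
  by move: y Gy; exact/subsetPset/ndG/leq_maxr.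
move=> k; have [mF Fk] := Foo k; have [mG Gk] := Goo k; split.
  rewrite -[X in measurable X]setTI.
  by apply: measurable_rV_uncons => //; exact: measurableX.
rewrite /lebesgue_rV_succ /pushforward -comp_preimage.
rewrite (_ : _ \o _ = id) ?preimage_id; last exact/funext/rV_consK.
by rewrite product_measure1E// lte_mul_pinfty// ge0_fin_numE.
Qed.

HB.instance Definition _ := Measure_isSigmaFinite.Build _ _ _ lebesgue_rV_succ
  lebesgue_rV_succ_sigma_finite.

End lebesgue_rV_succ.

Fixpoint lebesgue_rV n : {sigma_finite_measure set 'rV[R]_n -> \bar R} :=
  match n with
  | 0 => \d_ (0 : 'rV[R]_0)
  | m.+1 => lebesgue_rV_succ (lebesgue_rV m)
  end.

End lebesgue_rV.
Arguments lebesgue_rV {R n}.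

Section smooth.
Context (R : realType) (n : nat).
Implicit Types (f g : 'rV[R]_n -> R) (s : seq 'I_n) (x : 'rV[R]_n).

Definition partial (i : 'I_n) f : 'rV[R]_n -> R := 'D_(delta_mx ord0 i) f.

(* Words [s] are used instead of multi-indices; for smooth functions the order
   of the letters is irrelevant. *)
Definition partials s f : 'rV[R]_n -> R := foldr partial f s.

Definition smooth f := forall s, continuous (partials s f) /\
  forall i x, derivable (partials s f) x (delta_mx ord0 i).

Definition test_function f :=
  smooth f /\ compact (closure [set x | f x != 0]).

(* [`|x|] is the sup norm of ['rV[R]_n]; an equivalent norm would give an
   equivalent seminorm. *)
Definition schwartz_seminorm (k : nat) f : \bar R :=
  ereal_sup [set ((1 + `|x|) ^+ k * `|partials s f x|)%:E |
             s in [set s | (size s <= k)%N] & x in setT].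

Definition schwartz_fun : {pred 'rV[R]_n -> R} :=
  [pred f | `[< smooth f /\ forall k, (schwartz_seminorm k f < +oo)%E >]].

Lemma partials_lin s a f g : smooth f -> smooth g ->
  partials s (a *: f + g) = a *: partials s f + partials s g.
Proof.
move=> sf sg; elim: s => [//|i s IH] /=; rewrite IH; apply/funext => x.
have [_ /(_ i x) df] := sf s; have [_ /(_ i x) dg] := sg s.
rewrite /partial deriveD ?deriveZ//; exact: derivableZ.
Qed.

Lemma smooth_lin a f g : smooth f -> smooth g -> smooth (a *: f + g).
Proof.
move=> sf sg s; rewrite partials_lin//; split.
  move=> x; apply: continuousD; last exact: (sg s).1.
  exact: (continuousZl_tmp (k := a) ((sf s).1 x)).
move=> i x; apply: derivableD; last exact: (sg s).2.
by apply: derivableZ; exact: (sf s).2.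
Qed.

Lemma partials0 s : partials s 0 = 0.
Proof.
elim: s => [//|i s IH] /=; rewrite IH; apply/funext => x.
by rewrite /partial derive_cst.
Qed.

Lemma smooth0 : smooth 0.
Proof.
move=> s; rewrite partials0; split; first exact: cst_continuous.
by move=> i x; exact: derivable_cst.
Qed.

Lemma schwartz_seminorm_ub k f s x : (size s <= k)%N ->
  (((1 + `|x|) ^+ k * `|partials s f x|)%:E <= schwartz_seminorm k f)%E.
Proof. by move=> sk; apply: ereal_sup_ubound; exists s => //; exists x. Qed.

Lemma schwartz_seminorm_le k f (M : R) :
  (forall s x, (size s <= k)%N -> (1 + `|x|) ^+ k * `|partials s f x| <= M) ->
  (schwartz_seminorm k f <= M%:E)%E.
Proof. by move=> fM; apply: ge_ereal_sup => _ [s sk [x _ <-]]; rewrite lee_fin fM. Qed.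

Lemma schwartz_seminorm_ltyP k f : (schwartz_seminorm k f < +oo)%E <->
  exists M, forall s x, (size s <= k)%N ->
    (1 + `|x|) ^+ k * `|partials s f x| <= M.
Proof.
split=> [foo|[M fM]]; last first.
  by apply: (le_lt_trans (schwartz_seminorm_le fM)); rewrite ltry.
have f0 : (0 <= schwartz_seminorm k f)%E.
  apply: le_trans (@schwartz_seminorm_ub k f [::] 0 (leq0n _)).
  by rewrite lee_fin mulr_ge0// exprn_ge0// addr_ge0.
exists (fine (schwartz_seminorm k f)) => s x sk; rewrite -lee_fin fineK.
  exact: schwartz_seminorm_ub.
by rewrite ge0_fin_numE.
Qed.

Lemma schwartz_seminorm_mono k l f : (k <= l)%N ->
  (schwartz_seminorm k f <= schwartz_seminorm l f)%E.
Proof.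
move=> kl; apply: ge_ereal_sup => _ [s sk [x _ <-]].
apply: le_trans (@schwartz_seminorm_ub l f s x (leq_trans sk kl)).
rewrite lee_fin ler_wpM2r//; apply: ler_weXn2l => //.
by rewrite lerDl.
Qed.

Lemma schwartz_submod_closed : submod_closed schwartz_fun.
Proof.
split.
  apply/asboolP; split; first exact: smooth0.
  move=> k; apply/schwartz_seminorm_ltyP; exists 0 => s x _.
  by rewrite partials0 normr0 mulr0.
move=> a f g /asboolP[sf fk] /asboolP[sg gk]; apply/asboolP; split.
  exact: smooth_lin.
move=> k; have /schwartz_seminorm_ltyP[M fM] := fk k.
have /schwartz_seminorm_ltyP[N gN] := gk k.
apply/schwartz_seminorm_ltyP; exists (`|a| * M + N) => s x sk.
rewrite partials_lin//.
apply: le_trans (lerD (ler_wpM2l (normr_ge0 a) (fM _ x sk)) (gN _ x sk)).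
rewrite mulrCA -mulrDr ler_wpM2l ?exprn_ge0 ?addr_ge0//.
by rewrite -normrM; exact: ler_normD.
Qed.

HB.instance Definition _ := GRing.isSubmodClosed.Build R _ schwartz_fun
  schwartz_submod_closed.

Record schwartz := Schwartz {
  schwartz_val :> 'rV[R]_n -> R ; _ : schwartz_val \in schwartz_fun }.
HB.instance Definition _ := [isSub for schwartz_val].
HB.instance Definition _ := [Choice of schwartz by <:].
HB.instance Definition _ := [SubChoice_isSubLmodule of schwartz by <:].

End smooth.

Section dilation.
Context (R : realType) (n : nat).
Implicit Types (f : 'rV[R]_n -> R) (s : seq 'I_n) (x y : 'rV[R]_n).

Definition dilate f (t : R) : 'rV[R]_n -> R := fun x => t ^- n * f (t^-1 *: x).

Lemma is_derive_affine f (a c : R) x y v : c != 0 ->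
  derivable f (c *: (x - y)) v ->
  is_derive y v (fun z => a * f (c *: (x - z)))
    (a * - c * 'D_v f (c *: (x - y))).
Proof.
move=> c0 df.
have cvg0 : (fun h : R => - c * h) @ 0^' --> 0^'.
  move=> A A0; have := @mulrl_continuous R (- c) 0.
  rewrite /continuous_at mulr0 => /(_ _ A0) cA.
  apply: (@filterS _ (nbhs (0 : R)) _ _ _ _ cA) => h /= hA h0; apply: hA.
  by rewrite mulf_neq0// oppr_eq0.
have cvgD : h^-1 *: (a * f (c *: (x - (h *: v + y))) - a * f (c *: (x - y)))
    @[h --> 0^'] --> a * - c * 'D_v f (c *: (x - y)).
  have : (a * - c) * ((- c * h)^-1 *:
      (f ((- c * h) *: v + c *: (x - y)) - f (c *: (x - y))))
      @[h --> 0^'] --> a * - c * 'D_v f (c *: (x - y)).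
    apply: cvgMl_tmp.
    exact: (@cvg_comp _ _ _ (fun h : R => - c * h) (fun k : R => k^-1 *:
      (f (k *: v + c *: (x - y)) - f (c *: (x - y)))) _ _ _ cvg0 df).
  apply: cvg_trans; apply: near_eq_cvg; near=> h.
  have h0 : h != 0 by near: h; exact: nbhs_dnbhs_neq.
  rewrite (_ : (- c * h) *: v + _ = c *: (x - (h *: v + y))); last first.
    by rewrite opprD addrCA [in RHS]scalerDr scalerN scalerA mulNr scaleNr.
  rewrite /GRing.scale/= -mulrBr invfM -!mulrA mulVKf ?oppr_eq0//.
  exact: mulrCA.
by apply: DeriveDef; [apply/cvg_ex; eexists; exact: cvgD|exact: cvg_lim cvgD].
Unshelve. all: by end_near. Qed.

Lemma partials_affine f (a c : R) x s : c != 0 -> smooth f ->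
  partials s (fun y => a * f (c *: (x - y))) =
  (fun y => a * (- c) ^+ size s * partials s f (c *: (x - y))).
Proof.
move=> c0 sf; elim: s => [|i s IH] /=; first by rewrite mulr1.
rewrite IH; apply/funext => y; rewrite /partial.
have df := (sf s).2 i (c *: (x - y)).
rewrite (@derive_val _ _ _ _ _ _ _ (is_derive_affine _ c0 df)).
by rewrite exprSr mulrA.
Qed.

Lemma smooth_affine f (a c : R) x : c != 0 -> smooth f ->
  smooth (fun y => a * f (c *: (x - y))).
Proof.
move=> c0 sf s; rewrite partials_affine//; split.
  move=> y.
  have cy : {for y, continuous (fun z : 'rV[R]_n => x - z)}.
    by apply: (@continuousB _ _ _ (cst x) id); [exact: cst_continuous|].
  have cfy := continuous_comp (continuousZl_tmp (k := c) cy) ((sf s).1 _).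
  exact: (continuousZl_tmp (k := a * (- c) ^+ size s) cfy).
move=> i y; have df := (sf s).2 i (c *: (x - y)).
by case: (is_derive_affine (a * (- c) ^+ size s) c0 df).
Qed.

Lemma partials_supp f s x :
  ~ closure [set y | f y != 0] x -> partials s f x = 0.
Proof.
elim: s x => [|i s IH] x Kx /=.
  by apply/eqP/negPn/negP => fx; apply: Kx; exact: subset_closure.
rewrite /partial -[RHS](derive_cst 0 x (delta_mx ord0 i)).
apply: near_eq_derive; rewrite /cst.
have : open (~` closure [set y | f y != 0]).
  by rewrite openC; exact: closed_closure.
by move=> Ko; exact: (filterS IH (open_nbhs_nbhs (conj Ko Kx))).
Qed.

Lemma test_function_bounded f k : test_function f -> exists M, 0 <= M /\
  forall s x, (size s <= k)%N -> `|partials s f x| <= M.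
Proof.
move=> [sf cK].
have /choice[M fM] : forall s, exists M, 0 <= M /\
    forall x, `|partials s f x| <= M.
  move=> s; have : compact (partials s f @` closure [set y | f y != 0]).
    by apply: continuous_compact => //; apply: continuous_subspaceT; exact: (sf s).1.
  move=> /compact_bounded /pinfty_ex_gt0[M M0 KM].
  exists M; split; first exact: ltW.
  move=> x; have [Kx|Kx] := pselect (closure [set y | f y != 0] x).
    by apply: KM => /=; exists x.
  by rewrite partials_supp// normr0 ltW.
exists (\sum_(m < k.+1) \sum_(t : m.-tuple 'I_n) M t); split.
  by apply: sumr_ge0 => m _; apply: sumr_ge0 => t _; exact: (fM _).1.
move=> s x sk; apply: le_trans ((fM s).2 x) _.
rewrite (bigD1 (Ordinal (sk : (size s < k.+1)%N)))//=.
rewrite (bigD1 (in_tuple s))//= -addrA lerDl addr_ge0//.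
  by apply: sumr_ge0 => t _; exact: (fM _).1.
by apply: sumr_ge0 => m _; apply: sumr_ge0 => t _; exact: (fM _).1.
Qed.

Lemma schwartz_dilate f (t : R) x : 0 < t -> test_function f ->
  (fun y => dilate f t (x - y)) \in @schwartz_fun R n.
Proof.
move=> t0 tf; have [sf cK] := tf; have tV0 : t^-1 != 0 by rewrite invr_neq0 ?gt_eqF.
apply/asboolP; split; first exact: smooth_affine.
move=> k; apply/schwartz_seminorm_ltyP.
have [M [M0 fM]] := test_function_bounded k tf.
have [B B0 KB] := pinfty_ex_gt0 (compact_bounded cK).
exists ((1 + (`|x| + t * B)) ^+ k * (`|t ^- n| * (1 + `|t^-1|) ^+ k * M)) => s y sk.
rewrite /dilate partials_affine//.
have [Ky|Ky] := pselect (closure [set y | f y != 0] (t^-1 *: (x - y))); last first.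
  rewrite partials_supp// mulr0 normr0 mulr0.
  by rewrite !mulr_ge0// ?exprn_ge0// !addr_ge0// mulr_ge0 ?ltW.
apply: ler_pM; rewrite ?exprn_ge0 ?addr_ge0//.
  rewrite lerXn2r ?nnegrE ?addr_ge0//; first by rewrite mulr_ge0// ltW.
  rewrite lerD2l -[y in leLHS](subKr x) (le_trans (ler_normB _ _))// lerD2l.
  have := KB _ Ky; rewrite /= normrZ gtr0_norm ?invr_gt0//.
  by rewrite ler_pdivrMl.
rewrite !normrM normrX normrN -!mulrA ler_wpM2l//.
apply: ler_pM; rewrite ?exprn_ge0//; last exact: fM.
apply: (@le_trans _ _ ((1 + `|t^-1|) ^+ size s)).
  by rewrite lerXn2r ?nnegrE ?addr_ge0// lerDr.
by apply: ler_weXn2l => //; rewrite lerDl.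
Qed.

End dilation.

Section schwartz_topology.
Context (R : realType) (n : nat).
Local Notation schwartz := (schwartz R n).

(* The locally convex topology defined by the (increasing) sequence of
   seminorms [schwartz_seminorm k]. *)
Definition schwartz_open : set_system schwartz := [set U | forall phi, U phi ->
  exists k (e : R), 0 < e /\ forall psi : schwartz,
    (schwartz_seminorm k (psi - phi)%R < e%:E)%E -> U psi].

Let schwartz_openT : schwartz_open setT.
Proof. by move=> phi _; exists 0%N, 1. Qed.

Let schwartz_openI : setI_closed schwartz_open.
Proof.
move=> U V oU oV phi [/oU[k [e [e0 eU]]] /oV[l [d [d0 dV]]]].
exists (maxn k l), (Num.min e d); split; first by rewrite lt_min e0.
move=> psi psiphi; split; [apply: eU|apply: dV]; apply: le_lt_trans (_ : _ < _)%E.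
- exact: schwartz_seminorm_mono (leq_maxl k l).
- by apply: lt_le_trans psiphi _; rewrite lee_fin ge_min lexx.
- exact: schwartz_seminorm_mono (leq_maxr k l).
- by apply: lt_le_trans psiphi _; rewrite lee_fin ge_min lexx orbT.
Qed.

Let schwartz_open_bigU (I : Type) (f : I -> set schwartz) :
  (forall i, schwartz_open (f i)) -> schwartz_open (\bigcup_i f i).
Proof.
move=> of_ phi [i _ /of_[k [e [e0 eU]]]]; exists k, e; split => // psi /eU.
by exists i.
Qed.

HB.instance Definition _ := isOpenTopological.Build schwartz
  schwartz_openT schwartz_openI schwartz_open_bigU.

End schwartz_topology.

Definition tempered (R : realType) (n : nat) (T : schwartz R n -> R) :=
  scalar T /\ continuous T.

Record test_fun (R : realType) (n : nat) := TestFun {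
  test_val :> 'rV[R]_n -> R ;
  test_valP : test_function test_val }.

Section hardy.
Context (R : realType) (n : nat) (eta : test_fun R n).
Local Notation mu := (@lebesgue_rV R n).

(* [y |-> eta_t (x - y)], so that [(h * eta_t) x = h (eta_at t x)]. *)
Definition eta_at (t : {posnum R}) (x : 'rV[R]_n) : schwartz R n :=
  Schwartz (schwartz_dilate x (gt0 t) (test_valP eta)).

Definition hardy_maximal (h : schwartz R n -> R) (x : 'rV[R]_n) : \bar R :=
  ereal_sup [set `|h (eta_at t x)|%:E | t in setT].

Definition hardy_norm (h : schwartz R n -> R) : \bar R :=
  \int[mu]_x hardy_maximal h x.

Record hardy := Hardy {
  hardy_val :> schwartz R n -> R ;
  hardy_tempered : tempered hardy_val ;
  hardy_integrable : mu.-integrable setT (hardy_maximal hardy_val) }.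

HB.instance Definition _ := gen_eqMixin hardy.
HB.instance Definition _ := gen_choiceMixin hardy.

(* The topology of the norm: open sets are those containing a ball around each
   of their points. *)
Definition hardy_open : set_system hardy := [set U | forall h : hardy, U h ->
  exists e : R, 0 < e /\ forall g : hardy,
    (hardy_norm (hardy_val g - hardy_val h)%R < e%:E)%E -> U g].

Let hardy_openT : hardy_open setT.
Proof. by move=> h _; exists 1. Qed.

Let hardy_openI : setI_closed hardy_open.
Proof.
move=> U V oU oV h [/oU[e [e0 eU]] /oV[d [d0 dV]]].
exists (Num.min e d); split; first by rewrite lt_min e0.
move=> g gh; split; [apply: eU|apply: dV]; apply: lt_le_trans gh _.
  by rewrite lee_fin ge_min lexx.
by rewrite lee_fin ge_min lexx orbT.
Qed.

Let hardy_open_bigU (I : Type) (f : I -> set hardy) :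
  (forall i, hardy_open (f i)) -> hardy_open (\bigcup_i f i).
Proof.
move=> of_ h [i _ /of_[e [e0 eU]]]; exists e; split => // g /eU.
by exists i.
Qed.

HB.instance Definition _ := isOpenTopological.Build hardy
  hardy_openT hardy_openI hardy_open_bigU.

End hardy.

Section sobolev.
Context (R : realType) (n : nat).
Implicit Types (f g : 'rV[R]_n -> R) (u : 'rV[R]_n -> 'rV[R]_n).
Implicit Types (Du : 'rV[R]_n -> 'M[R]_n).
Local Notation mu := (@lebesgue_rV R n).

Definition weak_partial (j : 'I_n) f g := forall phi, test_function phi ->
  \int[mu]_x (f x * partial j phi x) = - \int[mu]_x (g x * phi x).

Definition euclidean_norm (v : 'rV[R]_n) : R :=
  Num.sqrt (\sum_i v ord0 i ^+ 2).

(* [u] belongs to W^(1,n)(R^n, R^n) and [Du] is its weak gradient (which is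
   unique up to a null set), [Du x i j] being the [j]-th derivative of the
   [i]-th component. *)
Definition sobolev u Du := forall i,
  (fun x => u x ord0 i) \in Lfun mu (n%:R)%:E /\
  forall j, (fun x => Du x i j) \in Lfun mu (n%:R)%:E /\
    weak_partial j (fun x => u x ord0 i) (fun x => Du x i j).

Definition sobolev_norm u Du : \bar R :=
  ((\int[mu]_x (euclidean_norm (u x) ^+ n)%:E +
    \sum_(i < n) \sum_(j < n) \int[mu]_x (`|Du x i j| ^+ n)%:E) `^ (n%:R^-1))%E.

Definition jacobian_det Du : 'rV[R]_n -> R := fun x => \det (Du x).

Definition regular_distribution f : schwartz R n -> R :=
  fun phi => \int[mu]_x (f x * phi x).

End sobolev.

(* The set of all sums [h] in the Hardy space of the series of the
   [lambda_j J u_j]: the partial sums converge to [h] for the Hardy norm. *)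
Definition jacobian_series (R : realType) (n : nat) (eta : test_fun R n) :
    set (hardy eta) :=
  [set h | exists (u : nat -> 'rV[R]_n -> 'rV[R]_n)
                  (Du : nat -> 'rV[R]_n -> 'M[R]_n) (lambda : nat -> R),
    [/\ forall j, sobolev (u j) (Du j) /\ (sobolev_norm (u j) (Du j) <= 1)%E,
        cvgn (series (fun j => `|lambda j|)) &
        hardy_norm eta (hardy_val h - \sum_(j < N)
          lambda j *: regular_distribution (jacobian_det (Du j)))
          @[N --> \oo] --> 0%E]].

Arguments jacobian_series {R n} eta _.

Definition nowhere_dense (T : topologicalType) (A : set T) :=
  (closure A)° = set0.

Definition first_category (T : topologicalType) (A : set T) :=
  exists F : nat -> set T, (forall k, nowhere_dense (F k)) /\
    A = \bigcup_k F k.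

(* Main.v *)
Require Import Defs.
From mathcomp Require Import all_boot all_order all_algebra fingroup perm.
From mathcomp Require Import all_classical all_reals all_analysis.
From mathcomp Require Import measurable_realfun ring lra.
Set Implicit Arguments.
Unset Strict Implicit.
Unset Printing Implicit Defensive.
Import Order.TTheory GRing.Theory Num.Theory.
Import numFieldNormedType.Exports.
Local Open Scope classical_set_scope.
Local Open Scope ring_scope.

(* Integrating by parts, the pairing of [J u] with [eta_t (x - y)] puts one of
   the [n] derivatives on [eta_t], so it is at most [C t^(-n-1)] uniformly in
   [x] when the norm of [u] is at most 1. Hence a sum [h] whose coefficients
   satisfy [sum |lambda_j| <= k] obeys [|h * eta_t| <= k C t^(-n-1)] for all [t].
   This condition is closed in the Hardy space. It has empty interior: for a
   fixed atom [f], the dilates [r^(-n) f(y / r)] have the same Hardy norm, while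
   their convolution with [eta_r] is [c r^(-n)] at the origin, with [c <> 0]; for
   large [r] a small multiple of such a dilate leaves the set. The set of all
   sums is thus a countable union, over [k], of nowhere dense sets. *)

(** * Lebesgue measure and translations *)

(** The rows of [Du] are gradients only in the weak sense, while the cancellation among cofactors
    needs second derivatives. Instead of approximating u by smooth maps, the proof treats the rows
    one at a time: the integrated identity is linear in each row, and a linear condition that holds
    for all gradients of test functions passes to weak gradients by mollification. The limit rests
    on continuity of translation in L^n, obtained here by induction on the sigma-algebra. The
    inhomogeneous norm is what makes the bound possible: after the integration by parts one
    component of u stands undifferentiated, and its L^n norm is controlled. The bound t^(-n-1)
    misses the scaling of the Hardy norm by one power of t, and this gap gives the empty interior.
    The dilated functions need a finite Hardy norm: a difference of two translates of a test
    function has mean zero, so its maximal function is of order |x|^(-n-1) at infinity. *)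

Section lebesgue_affine.
Context (R : realType).
Local Open Scope ereal_scope.

Lemma measurable_affine_real (a b : R) :
  measurable_fun [set: measurableTypeR R] (fun x => (a * x + b)%R : measurableTypeR R).
Proof. by apply: measurable_funD => //; apply: measurable_funM. Qed.

(** By uniqueness of Lebesgue measure: [|a|] times its image under the map agrees with it on the
    intervals []c, d]]. For a < 0 the preimage of such an interval is closed on the left instead,
    which does not change its length. *)
Lemma lebesgue_measure_affine (a b : R) (A : set (measurableTypeR R)) : a != 0%R ->
  measurable A ->
  lebesgue_measure ((fun x => (a * x + b)%R) @^-1` A) =
  (`|a|^-1)%:E * lebesgue_measure A.
Proof.
move=> a0 mA; have mf := measurable_affine_real a b.
have := @lebesgue_measure_unique R
  (mscale (NngNum (normr_ge0 a))
    (pushforward lebesgue_measure (fun x => (a * x + b)%R : measurableTypeR R))).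
move=> /(_ mf _ _ mA) ->.
  rewrite /mscale/= /pushforward muleA -EFinM mulVf ?mul1e//.
  by rewrite normr_eq0.
move=> X [[c d] _] <-; change (lebesgue_measure `]c, d]%classic =
  `|a|%:E * lebesgue_measure ((fun x => (a * x + b)%R) @^-1` `]c, d]%classic)).
have ab0 : (0 < `|a|)%R by rewrite normr_gt0.
have [{}a0|{}a0|/eqP] := ltgtP 0%R a; last by rewrite eq_sym (negbTE a0).
- rewrite (_ : _ @^-1` _ = `](c - b) / a, (d - b) / a]%classic)%R.
    rewrite !lebesgue_measure_itv/= !lte_fin ltr_pM2r ?invr_gt0// ltrD2r.
    case: ifPn => // _; last by rewrite mule0.
    rewrite -!EFinB -EFinM gtr0_norm//; congr (_%:E).
    by field; rewrite gt_eqF.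
  apply/seteqP; split=> x /=; rewrite !in_itv/= ltr_pdivrMr// ler_pdivlMr//;
    by rewrite ltrBlDr lerBrDr mulrC.
- rewrite (_ : _ @^-1` _ = `[(d - b) / a, (c - b) / a[%classic)%R.
    rewrite !lebesgue_measure_itv/= !lte_fin ltr_nM2r ?invr_lt0// ltrD2r.
    case: ifPn => // _; last by rewrite mule0.
    rewrite -!EFinB -EFinM ltr0_norm//; congr (_%:E).
    by field; rewrite lt_eqF.
  apply/seteqP; split=> x /=; rewrite !in_itv/= ler_ndivrMr// ltr_ndivlMr//;
    by rewrite lerBrDr ltrBlDr mulrC andbC.
Qed.

Lemma ge0_integral_affine_real (a b : R) (f : R -> \bar R) : a != 0%R ->
  measurable_fun [set: measurableTypeR R] f -> (forall x, 0 <= f x) ->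
  \int[lebesgue_measure]_x f (a * x + b)%R =
  (`|a|^-1)%:E * \int[lebesgue_measure]_x f x.
Proof.
move=> a0 mf f0; have mA := measurable_affine_real a b.
have ai : (0 <= `|a|^-1)%R by rewrite invr_ge0.
rewrite -[LHS](@ge0_integral_pushforward _ _ (measurableTypeR R) (measurableTypeR R) _ _ mA _ setT)//.
rewrite (eq_measure_integral (mscale (NngNum ai) lebesgue_measure)).
  by rewrite ge0_integral_mscale.
by move=> A mA' _; exact: lebesgue_measure_affine.
Qed.

End lebesgue_affine.

(** * Affine changes of variable and boxes in R^n *)

Section lebesgue_rV_facts.
Context (R : realType).
Local Open Scope ereal_scope.

Lemma lebesgue_rVSE n (A : set 'rV[R]_n.+1) :
  @lebesgue_rV R n.+1 A =
  \int[lebesgue_measure]_x lebesgue_rV [set y | A (rV_cons (x, y))].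
Proof.
rewrite /= /lebesgue_rV_succ /pushforward /product_measure1.
apply: eq_integral => x _ /=; congr (lebesgue_rV _); apply/seteqP; split => y /=;
  by rewrite /xsection/= inE.
Qed.

Lemma measurable_rV_section n (A : set 'rV[R]_n.+1) x : measurable A ->
  measurable [set y | A (rV_cons (x, y))].
Proof.
move=> mA; rewrite -[X in measurable X]setTI.
have := measurableT_comp (@measurable_rV_cons R n) (measurable_pair1 x).
by move=> /(_ measurableT _ mA); apply.
Qed.

Lemma measurable_lebesgue_rV_section n (A : set 'rV[R]_n.+1) : measurable A ->
  measurable_fun [set: measurableTypeR R]
    (fun x => lebesgue_rV [set y | A (rV_cons (x, y))]).
Proof.
move=> mA; have mB : measurable (@rV_cons R n @^-1` A).
  by rewrite -[X in measurable X]setTI; exact: measurable_rV_cons.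
have := measurable_fun_xsection (lebesgue_rV : {sigma_finite_measure set 'rV[R]_n -> \bar R}) mB.
apply: eq_measurable_fun => x _ /=; congr (lebesgue_rV _).
by apply/seteqP; split => y /=; rewrite /xsection/= inE.
Qed.

Lemma measurable_affine_rV n (a : R) (b : 'rV[R]_n) :
  measurable_fun setT (fun x : 'rV[R]_n => (a *: x + b)%R).
Proof.
apply: measurable_rV => i; under eq_fun do rewrite !mxE.
apply: measurable_funD => //; apply: measurable_funM => //.
exact: measurable_coord.
Qed.

(** Induction on the dimension. The slice at x of the preimage is an affine preimage of the slice at
    [a * x + b ord0 ord0]: the induction hypothesis accounts for [|a| ^- n] and the one-dimensional
    change of variable for the last factor. *)
Lemma lebesgue_rV_affine n (a : R) (b : 'rV[R]_n) (A : set 'rV[R]_n) :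
  a != 0%R -> measurable A ->
  lebesgue_rV ((fun x => a *: x + b)%R @^-1` A) =
  (`|a| ^- n)%:E * lebesgue_rV A.
Proof.
move=> a0; elim: n b A => [|n IH] b A mA.
  rewrite expr0 invr1 mul1e (_ : _ @^-1` _ = A)//.
  by apply/seteqP; split=> x /=; rewrite (thinmx0 (_ + _)%R) (thinmx0 x).
rewrite !lebesgue_rVSE.
pose f x := (`|a| ^- n)%:E * lebesgue_rV [set y | A (rV_cons (x, y))].
transitivity (\int[lebesgue_measure]_x f (a * x + b ord0 ord0)%R).
  apply: eq_integral => x _; rewrite /f.
  rewrite -(IH (\row_i b ord0 (lift ord0 i))); last exact: measurable_rV_section.
  congr (lebesgue_rV _); apply/funext => y /=.
  congr (A _); apply/rowP => i; rewrite (_ : 0%R = ord0 :> 'I_1)//=.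
  case: (unliftP ord0 i) => [j|] ->; rewrite ?rV_consS ?rV_cons0/= mxE.
    by rewrite mxE rV_consS/= !mxE.
  by rewrite mxE rV_cons0.
have mf := measurable_lebesgue_rV_section mA.
rewrite (@ge0_integral_affine_real _ a (b ord0 ord0) f)//.
- rewrite ge0_integralZl// muleA -EFinM -invfM -exprS//.
- by apply: measurable_funeM.
- by move=> x; rewrite /f mule_ge0// lee_fin invr_ge0 exprn_ge0.
Qed.

Lemma ge0_integral_affine n (a : R) (b : 'rV[R]_n) (f : 'rV[R]_n -> \bar R) :
  a != 0%R -> measurable_fun setT f -> (forall x, 0 <= f x) ->
  \int[lebesgue_rV]_x f (a *: x + b)%R =
  (`|a| ^- n)%:E * \int[lebesgue_rV]_x f x.
Proof.
move=> a0 mf f0; have mA := measurable_affine_rV a b.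
have ai : (0 <= `|a| ^- n)%R by rewrite invr_ge0 exprn_ge0.
rewrite -[LHS](@ge0_integral_pushforward _ _ _ _ _ _ mA _ setT)//.
rewrite (eq_measure_integral (mscale (NngNum ai) lebesgue_rV)).
  by rewrite ge0_integral_mscale.
by move=> A mA' _; exact: lebesgue_rV_affine.
Qed.

Lemma lebesgue_rV_box n (l h : 'I_n -> R) : (forall i, l i <= h i)%R ->
  lebesgue_rV [set x : 'rV[R]_n | forall i, l i <= x ord0 i <= h i]%R =
  (\prod_i (h i - l i))%:E.
Proof.
elim: n l h => [|n IH] l h lh.
  rewrite big_ord0 /= diracE (_ : _ \in _ = true)//.
  by apply/mem_set => -[].
rewrite lebesgue_rVSE big_ord_recl.
set B := [set y : 'rV[R]_n | forall i, l (lift ord0 i) <= y ord0 i <= h (lift ord0 i)]%R.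
transitivity (\int[lebesgue_measure]_x
    (lebesgue_rV B * (\1_(`[l ord0, h ord0]%classic : set R) x)%:E)); last first.
  rewrite ge0_integralZl//; last exact: measurableT_comp.
  rewrite integral_indic// setIT.
  rewrite [X in _ * X](lebesgue_measure_itv `[l ord0, h ord0])/= lte_fin.
  rewrite IH; last by move=> i; exact: lh.
  have := lh ord0; rewrite le_eqVlt => /predU1P[->|->].
    by rewrite ltxx subrr mul0r mule0.
  by rewrite -EFinB -EFinM mulrC.
apply: eq_integral => x _; rewrite indicE; have [xI|xI] := boolP (x \in _).
  rewrite mule1; congr (lebesgue_rV _); apply/seteqP; split => y /= yB i.
    by have := yB (lift ord0 i); rewrite rV_consS.
  case: (unliftP ord0 i) => [j|] ->; rewrite ?rV_consS ?rV_cons0//=.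
  by move: xI; rewrite inE/= in_itv.
rewrite mule0 (_ : [set _ | _] = set0) ?measure0//.
apply/seteqP; split => y //= /(_ ord0); rewrite rV_cons0/= => yB.
by move: xI; rewrite notin_setE/= in_itv/=; apply.
Qed.

End lebesgue_rV_facts.

(** * Sup norm, open sets and measurability *)

Section topology_rV.
Context (R : realType).

Lemma rV_norm_leP n (x : 'rV[R]_n) (r : R) : 0 <= r ->
  (`|x| <= r) <-> (forall i, `|x ord0 i| <= r).
Proof.
move=> r0; rewrite [X in X <= _]/Num.norm/= mx_normrE; split=> [xr i|xr].
  by apply: le_trans xr; exact: (le_bigmax _ (fun ij => `|x ij.1 ij.2|) (ord0, i)).
by apply: bigmax_le => // -[j i] _ /=; rewrite ord1.
Qed.

Lemma rV_coord_le n (x : 'rV[R]_n) i : `|x ord0 i| <= `|x|.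
Proof. by move: i; apply/rV_norm_leP. Qed.

Lemma measurable_rV_norm n : measurable_fun setT (fun x : 'rV[R]_n => `|x|).
Proof.
rewrite (_ : (fun x => _) = fun x : 'rV[R]_n => \big[Num.max/0]_i `|x ord0 i|); last first.
  apply/funext => x; apply/eqP; rewrite eq_le; apply/andP; split.
    apply/rV_norm_leP; first by rewrite bigmax_idl le_max lexx.
    by move=> i; exact: (le_bigmax _ (fun i => `|x ord0 i|) i).
  by apply: bigmax_le => // i _; exact: rV_coord_le.
elim: (index_enum _) => [|i s IH].
  by under eq_fun do rewrite big_nil; exact: measurable_cst.
under eq_fun do rewrite big_cons; apply: measurable_maxr => //.
by apply: measurableT_comp => //; exact: measurable_coord.
Qed.

Lemma measurable_rVB n (c : 'rV[R]_n) : measurable_fun setT (fun x : 'rV[R]_n => x - c).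
Proof.
apply: measurable_rV => i; under eq_fun do rewrite !mxE.
by apply: measurable_funB => //; exact: measurable_coord.
Qed.

Lemma measurable_cube n (c : 'rV[R]_n) r : measurable [set x : 'rV[R]_n | `|x - c| <= r].
Proof.
rewrite -[X in measurable X]setTI.
have := measurableT_comp (@measurable_rV_norm n) (measurable_rVB c).
move=> /(_ measurableT `]-oo, r]%classic (measurable_itv _)).
by rewrite (_ : _ @^-1` _ = [set x : 'rV[R]_n | `|x - c| <= r])//; apply/funext => x/=; rewrite in_itv.
Qed.

Lemma lebesgue_rV_cube n (c : 'rV[R]_n) r : 0 <= r ->
  lebesgue_rV [set x : 'rV[R]_n | `|x - c| <= r] = ((2 * r) ^+ n)%:E.
Proof.
move=> r0.
have := @lebesgue_rV_box R n (fun i => c ord0 i - r) (fun i => c ord0 i + r).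
rewrite (_ : [set x | _] = [set x : 'rV[R]_n | `|x - c| <= r]).
  move=> ->; last by move=> i; lra.
  rewrite (eq_bigr (fun=> 2 * r)); last by move=> i _; ring.
  by rewrite prodr_const card_ord.
apply/funext => x /=; rewrite propeqE; split => [xc|/rV_norm_leP xc i].
  by apply/rV_norm_leP => // i; rewrite !mxE ler_distl.
by have := xc r0 i; rewrite !mxE ler_distl.
Qed.

Lemma ball_rVE n (x : 'rV[R]_n) e : 0 < e -> ball x e = [set y | `|x - y| < e].
Proof. by move=> e0; rewrite -ball_normE. Qed.

(** The sigma-algebra is generated by the coordinates, not by the open sets. An open set is the
    union of the countably many cubes with rational centre and radius 1/(k+1) that it contains. *)
Lemma open_measurable_rV n (A : set 'rV[R]_n) : open A -> measurable A.
Proof.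
move=> oA.
pose B (p : 'rV[rat]_n * nat) := [set y : 'rV[R]_n | `|y - map_mx ratr p.1| <= p.2.+1%:R^-1].
have -> : A = \bigcup_(p in [set p | B p `<=` A]) B p.
  apply/seteqP; split => [x Ax|x [p /= pA]]; last exact: pA.
  have /nbhs_ballP[e /= e0 eA] : nbhs x A by exact: open_nbhs_nbhs.
  have e20 : 0 < e / 2 by rewrite divr_gt0.
  have [k _ /(_ k (leqnn k)) /= ke] := near_infty_natSinv_lt (PosNum e20).
  have k0 : 0 < k.+1%:R^-1 :> R by rewrite invr_gt0.
  have /choice[q qx] i : exists q : rat, `|x ord0 i - ratr q| <= k.+1%:R^-1.
    move: k0 (x ord0 i) => {ke}; set d := k.+1%:R^-1 => d0 z.
    have /rat_in_itvoo[q] : z - d < z + d by lra.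
    by rewrite in_itv/= => /andP[h1 h2]; exists q; rewrite ler_distl; lra.
  have xB : B (\row_i q i, k) x.
    by apply/rV_norm_leP => [|i]; [exact: ltW|rewrite !mxE; exact: qx].
  exists (\row_i q i, k) => //= y yB; apply: eA.
  rewrite ball_rVE//= (_ : x - y =
    (x - map_mx ratr (\row_i q i)) - (y - map_mx ratr (\row_i q i))); last first.
    by rewrite opprB addrA subrK.
  by rewrite (le_lt_trans (ler_normB _ _))// (splitr e) ltrD// (le_lt_trans _ ke).
rewrite bigcup_mkcond; apply: countable_bigcupT_measurable => [|p]; first exact: countableP.
by case: ifPn => // _; exact: measurable_cube.
Qed.

Lemma continuous_measurable_rV n (f : 'rV[R]_n -> R) : continuous f ->
  measurable_fun setT f.
Proof.
move=> /continuousP cf; apply: (measurability _ (RGenOInfty.measurableE R)) => //.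
move=> /= _ [_ [a ->] <-]; rewrite setTI; apply: open_measurable_rV.
by apply: cf; exact: rray_open.
Qed.

(** Meant for [hardy_maximal], a supremum of continuous functions over uncountably many scales. *)
Lemma lower_semicontinuous_measurable_rV n (f : 'rV[R]_n -> \bar R) :
  (forall a : R, open [set x | (a%:E < f x)%E]) -> measurable_fun setT f.
Proof.
move=> lf; apply: (measurability _ (ErealGenOInfty.measurableE R)).
move=> /= _ [_ [a ->]] <-; rewrite setTI preimage_itvoy.
by apply: open_measurable_rV; exact: lf.
Qed.

End topology_rV.

(** * Continuity of translation in measure *)

Section translation_sets.
Context (R : realType) (n : nat).
Local Notation mu := (@lebesgue_rV R n).
Implicit Types (A B : set 'rV[R]_n) (x y : 'rV[R]_n).

Definition cube (r : R) : set 'rV[R]_n := [set x | `|x| <= r].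

Lemma measurable_cube0 r : measurable (cube r).
Proof.
have := measurable_cube (0 : 'rV[R]_n) r.
by rewrite (_ : [set x | _] = cube r)//; apply/funext => x; rewrite /cube/= subr0.
Qed.

Lemma lebesgue_cube r : 0 <= r -> mu (cube r) = ((2 * r) ^+ n)%:E.
Proof.
move=> r0; rewrite -(lebesgue_rV_cube (0 : 'rV[R]_n) r0).
by congr (mu _); apply/funext => x; rewrite /cube/= subr0.
Qed.

Lemma measurable_translate A y : measurable A -> measurable [set x | A (x - y)].
Proof.
by move=> mA; have := measurable_rVB y measurableT mA; rewrite setTI.
Qed.

Lemma lebesgue_rV_translate A y : measurable A -> mu [set x | A (x - y)] = mu A.
Proof.
move=> mA; have := lebesgue_rV_affine (- y) (oner_neq0 R) mA.
rewrite normr1 expr1n invr1 mul1e => <-.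
by congr (mu _); apply/funext => x /=; rewrite scale1r.
Qed.

(* It is enough to control the one-sided difference: the other one is obtained
   by translating by [-y], or by passing to the complement. *)
Definition translation_cont A := measurable A /\ forall N e : R, 0 <= N -> 0 < e ->
  exists r, 0 < r /\ forall y, `|y| <= r ->
    (mu (cube N `&` [set x | A (x - y)%R /\ ~ A x]) <= e%:E)%E.

Lemma measurable_translate_diff N A y : measurable A ->
  measurable (cube N `&` [set x | A (x - y) /\ ~ A x]).
Proof.
move=> mA; apply: measurableI; first exact: measurable_cube0.
exact: measurableD (measurable_translate y mA) mA.
Qed.

Lemma translation_cont0 : translation_cont set0.
Proof.
split => // N e N0 e0; exists 1; split => // y _.
by rewrite (_ : _ `&` _ = set0) ?measure0 ?lee_fin ?ltW//; apply/seteqP; split => x // [_ []].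
Qed.

(** If x - y lies outside A and x in A, then z = x - y lies in the difference that A has for the
    translation by -y. Since [|y| <= 1], the point z stays in the cube of radius N + 1. *)
Lemma translation_contC A : translation_cont A -> translation_cont (~` A).
Proof.
move=> [mA cA]; split; first exact: measurableC.
move=> N e N0 e0; have [r [r0 rA]] := cA (N + 1) e (addr_ge0 N0 ler01) e0.
exists (Num.min r 1); split; first by rewrite lt_min r0 ltr01.
move=> y; rewrite le_min => /andP[yr y1].
have mD := measurable_translate_diff (N + 1) (- y) mA.
apply: le_trans (rA (- y) _); last by rewrite normrN.
rewrite -(lebesgue_rV_translate y mD) le_measure// ?inE.
- exact: measurable_translate_diff (measurableC mA).
- exact: measurable_translate.
- move=> x /= [xN [Axy /contrapT Ax]]; rewrite opprK subrK; split => //.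
  by rewrite /cube/= (le_trans (ler_normB _ _))// lerD.
Qed.

Lemma translation_contU A B : translation_cont A -> translation_cont B ->
  translation_cont (A `|` B).
Proof.
move=> [mA cA] [mB cB]; split; first exact: measurableU.
move=> N e N0 e0; have e20 : 0 < e / 2 by rewrite divr_gt0.
have [r [r0 rA]] := cA N _ N0 e20; have [s [s0 sB]] := cB N _ N0 e20.
exists (Num.min r s); split; first by rewrite lt_min r0.
move=> y; rewrite le_min => /andP[yr ys].
have mDA := measurable_translate_diff N y mA.
have mDB := measurable_translate_diff N y mB.
have -> : e%:E = ((e / 2)%:E + (e / 2)%:E)%E by rewrite -EFinD -splitr.
apply: le_trans (leeD (rA y yr) (sB y ys)); apply: le_trans (measureU2 _ mDA mDB).
rewrite le_measure// ?inE; [|exact: measurableU|].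
  exact: measurable_translate_diff (measurableU _ _ mA mB).
by move=> x /= [xN [[Ax|Bx] /not_orP[nA nB]]]; [left|right].
Qed.

(** Inside the cube of radius N + 1 the tails [D m] decrease to the empty set and have finite
    measure, so some [D M] is small. A point of the difference comes either from the finite union
    [B M] or from a translate of [D M]. *)
Lemma translation_cont_bigcup (F : (set 'rV[R]_n)^nat) :
  (forall i, translation_cont (F i)) -> translation_cont (\bigcup_i F i).
Proof.
move=> cF; have mF i : measurable (F i) by exact: (cF i).1.
have mU : measurable (\bigcup_i F i) by exact: bigcupT_measurable.
split => // N e N0 e0.
pose B m := \bigcup_(i < m) F i.
have cB m : translation_cont (B m).
  elim: m => [|m IH]; first by rewrite /B bigcup_mkord big_ord0; exact: translation_cont0.
  rewrite /B bigcup_mkord big_ord_recr/= -bigcup_mkord.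
  exact: translation_contU.
pose D m := cube (N + 1) `&` (\bigcup_i F i `\` B m).
have mD m : measurable (D m).
  by apply: measurableI; [exact: measurable_cube0|apply: measurableD => //; exact: (cB m).1].
have D0 : \bigcap_m D m = set0.
  apply/seteqP; split => x // Dx; have [_ [[i _ Fix] _]] := Dx 0%N I.
  by have [_ [_]] := Dx i.+1 I; apply; exists i => /=.
have e20 : 0 < e / 2 by rewrite divr_gt0.
have [M De] : exists M, (mu (D M) < (e / 2)%:E)%E.
  have N10 : 0 <= N + 1 by rewrite addr_ge0.
  have cD : mu \o D @ \oo --> 0%E.
    rewrite -[0%E](measure0 mu) -D0; apply: nonincreasing_cvg_mu => //.
    - apply: (@le_lt_trans _ _ (mu (cube (N + 1)))); last by rewrite lebesgue_cube// ltry.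
      by rewrite le_measure// ?inE//; [exact: measurable_cube0|move=> x []].
    - exact: bigcapT_measurable.
    - move=> i j ij; apply/subsetPset => x [xN [Ux nB]]; split => //; split => // -[k /= ki Fk].
      by apply: nB; exists k => //=; exact: leq_trans ki ij.
  have : \forall m \near \oo, (mu (D m) < (e / 2)%:E)%E.
    apply: (cD [set x | (x < (e / 2)%:E)%E]); apply: open_nbhs_nbhs; split.
      exact: open_ereal_lt_ereal.
    by rewrite /= lte_fin.
  by case=> M _ /(_ M (leqnn M)) ?; exists M.
have [r [r0 rB]] := (cB M).2 N _ N0 e20.
exists (Num.min r 1); split; first by rewrite lt_min r0 ltr01.
move=> y; rewrite le_min => /andP[yr y1].
have -> : e%:E = ((e / 2)%:E + (e / 2)%:E)%E by rewrite -EFinD -splitr.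
apply: le_trans (leeD (rB y yr) (ltW De)).
rewrite -[in leRHS](lebesgue_rV_translate y (mD M)).
have mDB := measurable_translate_diff N y (cB M).1.
have mDy := measurable_translate y (mD M).
apply: le_trans (measureU2 _ mDB mDy).
rewrite le_measure// ?inE; [|exact: measurableU|].
  exact: measurable_translate_diff.
move=> x /= [xN [Fxy nFx]].
have [BM|nBM] := pselect (B M (x - y)); last right.
  by left; split => //; split => // -[i _ Fi]; apply: nFx; exists i.
by split => //; rewrite /cube/= (le_trans (ler_normB _ _))// lerD.
Qed.

(** It is enough to treat the rays []a, +oo[], which generate the Borel sets. There the difference
    lies in the slab [a - |y| <= x_i <= a], whose part in the cube has volume at most [|y| * c]. *)
Lemma translation_cont_coord i (C : set R) : measurable C ->
  translation_cont [set x | C (x ord0 i)].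
Proof.
have mcoord D : measurable D -> measurable [set x : 'rV[R]_n | D (x ord0 i)].
  by move=> mD; have := @measurable_coord R n i measurableT D mD; rewrite setTI.
move: C; change ((@ocitv R).-sigma.-measurable `<=`
  [set C | translation_cont [set x | C (x ord0 i)]]).
rewrite RGenOInfty.measurableE; apply: smallest_sub.
  split => /=; first exact: translation_cont0.
  - move=> C /translation_contC; congr translation_cont; apply/funext => x.
    by rewrite /setC/= propeqE; split=> [?|[]].
  - move=> F cF; rewrite [X in translation_cont X](_ : _ =
      \bigcup_k [set x : 'rV[R]_n | F k (x ord0 i)])//.
    exact: translation_cont_bigcup.
move=> _ [a ->] /=; have ma := mcoord _ (measurable_itv `]a, +oo[).
split => // N e N0 e0.
pose c := \prod_(j < n | j != i) (N + N).
have c0 : 0 <= c by apply: prodr_ge0 => j _; rewrite addr_ge0.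
have c10 : 0 < c + 1 by rewrite ltr_wpDl.
(* The face volume c may vanish when N = 0, hence c + 1. *)
exists (e / (c + 1)); split; first by rewrite divr_gt0.
move=> y yr; have yi := rV_coord_le y i.
pose l j := if j == i then a - `|y| else - N.
pose h j := if j == i then a else N.
apply: (@le_trans _ _ (mu [set x | forall j, l j <= x ord0 j <= h j])).
  have mbox : measurable [set x : 'rV[R]_n | forall j, l j <= x ord0 j <= h j].
    rewrite (_ : [set x | _] = \bigcap_(j in [set: 'I_n])
        [set x : 'rV[R]_n | `[l j, h j]%classic (x ord0 j)]).
      apply: fin_bigcap_measurable => // j _.
      by have := @measurable_coord R n j measurableT _ (measurable_itv `[l j, h j]); rewrite setTI.
    apply/seteqP; split => x /= xlh j.
      by move=> _; rewrite /= in_itv/=.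
    by have := xlh j I; rewrite /= in_itv/=.
  rewrite le_measure// ?inE//; first exact: measurable_translate_diff ma.
  move=> x /= [xN [+ +]] j; rewrite !in_itv/= !andbT !mxE => ay /negP; rewrite -leNgt => xa.
  rewrite /l /h; case: eqVneq => [->|_].
    rewrite xa andbT lerBlDr; apply: ltW; apply: lt_le_trans ay _.
    by rewrite lerD2l (le_trans _ yi)// -normrN ler_norm.
  by rewrite -ler_norml (le_trans (rV_coord_le _ _)).
rewrite lebesgue_rV_box.
  rewrite (bigD1 i)//= /l /h eqxx opprB addrCA subrr addr0 lee_fin.
  rewrite (eq_bigr (fun=> N + N)) => [|j /negbTE ->]; last by rewrite opprK.
  rewrite -/c (@le_trans _ _ (`|y| * (c + 1)))//; first by rewrite ler_wpM2l// lerDl.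
  by rewrite -ler_pdivlMr.
by move=> j; rewrite /l /h; case: ifP => _; [rewrite lerBlDr lerDl|rewrite -subr_ge0 opprK addr_ge0].
Qed.

(** Induction on the sigma-algebra plays the part of an approximation by open or compact sets. *)
Lemma measurable_translation_cont A : measurable A -> translation_cont A.
Proof.
move: A; change (measurable `<=` [set A | translation_cont A]).
apply: smallest_sub.
  split => /=; first exact: translation_cont0.
  - by move=> C /translation_contC cC; rewrite setTD.
  - by move=> F cF; exact: translation_cont_bigcup.
rewrite -bigcup_seq/= => B [i _ [C mC <-]] /=.
by rewrite setTI; exact: translation_cont_coord.
Qed.

End translation_sets.

(** * Continuity of translation in L^p *)

Section translation_Lp.
Context (R : realType) (n p : nat).
Hypothesis p0 : (0 < p)%N.
Local Notation mu := (@lebesgue_rV R n).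
Implicit Types (f g h : 'rV[R]_n -> R) (x y : 'rV[R]_n).

(** The p-th power of the L^p norm. Only smallness matters below, so roots are avoided and
    Minkowski's inequality becomes [pow_intD], with the constant 2^p. *)
Definition pow_int f : \bar R := (\int[mu]_x (`|f x| ^+ p)%:E)%E.

Lemma exprD_le (a b : R) : 0 <= a -> 0 <= b ->
  (a + b) ^+ p <= 2 ^+ p * (a ^+ p + b ^+ p).
Proof.
move=> a0 b0; wlog ab : a b a0 b0 / a <= b => [hw|].
  by have [/hw|/ltW/hw] := leP a b; [exact|rewrite addrC [X in _ * X]addrC; exact].
apply: (@le_trans _ _ ((2 * b) ^+ p)).
  by rewrite lerXn2r ?nnegrE ?addr_ge0 ?mulr_ge0//; lra.
by rewrite exprMn ler_wpM2l ?exprn_ge0// lerDr exprn_ge0.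
Qed.

Lemma measurable_pow f : measurable_fun setT f ->
  measurable_fun setT (fun x => (`|f x| ^+ p)%:E).
Proof.
by move=> mf; apply/measurable_EFinP; apply: measurable_funX; exact: measurableT_comp.
Qed.

Lemma pow_int_ge0 f : (0 <= pow_int f)%E.
Proof. by apply: integral_ge0 => x _; rewrite lee_fin exprn_ge0. Qed.

Lemma pow_intZ c f : measurable_fun setT f ->
  pow_int (fun x => c * f x) = ((`|c| ^+ p)%:E * pow_int f)%E.
Proof.
move=> mf; rewrite -ge0_integralZl//.
- by apply: eq_integral => x _; rewrite normrM exprMn EFinM.
- exact: measurable_pow.
Qed.

Lemma pow_intN f : pow_int (fun x => - f x) = pow_int f.
Proof. by apply: eq_integral => x _; rewrite normrN. Qed.

Lemma pow_intD f g : measurable_fun setT f -> measurable_fun setT g ->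
  (pow_int (fun x => f x + g x)%R <= (2 ^+ p)%:E * (pow_int f + pow_int g))%E.
Proof.
move=> mf mg; rewrite -ge0_integralD//; [|exact: measurable_pow..].
rewrite -ge0_integralZl//.
- apply: ge0_le_integral => //.
  + by apply: measurable_pow; exact: measurable_funD.
  + by apply: measurable_funeM; apply: emeasurable_funD; exact: measurable_pow.
  + move=> x _; rewrite -EFinD -EFinM lee_fin.
    apply: le_trans (exprD_le (normr_ge0 _) (normr_ge0 _)).
    by rewrite lerXn2r ?nnegrE ?addr_ge0// ler_normD.
- by apply: emeasurable_funD; exact: measurable_pow.
- by move=> x _; rewrite adde_ge0// lee_fin exprn_ge0.
Qed.

Lemma measurable_fun_translate f y : measurable_fun setT f ->
  measurable_fun setT (fun x => f (x - y)).
Proof. by move=> mf; exact: measurableT_comp mf (measurable_rVB y). Qed.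

Lemma ge0_integral_translate (F : 'rV[R]_n -> \bar R) y : measurable_fun setT F ->
  (forall x, 0 <= F x)%E -> (\int[mu]_x F (x - y)%R = \int[mu]_x F x)%E.
Proof.
move=> mF F0; have := ge0_integral_affine (- y) (oner_neq0 R) mF F0.
rewrite normr1 expr1n invr1 mul1e => <-.
by apply: eq_integral => x _; rewrite scale1r.
Qed.

Lemma pow_int_translate f y : measurable_fun setT f ->
  pow_int (fun x => f (x - y)) = pow_int f.
Proof.
move=> mf; apply: (@ge0_integral_translate (fun x => (`|f x| ^+ p)%:E)) => [|x].
  exact: measurable_pow.
by rewrite lee_fin exprn_ge0.
Qed.

Definition Lp_translation_cont f := measurable_fun setT f /\
  forall e : R, 0 < e -> exists r, 0 < r /\ forall y, `|y| <= r ->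
    (pow_int (fun x => f (x - y) - f x)%R <= e%:E)%E.

(** The increment of the indicator has absolute value 1 exactly on the symmetric difference. Its two
    halves are the one-sided differences of E and of the complement of E, and both lie in the cube
    of radius N + 1. *)
Lemma Lp_translation_cont_indic A N : 0 <= N -> measurable A ->
  Lp_translation_cont (\1_(A `&` cube N)).
Proof.
move=> N0 mA; set E := A `&` _.
have mE : measurable E by apply: measurableI => //; exact: measurable_cube0.
split => [|e e0]; first exact: measurable_indic.
have e20 : 0 < e / 2 by rewrite divr_gt0.
have N10 : 0 <= N + 1 by rewrite addr_ge0.
have [_ /(_ _ _ N10 e20)[r [r0 rE]]] := measurable_translation_cont mE.
have [_ /(_ _ _ N10 e20)[s [s0 sE]]] := measurable_translation_cont (measurableC mE).
exists (Num.min 1 (Num.min r s)); split; first by rewrite !lt_min ltr01 r0.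
move=> y; rewrite !le_min => /and3P[y1 yr ys].
have -> : e%:E = ((e / 2)%:E + (e / 2)%:E)%E by rewrite -EFinD -splitr.
apply: le_trans (leeD (rE y yr) (sE y ys)).
have mD1 := measurable_translate_diff (N + 1) y mE.
have mD2 := measurable_translate_diff (N + 1) y (measurableC mE).
rewrite -(setIT (cube (N + 1) `&` [set x | E (x - y) /\ ~ E x])) -integral_indic//.
rewrite -(setIT (cube (N + 1) `&` [set x | (~` E) (x - y) /\ ~ (~` E) x])) -integral_indic//.
rewrite -ge0_integralD//; [|by apply/measurable_EFinP; exact: measurable_indic..].
apply: ge0_le_integral => //.
- have mI : measurable_fun setT (\1_E : 'rV[R]_n -> R) by exact: measurable_indic.
  by apply: measurable_pow; apply: measurable_funB => //; exact: measurable_fun_translate mI.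
- by apply: emeasurable_funD; apply/measurable_EFinP; exact: measurable_indic.
move=> x _; rewrite -EFinD lee_fin !indicE.
have xN z : `|z| <= N + 1 -> cube (N + 1) z by [].
have [/set_mem Exy|nExy] := boolP (x - y \in E);
  have [/set_mem Ex|nEx] := boolP (x \in E).
- by rewrite subrr normr0 expr0n gtn_eqF// addr_ge0.
- rewrite subr0 normr1 expr1n (_ : x \in _ = true) ?lerDl//; apply/mem_set.
  split; last by split => //; move: nEx; rewrite notin_setE.
  apply: xN; rewrite -(subrK y x) (le_trans (ler_normD _ _))// lerD//.
  by have [] := Exy.
- rewrite sub0r normrN normr1 expr1n [in X in _ <= _ + X](_ : x \in _ = true) ?lerDr//.
  apply/mem_set; split; last first.
    by split; [move: nExy; rewrite notin_setE|move=> /(_ Ex)].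
  by apply: xN; have [_ xN'] := Ex; rewrite (le_trans xN')// lerDl.
- by rewrite subrr normr0 expr0n gtn_eqF// addr_ge0.
Qed.

Lemma Lp_translation_contZ c f : Lp_translation_cont f -> Lp_translation_cont (fun x => c * f x).
Proof.
move=> [mf cf]; split => [|e e0]; first exact: measurable_funM.
have c10 : 0 < `|c| ^+ p + 1 by rewrite ltr_wpDl ?exprn_ge0.
have [r [r0 rf]] := cf _ (divr_gt0 e0 c10); exists r; split => // y /rf fy.
under [X in pow_int X]eq_fun do rewrite -mulrBr.
rewrite pow_intZ; last by apply: measurable_funB => //; exact: measurable_fun_translate.
apply: le_trans (lee_wpmul2l _ fy) _; first by rewrite lee_fin exprn_ge0.
by rewrite -EFinM lee_fin mulrA ler_pdivrMr// mulrC ler_wpM2l ?ltW// ltrDl.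
Qed.

Lemma Lp_translation_contD f g : Lp_translation_cont f -> Lp_translation_cont g ->
  Lp_translation_cont (fun x => f x + g x).
Proof.
move=> [mf cf] [mg cg]; split => [|e e0]; first exact: measurable_funD.
pose d := e / 2 ^+ p / 2.
have d0 : 0 < d by rewrite !divr_gt0// exprn_gt0.
have [r [r0 rf]] := cf _ d0; have [s [s0 sg]] := cg _ d0.
exists (Num.min r s); split; first by rewrite lt_min r0.
move=> y; rewrite le_min => /andP[/rf fy /sg gy].
under [X in pow_int X]eq_fun do rewrite opprD addrACA.
apply: le_trans (pow_intD _ _) _.
- by apply: measurable_funB => //; exact: measurable_fun_translate.
- by apply: measurable_funB => //; exact: measurable_fun_translate.
apply: (@le_trans _ _ ((2 ^+ p)%:E * (d%:E + d%:E))%E).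
  by rewrite lee_wpmul2l ?lee_fin ?exprn_ge0// leeD.
by rewrite -EFinD -EFinM lee_fin /d -splitr mulrC divfK// gt_eqF// exprn_gt0.
Qed.

Lemma Lp_translation_cont0 : Lp_translation_cont (fun=> 0).
Proof.
split => // e e0; exists 1; split => // y _.
rewrite /pow_int; under eq_integral do rewrite subrr normr0 expr0n gtn_eqF//.
by rewrite integral0 lee_fin ltW.
Qed.

Lemma Lp_translation_cont_approx f : measurable_fun setT f ->
  (forall e : R, 0 < e -> exists h, Lp_translation_cont h /\
    (pow_int (fun x => f x - h x)%R <= e%:E)%E) ->
  Lp_translation_cont f.
Proof.
move=> mf fh; split => // e e0.
pose K : R := 2 ^+ p; have K0 : 0 < K by rewrite exprn_gt0.
(* Two uses of [pow_intD] on the three terms below give K (d + K (d + d)), which is e for this d. *)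
pose d := e / (K + K * K + K * K).
have d0 : 0 < d by rewrite divr_gt0// !addr_gt0// mulr_gt0.
have [h [[mh ch] hd]] := fh _ d0; have [r [r0 rh]] := ch _ d0.
exists r; split => // y /rh hy.
pose g x := f x - h x.
have mg : measurable_fun setT g by exact: measurable_funB.
have mDh : measurable_fun setT (fun x => h (x - y) - h x).
  by apply: measurable_funB => //; exact: measurable_fun_translate.
have mgN : measurable_fun setT (fun x => - g x) by exact: measurable_funN.
rewrite (_ : (fun x => f (x - y) - f x) =
    fun x => g (x - y) + ((h (x - y) - h x) + - g x)); last first.
  by apply/funext => x; rewrite /g; ring.
apply: le_trans (pow_intD (measurable_fun_translate y mg) (measurable_funD mDh mgN)) _.
rewrite pow_int_translate//.
apply: (@le_trans _ _ (K%:E * (d%:E + K%:E * (d%:E + d%:E)))%E).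
  apply: lee_wpmul2l; first by rewrite lee_fin ltW.
  apply: leeD => //; apply: le_trans (pow_intD mDh mgN) _.
  apply: lee_wpmul2l; first by rewrite lee_fin ltW.
  by rewrite leeD// pow_intN.
rewrite -!(EFinD,EFinM) lee_fin (_ : K * _ = d * (K + K * K + K * K)); last by ring.
by rewrite /d divfK// gt_eqF// !addr_gt0// mulr_gt0.
Qed.

Import HBSimple.
Import HBNNSimple.

(** The simple functions increasing to f, cut off to growing cubes, lie between 0 and f, so they
    converge to f in L^p by dominated convergence. Each is a finite combination of indicators of
    bounded sets. *)
Lemma Lp_translation_cont_ge0 f : measurable_fun setT f -> (forall x, 0 <= f x) ->
  (pow_int f < +oo)%E -> Lp_translation_cont f.
Proof.
move=> mf f0 foo; apply: Lp_translation_cont_approx => // e e0.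
have mEf : measurable_fun setT (EFin \o f) by exact/measurable_EFinP.
pose F m : {nnsfun _ >-> R} := nnsfun_approx measurableT mEf m.
pose h m x := F m x * \1_(cube m%:R) x.
have mF m : measurable_fun setT (F m) by exact: measurable_funP.
have mh m : measurable_fun setT (h m).
  by apply: measurable_funM => //; apply: measurable_indic; exact: measurable_cube0.
have Ff m x : F m x <= f x.
  by rewrite -lee_fin /F nnsfun_approxE; apply: le_approx => //= z _; rewrite lee_fin.
have F0 m x : 0 <= F m x by exact: fun_ge0.
have Fcvg x : F m x @[m --> \oo] --> f x.
  have := @cvg_nnsfun_approx _ _ _ _ measurableT _ mEf (fun z _ => f0 z : (0 <= (EFin \o f) z)%E) x I.
  by move=> /fine_cvgP[_].
have hcvg x : h m x @[m --> \oo] --> f x.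
  apply: cvg_trans (Fcvg x); apply: near_eq_cvg; near=> m.
  rewrite /h indicE (_ : _ \in _ = true) ?mulr1//; apply/mem_set; rewrite /cube/=.
  by near: m; exact: nbhs_infty_ger.
have [] := @dominated_convergence _ _ _ mu _ measurableT
    (fun m x => (`|f x - h m x| ^+ p)%:E) (cst 0%E) (fun x => (`|f x| ^+ p)%:E).
- by move=> m; apply: measurable_pow; exact: measurable_funB.
- exact: measurable_cst.
- apply: aeW => x _; rewrite /cst/=; apply: cvg_EFin; first by near=> m.
  have : `|f x - h m x| ^+ p @[m --> \oo] --> `|f x - f x| ^+ p.
    have := @exprn_continuous R p `|f x - f x|; apply: cvg_comp.
    by apply: cvg_norm; apply: cvgB (hcvg x); exact: cvg_cst.
  by rewrite subrr normr0 expr0n gtn_eqF.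
- apply/integrableP; split; first exact: measurable_pow.
  by under eq_integral do rewrite gee0_abs ?lee_fin ?exprn_ge0//.
- apply: aeW => x m _; rewrite /= ger0_norm ?exprn_ge0// lee_fin lerXn2r ?nnegrE//.
  have hf : 0 <= h m x <= f x.
    rewrite /h indicE; case: (_ \in _); rewrite ?mulr1 ?mulr0 ?F0 ?Ff//=.
    by rewrite lexx f0.
  by rewrite !ger0_norm ?subr_ge0//; [rewrite lerBlDr lerDl|]; case/andP: hf.
move=> _ _; rewrite integral0 => cv.
have /(cv _)[M _ /(_ M (leqnn M))/= He] : nbhs 0%E [set x | (x < e%:E)%E].
  apply: open_nbhs_nbhs; split; first exact: open_ereal_lt_ereal.
  by rewrite /= lte_fin.
exists (h M); split; last exact: ltW He.
rewrite (_ : h M = fun x => \sum_(k <- finmap.enum_fset (fset_set (range (F M))))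
    k * \1_((F M @^-1` [set k]) `&` cube M%:R) x); last first.
  apply/funext => x; rewrite /h fimfunE fsbig_finite//= big_distrl/=.
  by apply: eq_bigr => k _; rewrite -mulrA indicI.
elim: (finmap.enum_fset _) => [|k s IH].
  by under eq_fun do rewrite big_nil; exact: Lp_translation_cont0.
under eq_fun do rewrite big_cons.
apply: Lp_translation_contD => //; apply: Lp_translation_contZ.
by apply: Lp_translation_cont_indic => //; exact: measurable_sfunP.
Unshelve. all: by end_near. Qed.

Lemma pow_int_lty_translation_cont f : measurable_fun setT f -> (pow_int f < +oo)%E ->
  Lp_translation_cont f.
Proof.
move=> mf foo; rewrite (_ : f = fun x => f^\+ x + -1 * f^\- x); last first.
  by apply/funext => x; rewrite mulN1r -[in LHS](funrposBneg f).
apply: Lp_translation_contD; last apply: Lp_translation_contZ.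
all: apply: Lp_translation_cont_ge0 => //;
  rewrite ?(funrpos_ge0,funrneg_ge0)//; try exact: measurable_funrpos; try exact: measurable_funrneg.
all: apply: le_lt_trans foo; apply: ge0_le_integral => //;
  try (by apply: measurable_pow; try exact: measurable_funrpos; try exact: measurable_funrneg).
all: move=> x _; rewrite lee_fin lerXn2r ?nnegrE// ger0_norm ?(funrpos_ge0,funrneg_ge0)//.
all: by rewrite /funrpos/funrneg ge_max normr_ge0 andbT ?ler_norm// -normrN ler_norm.
Qed.

End translation_Lp.

(** * Smooth functions *)

Section directional.
Context (R : realType) (n : nat).
Implicit Types (f : 'rV[R]_n -> R) (x y u v w : 'rV[R]_n).

Lemma is_derive_line f x v (s : R) : derivable f (s *: v + x) v ->
  is_derive s 1 (fun t => f (t *: v + x)) ('D_v f (s *: v + x)).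
Proof.
move=> df.
have eqD : (fun h : R => h^-1 *: (((fun t => f (t *: v + x)) \o shift s) (h *: 1) -
    f (s *: v + x))) = (fun h => h^-1 *: ((f \o shift (s *: v + x)) (h *: v) - f (s *: v + x))).
  by apply/funext => h /=; rewrite [h *: 1]mulr1 scalerDl addrA.
by apply: DeriveDef; [rewrite /derivable eqD|rewrite /derive eqD].
Qed.

Lemma directional_MVT f v : (forall y, derivable f y v) -> forall x (h : R),
  exists2 c, `|c| <= `|h| & f (h *: v + x) - f x = h * 'D_v f (c *: v + x).
Proof.
move=> df x h; pose g t := f (t *: v + x); pose dg (t : R) : R := 'D_v f (t *: v + x).
have gdg (t : R) : is_derive t 1 g (dg t) by exact: is_derive_line.
have cg a b : {within `[a, b], continuous g}.
  by apply: derivable_within_continuous => t _; exact: (@ex_derive _ _ _ _ _ _ _ (gdg t)).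
have g0 : g 0 = f x by rewrite /g scale0r add0r.
have [h0|h0] := leP 0 h.
  have [c] := @MVT_segment R g dg 0 h h0 (fun t _ => gdg t) (cg 0 h).
  rewrite in_itv/= => /andP[c0 ch] E; exists c; first by rewrite !ger0_norm.
  by rewrite -g0 E subr0 mulrC.
have [c] := @MVT_segment R g dg h 0 (ltW h0) (fun t _ => gdg t) (cg h 0).
rewrite in_itv/= => /andP[hc c0] E; exists c; first by rewrite !ler0_norm ?lerN2// ltW.
by rewrite -g0 -opprB E sub0r mulrN opprK mulrC.
Qed.

Lemma derivable_shift f v w x : derivable f (w + x) v -> derivable (fun y => f (w + y)) x v.
Proof.
rewrite /derivable (_ : (fun h : R => _) =
  (fun h : R => h^-1 *: (((fun y => f (w + y)) \o shift x) (h *: v) - f (w + x))))//.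
by apply/funext => h /=; rewrite addrCA.
Qed.

Lemma derive_shift f v w x : 'D_v (fun y => f (w + y)) x = 'D_v f (w + x).
Proof.
rewrite /derive (_ : (fun h : R => _) =
  (fun h : R => h^-1 *: ((f \o shift (w + x)) (h *: v) - f (w + x))))//.
by apply/funext => h /=; rewrite addrCA.
Qed.

(** The mean value theorem is applied along u to the increment of f in direction v, then along v to
    the derivative of f in direction u. *)
Lemma second_difference f u v : (forall y, derivable f y u) ->
  (forall y, derivable ('D_u f) y v) -> forall x (h : R),
  exists c d, [/\ `|c| <= `|h|, `|d| <= `|h| &
    f (h *: v + (h *: u + x)) - f (h *: u + x) - (f (h *: v + x) - f x) =
    h * (h * 'D_v ('D_u f) (d *: v + (c *: u + x)))].
Proof.
move=> du dv x h; pose g y := f (h *: v + y) - f y.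
have dg y : derivable g y u.
  by apply: derivableB => //; exact: derivable_shift.
have [c ch E] := directional_MVT dg x h.
have [d dh F] := directional_MVT dv (c *: u + x) h.
exists c, d; split => //; rewrite -F.
rewrite -[LHS]/(g (h *: u + x) - g x) E; congr (h * _).
by rewrite (deriveB (derivable_shift (du _)) (du _)) derive_shift.
Qed.

(** The two intermediate points need not coincide: both are within [h * (|u| + |v|)] of x, so
    continuity at x is enough when h tends to 0. *)
Lemma mixed_limit (A B : 'rV[R]_n -> R) u v x :
  {for x, continuous A} -> {for x, continuous B} ->
  (forall h : R, 0 < h -> exists c d c' d',
    [/\ `|c| <= h, `|d| <= h, `|c'| <= h, `|d'| <= h &
      A (d *: v + (c *: u + x)) = B (d' *: u + (c' *: v + x))]) ->
  A x = B x.
Proof.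
move=> cA cB AB; apply/eqP; rewrite -subr_eq0 -normr_le0.
apply/ler_addgt0Pr => e e0; rewrite add0r.
have e20 : 0 < e / 2 by rewrite divr_gt0.
have /nbhs_ballP[r /= r0 rP] : \forall y \near x, `|A x - A y| < e / 2.
  by move/cvgrPdist_lt : cA => /(_ _ e20).
have /nbhs_ballP[s /= s0 sP] : \forall y \near x, `|B x - B y| < e / 2.
  by move/cvgrPdist_lt : cB => /(_ _ e20).
pose K := `|u| + `|v| + 1; have K0 : 0 < K by rewrite ltr_wpDl// addr_ge0.
pose h := Num.min r s / 2 / K; have m0 : 0 < Num.min r s by rewrite lt_min r0.
have h0 : 0 < h by rewrite !divr_gt0.
have near_x (c d : R) w z : `|w| + `|z| <= `|u| + `|v| -> `|c| <= h -> `|d| <= h ->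
    ball x (Num.min r s) (d *: w + (c *: z + x)).
  move=> wz ch dh; rewrite ball_rVE//= addrA opprD addrCA subrr addr0 normrN.
  apply: (@le_lt_trans _ _ (h * K)).
    rewrite (le_trans (ler_normD _ _))// !normrZ.
    apply: (@le_trans _ _ (h * (`|w| + `|z|))); first by rewrite mulrDr lerD// ler_wpM2r.
    by apply: ler_wpM2l; [exact: ltW|rewrite /K (le_trans wz)// lerDl].
  by rewrite /h divfK ?gt_eqF// ltr_pdivrMr// ltr_pMr// ltr1n.
have [c [d [c' [d' [ch dh ch' dh' E]]]]] := AB h h0.
have uv : `|v| + `|u| <= `|u| + `|v| by rewrite addrC.
have [mr ms] : Num.min r s <= r /\ Num.min r s <= s by rewrite !ge_min !lexx orbT.
have h1 := rP _ (le_ball mr (near_x _ _ _ _ uv ch dh)).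
have h2 := sP _ (le_ball ms (near_x _ _ _ _ (lexx _) ch' dh')).
rewrite (splitr e); apply: ltW; rewrite -(subrKA (A (d *: v + (c *: u + x)))).
by rewrite (le_lt_trans (ler_normD _ _))// ltrD// distrC E.
Qed.

(* Clairaut's theorem: both mixed derivatives are limits of the second
   difference quotient. *)
Lemma derive_commute f u v : (forall y, derivable f y u) -> (forall y, derivable f y v) ->
  (forall y, derivable ('D_u f) y v) -> (forall y, derivable ('D_v f) y u) ->
  continuous ('D_v ('D_u f)) -> continuous ('D_u ('D_v f)) ->
  'D_v ('D_u f) = 'D_u ('D_v f).
Proof.
move=> du dv duv dvu cvu cuv; apply/funext => x.
apply: (mixed_limit (u := u) (v := v) (cvu x) (cuv x)) => h h0.
have [c [d [ch dh E]]] := second_difference du duv x h.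
have [c' [d' [ch' dh' F]]] := second_difference dv dvu x h.
rewrite (gtr0_norm h0) in ch dh ch' dh'; exists c, d, c', d'.
split; [exact: ch|exact: dh|exact: ch'|exact: dh'|].
apply: (mulfI (lt0r_neq0 h0)); apply: (mulfI (lt0r_neq0 h0)).
apply: etrans (esym E) _; apply: etrans F; rewrite [h *: u + (h *: v + x)]addrCA.
move: (f (_ + (_ + _))) (f (h *: u + x)) (f (h *: v + x)) (f x) => a1 a2 a3 a4.
by rewrite !opprB addrACA [RHS]addrACA [- _ - _]addrC.
Qed.

(** Only derivatives along the axes are at hand, so y is joined to x by changing one coordinate at a
    time. Each of the n steps costs at most [M * |x - y|]. *)
Lemma partials_lipschitz f (M : R) : (forall i x, derivable f x (delta_mx ord0 i)) ->
  (forall i x, `|partial i f x| <= M) -> forall x y, `|f x - f y| <= n%:R * M * `|x - y|.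
Proof.
move=> df fM x y.
pose p k : 'rV[R]_n := \row_i (if (i < k)%N then x ord0 i else y ord0 i).
have p0 : p 0%N = y by apply/rowP => i; rewrite mxE.
have pn : p n = x by apply/rowP => i; rewrite mxE ltn_ord.
rewrite -{1}p0 -{1}pn {p0 pn}.
have : (n <= n)%N by [].
elim: {1 3 4}n => [|k IH] kn; first by rewrite subrr normr0 !mul0r.
pose i := Ordinal kn.
have -> : p k.+1 = (x ord0 i - y ord0 i) *: delta_mx ord0 i + p k.
  apply/rowP => j; rewrite !mxE eqxx/= eq_sym (_ : (i == j) = (k == j))//.
  rewrite ltnS leq_eqVlt; case: ltngtP => [jk|jk|jk]/=; rewrite ?mulr0 ?add0r//.
  by rewrite mulr1 (_ : j = i) ?subrK//; exact/val_inj.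
have [c _ E] := directional_MVT (df i) (p k) (x ord0 i - y ord0 i).
have -> : k.+1%:R * M * `|x - y| = M * `|x - y| + k%:R * M * `|x - y|.
  by rewrite -natr1 2!mulrDl mul1r addrC.
rewrite -(subrKA (f (p k))) (le_trans (ler_normD _ _))// E.
apply: lerD; last exact: IH (ltnW kn).
rewrite normrM mulrC ler_pM// ?fM//.
by have := rV_coord_le (x - y) i; rewrite !mxE.
Qed.

End directional.

(** * The algebra of smooth functions *)

Section smooth_algebra.
Context (R : realType) (n : nat).
Implicit Types (f g : 'rV[R]_n -> R) (x y : 'rV[R]_n).

(** Smoothness as a greatest fixed point: it suffices to exhibit a class of functions stable under
    [partial], with no formula for iterated derivatives. *)
Lemma smooth_coind (S : set ('rV[R]_n -> R)) :
  (forall f, S f -> [/\ continuous f,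
    forall i x, derivable f x (delta_mx ord0 i) & forall i, S (partial i f)]) ->
  forall f, S f -> smooth f.
Proof.
move=> HS f Sf s; have /HS[cf df _] : S (partials s f).
  by elim: s => //= i s /HS[_ _]; exact.
by split.
Qed.

Lemma smooth_continuous f : smooth f -> continuous f.
Proof. by move=> sf; exact: (sf [::]).1. Qed.

Lemma smooth_derivable f i x : smooth f -> derivable f x (delta_mx ord0 i).
Proof. by move=> sf; exact: (sf [::]).2. Qed.

Lemma smooth_partials f s : smooth f -> smooth (partials s f).
Proof.
move=> sf; apply: (@smooth_coind [set g | exists s, g = partials s f]); last by exists s.
move=> _ [t ->]; have [ct dt] := sf t; split => // i.
by exists (i :: t).
Qed.

Lemma smooth_partial f i : smooth f -> smooth (partial i f).
Proof. exact: (@smooth_partials f [:: i]). Qed.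

(** The class given to [smooth_coind]. Sums are included because the derivative of a product is a
    sum of two products. *)
Inductive smooth_closure : ('rV[R]_n -> R) -> Prop :=
| smooth_closure_smooth f : smooth f -> smooth_closure f
| smooth_closure_add f g : smooth_closure f -> smooth_closure g -> smooth_closure (f + g)
| smooth_closure_mul f g : smooth_closure f -> smooth_closure g -> smooth_closure (f * g).

Lemma partialD f g i x : derivable f x (delta_mx ord0 i) -> derivable g x (delta_mx ord0 i) ->
  partial i (f + g) x = partial i f x + partial i g x.
Proof. exact: deriveD. Qed.

Lemma partialM f g i x : derivable f x (delta_mx ord0 i) -> derivable g x (delta_mx ord0 i) ->
  partial i (f * g) x = partial i f x * g x + f x * partial i g x.
Proof. by move=> df dg; rewrite /partial (deriveM df dg) addrC; congr (_ + _); rewrite mulrC. Qed.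

Lemma smooth_closureP f : smooth_closure f -> smooth f.
Proof.
apply: smooth_coind => {}f; elim=> {f}
  [f sf|f g _ [cf df pf] _ [cg dg pg]|f g sf [cf df pf] sg [cg dg pg]].
- split; [exact: smooth_continuous|by move=> i x; exact: smooth_derivable|].
  by move=> i; apply: smooth_closure_smooth; exact: smooth_partial.
- split.
  + by move=> x; apply: continuousD; [exact: cf|exact: cg].
  + by move=> i x; exact: derivableD.
  + move=> i; rewrite (_ : partial i _ = partial i f + partial i g).
      exact: smooth_closure_add.
    by apply/funext => x; exact: partialD.
- split.
  + by move=> x; apply: continuousM; [exact: cf|exact: cg].
  + by move=> i x; exact: derivableM.
  + move=> i; rewrite (_ : partial i _ = partial i f * g + f * partial i g).
      by apply: smooth_closure_add; exact: smooth_closure_mul.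
    by apply/funext => x; exact: partialM.
Qed.

Lemma smoothD f g : smooth f -> smooth g -> smooth (f + g).
Proof.
by move=> sf sg; apply: smooth_closureP; apply: smooth_closure_add; exact: smooth_closure_smooth.
Qed.

Lemma smoothM f g : smooth f -> smooth g -> smooth (f * g).
Proof.
by move=> sf sg; apply: smooth_closureP; apply: smooth_closure_mul; exact: smooth_closure_smooth.
Qed.

Lemma smooth_cst (c : R) : smooth (cst c : 'rV[R]_n -> R).
Proof.
apply: (@smooth_coind [set f | exists c, f = cst c]); last by exists c.
move=> _ [d ->]; split => [||i]; first exact: cst_continuous.
  by move=> i x; exact: derivable_cst.
by exists 0; apply/funext => x; rewrite /partial derive_cst.
Qed.

Lemma partial_cst (c : R) i x : partial i (cst c : 'rV[R]_n -> R) x = 0.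
Proof. by rewrite /partial derive_cst. Qed.

Lemma smooth_prod (I : eqType) (r : seq I) (P : pred I) (F : I -> 'rV[R]_n -> R) :
  (forall i, P i -> smooth (F i)) -> smooth (\prod_(i <- r | P i) F i).
Proof.
move=> sF; apply: (big_ind (fun f => smooth f)); last exact: sF.
  exact: (smooth_cst 1).
by move=> f g; exact: smoothM.
Qed.

Lemma smooth_sum (I : eqType) (r : seq I) (P : pred I) (F : I -> 'rV[R]_n -> R) :
  (forall i, P i -> smooth (F i)) -> smooth (\sum_(i <- r | P i) F i).
Proof.
move=> sF; apply: (big_ind (fun f => smooth f)); last exact: sF.
  exact: (smooth_cst 0).
by move=> f g; exact: smoothD.
Qed.

Lemma partial_sum (I : eqType) (r : seq I) (P : pred I) (F : I -> 'rV[R]_n -> R) j x :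
  (forall i, P i -> smooth (F i)) ->
  partial j (\sum_(i <- r | P i) F i) x = \sum_(i <- r | P i) partial j (F i) x.
Proof.
move=> sF; elim: r => [|i r IH]; first by rewrite !big_nil; exact: (partial_cst 0).
rewrite !big_cons; case: ifP => // Pi; rewrite partialD ?IH//.
  exact: smooth_derivable (sF _ Pi).
exact: smooth_derivable (smooth_sum _ _).
Qed.

Lemma prod_apply (I : eqType) (r : seq I) (P : pred I) (F : I -> 'rV[R]_n -> R) x :
  (\prod_(i <- r | P i) F i) x = \prod_(i <- r | P i) F i x.
Proof. exact: (big_morph (fun f : 'rV[R]_n -> R => f x)). Qed.

Lemma partial_prod (I : finType) (A : {set I}) (F : I -> 'rV[R]_n -> R) j x :
  (forall i, i \in A -> smooth (F i)) ->
  partial j (\prod_(i in A) F i) x =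
  \sum_(k in A) partial j (F k) x * \prod_(i in A :\ k) F i x.
Proof.
have [m] := ubnP #|A|; elim: m A => // m IH A; rewrite ltnS => Am sF.
have [->|/finset.set0Pn[k kA]] := eqVneq A finset.set0.
  by rewrite !big_set0; exact: (partial_cst 1).
have sFk i : i \in A :\ k -> smooth (F i) by move=> /finset.setD1P[_ /sF].
have sFA : smooth (\prod_(i in A :\ k) F i) by exact: smooth_prod.
rewrite (big_setD1 k kA) partialM; [|exact: smooth_derivable (sF _ kA)|exact: smooth_derivable].
rewrite [RHS](big_setD1 k kA) prod_apply; congr (_ + _).
rewrite IH//; last by rewrite (leq_trans _ Am)// [X in (_ < X)%N](cardsD1 k) kA.
rewrite mulr_sumr; apply: eq_bigr => l /finset.setD1P[lk lA].
have kl : k \in A :\ l by rewrite !inE eq_sym lk.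
rewrite mulrCA; congr (_ * _); rewrite (big_setD1 k kl); congr (_ * _).
by apply: eq_bigl => i; rewrite !inE andbCA.
Qed.

Lemma partial_commute f i j : smooth f -> partial i (partial j f) = partial j (partial i f).
Proof.
move=> sf; apply: derive_commute.
- by move=> y; exact: smooth_derivable.
- by move=> y; exact: smooth_derivable.
- by move=> y; apply: smooth_derivable; exact: smooth_partial.
- by move=> y; apply: smooth_derivable; exact: smooth_partial.
- by apply: smooth_continuous; do 2 apply: smooth_partial.
- by apply: smooth_continuous; do 2 apply: smooth_partial.
Qed.

End smooth_algebra.

(** * Test functions *)

Section test_functions.
Context (R : realType) (n : nat).
Implicit Types (f g : 'rV[R]_n -> R) (x y : 'rV[R]_n).

Lemma closed_cube (B : R) : closed (@cube R n B).
Proof.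
apply: (@preimage_closed _ _ (fun x : 'rV[R]_n => `|x|) [set r | r <= B]); last exact: closed_le.
by move=> x _; exact: norm_continuous.
Qed.

Lemma closure_support f (B : R) : (forall x, f x != 0 -> `|x| <= B) ->
  closure [set x | f x != 0] `<=` cube B.
Proof. by move=> fB; have /closure_id -> := @closed_cube B; exact: closureS. Qed.

Lemma test_functionP f : test_function f <->
  smooth f /\ exists B, forall x, f x != 0 -> `|x| <= B.
Proof.
split=> [[sf cf]|[sf [B fB]]]; split => //.
  have [B _ KB] := pinfty_ex_gt0 (compact_bounded cf).
  by exists B => x fx; apply: KB; exact: subset_closure.
apply: bounded_closed_compact; last exact: closed_closure.
exists B; split; first exact: num_real.
by move=> M /ltW BM x /(closure_support fB) xB; exact: le_trans BM.
Qed.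

Lemma test_functionS f : test_function f -> smooth f. Proof. by case. Qed.

Lemma test_function_mulr f g : test_function f -> smooth g -> test_function (f * g).
Proof.
move=> /test_functionP[sf [B fB]] sg; apply/test_functionP; split; first exact: smoothM.
exists B => x fgx; apply: fB; apply: contraNN fgx => /eqP fx.
by rewrite -[_ x]/(f x * g x) fx mul0r.
Qed.

Lemma test_function_partial f i : test_function f -> test_function (partial i f).
Proof.
move=> tf; have /test_functionP[sf [B fB]] := tf.
apply/test_functionP; split; first exact: smooth_partial.
exists B => x; apply: contraNT; rewrite -ltNge => Bx.
apply/eqP; apply: (@partials_supp _ _ f [:: i]) => /(closure_support fB).
by rewrite /cube/= leNgt Bx.
Qed.

Lemma test_function_affine f (a c : R) x : c != 0 -> test_function f ->
  test_function (fun y => a * f (c *: (x - y))).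
Proof.
move=> c0 /test_functionP[sf [B fB]]; apply/test_functionP; split; first exact: smooth_affine.
exists (`|x| + `|c|^-1 * B) => y; rewrite mulf_eq0 negb_or => /andP[_ /fB].
rewrite normrZ => cB; rewrite -[y](subKr x) (le_trans (ler_normB _ _))// lerD2l.
by rewrite ler_pdivlMl// normr_gt0.
Qed.

Lemma test_function_measurable f : test_function f -> measurable_fun setT f.
Proof. by move=> [sf _]; apply: continuous_measurable_rV; exact: smooth_continuous. Qed.

Lemma test_function_bound f : test_function f ->
  exists2 M, 0 <= M & forall x, `|f x| <= M.
Proof.
move=> /(test_function_bounded 0)[M [M0 fM]].
by exists M => // x; exact: (fM [::]).
Qed.

End test_functions.

(** * Real-valued integrals, changes of variable and Fubini's theorem *)

Section integral_tools.
Context (R : realType) (n : nat).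
Local Notation mu := (@lebesgue_rV R n).
Implicit Types (f g : 'rV[R]_n -> R) (x y : 'rV[R]_n).

Definition intble f := mu.-integrable setT (EFin \o f).

Lemma intble_measurable f : intble f -> measurable_fun setT f.
Proof. by move=> /measurable_int/measurable_EFinP. Qed.

Lemma intble_le f g : measurable_fun setT f -> intble g ->
  (forall x, `|f x| <= g x) -> intble f.
Proof.
move=> mf ig fg; apply: le_integrable ig => //; first exact/measurable_EFinP.
by move=> x _ /=; rewrite lee_fin (le_trans (fg x))// ler_norm.
Qed.

Lemma intble_lty f : measurable_fun setT f -> (forall x, 0 <= f x) ->
  (\int[mu]_x (f x)%:E < +oo)%E -> intble f.
Proof.
move=> mf f0 foo; apply/integrableP; split; first exact/measurable_EFinP.
by under eq_integral do rewrite /= ger0_norm//.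
Qed.

Lemma intbleD f g : intble f -> intble g -> intble (fun x => f x + g x).
Proof. by move=> fi gi; exact: (integrableD measurableT fi gi). Qed.

Lemma intbleB f g : intble f -> intble g -> intble (fun x => f x - g x).
Proof. by move=> fi gi; exact: (integrableB measurableT fi gi). Qed.

Lemma intbleZ c f : intble f -> intble (fun x => c * f x).
Proof. by move=> fi; exact: (integrableZl measurableT c fi). Qed.

Lemma intble_norm f : intble f -> intble (fun x => `|f x|).
Proof. by move=> fi; exact: (integrable_norm fi). Qed.

Lemma intble_sum (I : Type) (r : seq I) (P : pred I) (F : I -> 'rV[R]_n -> R) :
  (forall i, P i -> intble (F i)) -> intble (fun x => \sum_(i <- r | P i) F i x).
Proof.
move=> iF; elim: r => [|i r IH].
  by under eq_fun do rewrite big_nil; exact: integrable0.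
have [Pi|/negbTE nPi] := boolP (P i); last by under eq_fun do rewrite big_cons nPi.
by under eq_fun do rewrite big_cons Pi; apply: intbleD => //; exact: iF.
Qed.

Lemma Rintegral_sum (I : Type) (r : seq I) (P : pred I) (F : I -> 'rV[R]_n -> R) :
  (forall i, P i -> intble (F i)) ->
  \int[mu]_x (\sum_(i <- r | P i) F i x) = \sum_(i <- r | P i) \int[mu]_x F i x.
Proof.
move=> iF; elim: r => [|i r IH].
  by rewrite big_nil; under eq_Rintegral do rewrite big_nil; rewrite Rintegral_cst// mul0r.
rewrite big_cons; have [Pi|/negbTE nPi] := boolP (P i); last first.
  by under eq_Rintegral do rewrite big_cons nPi.
under eq_Rintegral do rewrite big_cons Pi.
by rewrite RintegralD// ?IH//; [exact: iF|exact: intble_sum].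
Qed.

Lemma Rintegral_mull c f : intble f -> \int[mu]_x (c * f x) = c * \int[mu]_x f x.
Proof. by move=> fi; exact: RintegralZl. Qed.

Lemma ler_Rintegral f g : intble f -> intble g -> (forall x, f x <= g x) ->
  \int[mu]_x f x <= \int[mu]_x g x.
Proof. by move=> fi gi fg; exact: le_Rintegral. Qed.

Lemma ler_norm_Rintegral f g : measurable_fun setT f -> intble g -> (forall x, `|f x| <= g x) ->
  `|\int[mu]_x f x| <= \int[mu]_x g x.
Proof.
move=> mf gi fg; have fi := intble_le mf gi fg.
rewrite (le_trans (le_normr_Rintegral _ fi))//.
by apply: ler_Rintegral => //; exact: intble_norm.
Qed.

Lemma intble_affine (a : R) (b : 'rV[R]_n) f : a != 0 -> intble f ->
  intble (fun x => f (a *: x + b)).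
Proof.
move=> a0 /integrableP[mf foo].
have ma := measurable_affine_rV a b; apply/integrableP; split.
  exact: (measurableT_comp mf ma).
have mnf : measurable_fun setT (fun x => `|(EFin \o f) x|%E) by exact: measurableT_comp.
rewrite (@ge0_integral_affine _ _ a b (fun x => `|(EFin \o f) x|%E))//.
by rewrite lte_mul_pinfty// lee_fin invr_ge0 exprn_ge0.
Qed.

Lemma Rintegral_affine (a : R) (b : 'rV[R]_n) f : a != 0 -> intble f ->
  \int[mu]_x f (a *: x + b) = `|a| ^- n * \int[mu]_x f x.
Proof.
move=> a0 fi; rewrite /Rintegral.
have mf : measurable_fun setT (EFin \o f) by case/integrableP: (fi).
have E : (\int[mu]_x (f (a *: x + b))%:E = (`|a| ^- n)%:E * \int[mu]_x (f x)%:E)%E.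
  rewrite [LHS]integralE [in RHS]integralE muleBr//; last first.
    apply: fin_num_adde_defl; rewrite fin_numN.
    exact: (integrable_neg_fin_num measurableT fi).
  congr (_ - _)%E.
    have P := measurable_funepos mf; have P0 := @funepos_ge0 _ R (EFin \o f).
    by rewrite -(ge0_integral_affine b a0 P P0); apply: eq_integral => x _; rewrite !funeposE.
  have N := measurable_funeneg mf; have N0 := @funeneg_ge0 _ R (EFin \o f).
  by rewrite -(ge0_integral_affine b a0 N N0); apply: eq_integral => x _; rewrite !funenegE.
by rewrite E fineM//; exact: integrable_fin_num.
Qed.

Lemma Rintegral_translate f y : intble f -> \int[mu]_x f (x - y) = \int[mu]_x f x.
Proof.
move=> fi; have := Rintegral_affine (- y) (oner_neq0 R) fi.
rewrite normr1 expr1n invr1 mul1r => <-.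
by apply: eq_Rintegral => x _; rewrite scale1r.
Qed.

Lemma Rintegral_reflect f x : intble f -> \int[mu]_y f (x - y) = \int[mu]_y f y.
Proof.
move=> fi; have N10 : -1 != 0 :> R by rewrite oppr_eq0 oner_neq0.
have := Rintegral_affine x N10 fi.
rewrite normrN normr1 expr1n invr1 mul1r => <-.
by apply: eq_Rintegral => y _; rewrite scaleN1r addrC.
Qed.

Lemma intble_reflect f x : intble f -> intble (fun y => f (x - y)).
Proof.
move=> fi; have N10 : -1 != 0 :> R by rewrite oppr_eq0 oner_neq0.
have := intble_affine x N10 fi.
by under eq_fun do rewrite scaleN1r addrC.
Qed.

Lemma intble_translate f y : intble f -> intble (fun x => f (x - y)).
Proof.
move=> fi; have := intble_affine (- y) (oner_neq0 R) fi.
by under eq_fun do rewrite scale1r.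
Qed.

Lemma intble_cube (c B : R) : intble (fun x => c * \1_(cube B) x).
Proof.
apply: intbleZ; apply: intble_lty => //.
  by apply: measurable_indic; exact: measurable_cube0.
rewrite integral_indic ?setIT//; last exact: measurable_cube0.
have [B0|B0] := leP 0 B; first by rewrite [X in (X < _)%E](lebesgue_cube n B0) ltry.
rewrite (_ : cube B = set0) ?measure0//; apply/seteqP; split => // x.
by rewrite /cube/= leNgt (lt_le_trans B0).
Qed.

(** Every section is required to be integrable, not almost every one: each inner real integral is
    then the value of a finite extended integral. *)
Lemma Rfubini (f : 'rV[R]_n -> 'rV[R]_n -> R) :
  measurable_fun setT (fun z => f z.1 z.2) ->
  (forall x, intble (f x)) -> (forall y, intble (f ^~ y)) ->
  (\int[mu]_x \int[mu]_y (`|f x y|)%:E < +oo)%E ->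
  \int[mu]_x (\int[mu]_y f x y) = \int[mu]_y (\int[mu]_x f x y).
Proof.
move=> mf fx fy foo.
pose F (z : 'rV[R]_n * 'rV[R]_n) := (f z.1 z.2)%:E.
have iF : (mu \x mu)%E.-integrable setT F.
  by apply/integrable12ltyP => //; exact/measurable_EFinP.
rewrite /Rintegral; congr fine.
transitivity (\int[mu]_x \int[mu]_y F (x, y))%E.
  by apply: eq_integral => x _; rewrite fineK//; exact: (integrable_fin_num measurableT (fx x)).
rewrite (Fubini iF).
by apply: eq_integral => y _; rewrite fineK//; exact: (integrable_fin_num measurableT (fy y)).
Qed.

Lemma Rfubini_intble (f : 'rV[R]_n -> 'rV[R]_n -> R) :
  measurable_fun setT (fun z => f z.1 z.2) -> (forall y, intble (f ^~ y)) ->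
  (\int[mu]_x \int[mu]_y (`|f x y|)%:E < +oo)%E ->
  intble (fun y => \int[mu]_x f x y).
Proof.
move=> mf fy foo.
pose F (z : 'rV[R]_n * 'rV[R]_n) := (f z.1 z.2)%:E.
have mF : measurable_fun setT F by exact/measurable_EFinP.
have mnF : measurable_fun setT (fun z => `|F z|%E) by exact: measurableT_comp.
have iF : (mu \x mu)%E.-integrable setT F by exact/integrable12ltyP.
have E y : (\int[mu]_x f x y)%:E = (\int[mu]_x F (x, y))%E.
  by rewrite fineK//; exact: (integrable_fin_num measurableT (fy y)).
have mG : measurable_fun setT (EFin \o (fun y => \int[mu]_x f x y)).
  by have mG := measurable_fubini_G iF; rewrite (_ : _ \o _ = fubini_G mu F)//; exact/funext.
apply/integrableP; split => //; apply: le_lt_trans foo.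
rewrite (@fubini_tonelli _ _ _ _ _ mu mu (fun z => `|F z|%E))//.
apply: ge0_le_integral => //.
- exact: measurableT_comp.
- by have := @measurable_fun_fubini_tonelli_G _ _ _ _ _ mu _ mnF; apply.
- move=> y _; rewrite [(_ \o _) y]E.
  by apply: le_abse_integral => //; case/integrableP: (fy y).
Qed.

End integral_tools.

(** * Convolutions and weak gradients *)

Section weak_closure.
Context (R : realType) (n q : nat).
Local Notation mu := (@lebesgue_rV R n).
Implicit Types (f g H V b K : 'rV[R]_n -> R) (x y z : 'rV[R]_n).

Definition in_Lp f := measurable_fun setT f /\ (pow_int q.+1 f < +oo)%E.

(** Membership of H in the dual space L^((q+1)/q), with bounded support, stated without fractional
    exponents. Minors of order q of a matrix with entries in L^(q+1) have this form. *)
Definition compactly_dominated H b (B : R) :=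
  [/\ measurable_fun setT H, in_Lp b, (forall x, 0 <= b x),
      (forall x, `|H x| <= b x ^+ q) & (forall x, H x != 0 -> `|x| <= B)].

(** Young's inequality without sharp constants: the smaller of a and c is replaced by the larger. *)
Lemma young (a c : R) : 0 <= a -> 0 <= c -> a ^+ q * c <= a ^+ q.+1 + c ^+ q.+1.
Proof.
move=> a0 c0; have [ac|/ltW ca] := leP c a.
  by rewrite -[leLHS]addr0 lerD ?exprn_ge0// exprSr ler_wpM2l// exprn_ge0.
rewrite -[leLHS]add0r lerD ?exprn_ge0// exprSr ler_wpM2r//.
by rewrite lerXn2r ?nnegrE.
Qed.

Lemma in_Lp_intble f : in_Lp f -> intble (fun x => `|f x| ^+ q.+1).
Proof.
move=> [mf foo]; apply: intble_lty => //.
by apply: measurable_funX; exact: measurableT_comp.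
Qed.

Lemma Rintegral_pow_le f (e : R) : in_Lp f -> (pow_int q.+1 f <= e%:E)%E ->
  \int[mu]_x (`|f x| ^+ q.+1) <= e.
Proof.
move=> Lf fe; rewrite -lee_fin fineK//.
exact: (integrable_fin_num measurableT (in_Lp_intble Lf)).
Qed.

Lemma in_Lp_translate f y : in_Lp f -> in_Lp (fun x => f (x - y)).
Proof. by move=> [mf foo]; split; [exact: measurable_fun_translate|rewrite pow_int_translate]. Qed.

Lemma in_Lp_local f (B : R) : in_Lp f -> intble (fun x => `|f x| * \1_(cube B) x).
Proof.
move=> [mf foo].
have i1 := intbleD (intble_cube n 1 B) (in_Lp_intble (conj mf foo)).
apply: intble_le i1 _.
  apply: measurable_funM; first exact: measurableT_comp.
  by apply: measurable_indic; exact: measurable_cube0.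
move=> x; rewrite indicE; case: (_ \in _); rewrite ?(mulr1, mulr0, normr0, normr_id, add0r, exprn_ge0)//.
by have := young ler01 (normr_ge0 (f x)); rewrite !expr1n mul1r.
Qed.

Lemma compactly_dominated_intble H b B : compactly_dominated H b B -> intble H.
Proof.
move=> [mH Lb b0 Hb HB].
apply: intble_le mH (intbleD (intble_cube n 1 B) (in_Lp_intble Lb)) _ => x.
have [->|Hx] := eqVneq (H x) 0; first by rewrite normr0 addr_ge0// ?exprn_ge0// mul1r indicE.
rewrite indicE (_ : x \in _ = true) ?mulr1; last exact/mem_set/HB.
by rewrite (le_trans (Hb x))// ger0_norm// addrC -[X in _ + X](expr1n _ q.+1) -[leLHS]mulr1 young.
Qed.

Lemma compactly_dominated_mul_le H b B g x : compactly_dominated H b B ->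
  `|H x * g x| <= `|b x| ^+ q.+1 + `|g x| ^+ q.+1.
Proof.
move=> [_ _ b0 Hb _]; rewrite normrM (ger0_norm (b0 x)).
by rewrite (le_trans _ (young (b0 x) (normr_ge0 _)))// ler_wpM2r.
Qed.

Lemma compactly_dominated_mul H b B g : compactly_dominated H b B -> in_Lp g ->
  intble (fun x => H x * g x).
Proof.
move=> cH Lg; have [mH Lb b0 Hb HB] := cH.
apply: intble_le (intbleD (in_Lp_intble Lb) (in_Lp_intble Lg)) _.
  by apply: measurable_funM => //; exact: Lg.1.
by move=> x; exact: compactly_dominated_mul_le cH.
Qed.

(** Weights in Young's inequality replace Hölder's inequality: [b ^+ q * |D|] equals
    [(t * b) ^+ q * (|D| / s)] for [s = t ^+ q]. A small t, fixed beforehand, makes the term in b at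
    most d / 2; then r is chosen so that the increment D of g is small enough in L^(q+1) for the
    other term. *)
Lemma translation_pairing_cont H b B g : compactly_dominated H b B -> in_Lp g ->
  forall d : R, 0 < d -> exists r, 0 < r /\ forall y, `|y| <= r ->
    `|\int[mu]_x (H x * g (x - y)) - \int[mu]_x (H x * g x)| <= d.
Proof.
move=> cH Lg d d0; have [mH Lb b0 Hb HB] := cH; have [mg goo] := Lg.
pose I := \int[mu]_x (`|b x| ^+ q.+1).
have I0 : 0 <= I by apply: Rintegral_ge0 => x _; rewrite exprn_ge0.
pose t := Num.min 1 (d / 2 / (I + 1)).
have t0 : 0 < t by rewrite lt_min ltr01 !divr_gt0// ltr_wpDl.
have t1 : t <= 1 by rewrite ge_min lexx.
have tI : t ^+ q.+1 * I <= d / 2.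
  apply: (@le_trans _ _ (t * (I + 1))).
    have tq : t ^+ q.+1 <= t.
      by rewrite exprS; apply: ler_piMr; [exact: ltW|apply: exprn_ile1 => //; exact: ltW].
    by apply: ler_pM => //; [apply: exprn_ge0; exact: ltW|rewrite lerDl].
  by rewrite -ler_pdivlMr ?ltr_wpDl// ge_min lexx orbT.
pose s := t ^+ q; have s0 : 0 < s by rewrite exprn_gt0.
have e0 : 0 < d / 2 * s ^+ q.+1 by rewrite mulr_gt0 ?divr_gt0// exprn_gt0.
have [_ /(_ _ e0)[r [r0 rg]]] := pow_int_lty_translation_cont (ltn0Sn q) mg goo.
exists r; split => // y /rg gy.
pose D x := g (x - y) - g x.
have mD : measurable_fun setT D by apply: measurable_funB => //; exact: measurable_fun_translate.
have LD : in_Lp D by split => //; apply: le_lt_trans gy _; rewrite ltry.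
have iHy := compactly_dominated_mul cH (in_Lp_translate y Lg).
rewrite -RintegralB//; last exact: compactly_dominated_mul cH Lg.
rewrite (_ : \int[mu]_x _ = \int[mu]_x (H x * D x)); last first.
  by apply: eq_Rintegral => x _; rewrite mulrBr.
pose G x := t ^+ q.+1 * `|b x| ^+ q.+1 + s ^- q.+1 * `|D x| ^+ q.+1.
have iG : intble G by apply: intbleD; apply: intbleZ; exact: in_Lp_intble.
apply: (@le_trans _ _ (\int[mu]_x G x)).
  apply: ler_norm_Rintegral => //; first exact: measurable_funM.
  move=> x; rewrite normrM.
  have tb0 : 0 <= t * b x by rewrite mulr_ge0// ltW.
  have Ds0 : 0 <= `|D x| / s by rewrite divr_ge0// ltW.
  have E : (t * b x) ^+ q * (`|D x| / s) = b x ^+ q * `|D x|.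
    by rewrite exprMn -/s; field; rewrite gt_eqF.
  apply: (@le_trans _ _ (b x ^+ q * `|D x|)); first by rewrite ler_wpM2r.
  rewrite -E (le_trans (young tb0 Ds0))// /G (ger0_norm (b0 x)) !exprMn exprVn.
  by rewrite [X in _ + X]mulrC.
rewrite /G RintegralD//; try by apply: intbleZ; exact: in_Lp_intble.
rewrite !RintegralZl//; try exact: in_Lp_intble.
rewrite (splitr d); apply: lerD => //.
rewrite mulrC ler_pdivrMr ?exprn_gt0//; exact: Rintegral_pow_le.
Qed.

Lemma bounded_support_dominated K (M B : R) z : 0 <= M -> (forall x, `|K x| <= M) ->
  (forall x, K x != 0 -> `|x| <= B) -> forall x V, `|V z * K (x - z)| <=
  M * (`|V z| * \1_(cube (`|x| + B)) z).
Proof.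
move=> M0 KM KB x V; have [->|Kx] := eqVneq (K (x - z)) 0.
  by rewrite mulr0 normr0 !mulr_ge0// indicE.
rewrite normrM indicE (_ : z \in _ = true) ?mulr1; first by rewrite mulrC ler_wpM2r.
apply/mem_set; rewrite /cube/= -[z](subKr x) (le_trans (ler_normB _ _))// lerD2l.
exact: KB.
Qed.

Lemma convolution_intble K V (M B : R) x : measurable_fun setT K -> 0 <= M ->
  (forall x, `|K x| <= M) -> (forall x, K x != 0 -> `|x| <= B) -> in_Lp V ->
  intble (fun z => V z * K (x - z)).
Proof.
move=> mK M0 KM KB LV; have iV := intbleZ M (in_Lp_local (`|x| + B) LV).
apply: intble_le iV _ => [|z]; last exact: bounded_support_dominated.
apply: measurable_funM; first exact: LV.1.
apply: measurableT_comp => //; apply: measurable_rV => i.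
by under eq_fun do rewrite !mxE; apply: measurable_funB => //; exact: measurable_coord.
Qed.

Lemma measurable_subr2 : measurable_fun setT (fun z : 'rV[R]_n * 'rV[R]_n => z.1 - z.2).
Proof.
apply: measurable_rV => i; under eq_fun do rewrite !mxE.
apply: measurable_funB.
  exact: measurableT_comp (@measurable_coord R n i) measurable_fst.
exact: measurableT_comp (@measurable_coord R n i) measurable_snd.
Qed.

(** Fubini's theorem moves the kernel from V to H. Where H and K do not vanish, z lies in the cube
    of radius B + B', on which V is integrable; hence the integrable majorant [|H x| * G z]. *)
Lemma convolution_swap H b B K V (M B' : R) : compactly_dominated H b B ->
  measurable_fun setT K -> 0 <= M ->
  (forall x, `|K x| <= M) -> (forall x, K x != 0 -> `|x| <= B') -> in_Lp V ->
  intble (fun z => V z * \int[mu]_x (H x * K (x - z))) /\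
  \int[mu]_x (H x * \int[mu]_z (V z * K (x - z))) =
  \int[mu]_z (V z * \int[mu]_x (H x * K (x - z))).
Proof.
move=> cH mK M0 KM KB LV; have [mH Lb b0 Hb HB] := cH; have [mV _] := LV.
have iH := compactly_dominated_intble cH.
pose G z := M * (`|V z| * \1_(cube (B + B')) z).
have iG : intble G by apply: intbleZ; exact: in_Lp_local.
have G0 z : 0 <= G z by rewrite /G !mulr_ge0// indicE.
have le x z : `|H x * (V z * K (x - z))| <= `|H x| * G z.
  have [->|Hx] := eqVneq (H x) 0; first by rewrite mul0r normr0 mul0r.
  rewrite normrM ler_wpM2l// (le_trans (bounded_support_dominated z M0 KM KB x V))//.
  rewrite ler_wpM2l// ler_wpM2l// !indicE ler_nat.
  have [/set_mem zx|//] := boolP (z \in cube (`|x| + B')).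
  by rewrite (_ : z \in cube (B + B') = true)//; apply/mem_set/(le_trans zx); rewrite lerD2r HB.
have iKx x : intble (fun z => V z * K (x - z)) by exact: (convolution_intble x mK M0 KM KB LV).
have iKz z : intble (fun x => H x * K (x - z)).
  apply: intble_le (intbleZ M (intble_norm iH)) _.
    by apply: measurable_funM => //; exact: measurable_fun_translate.
  by move=> x; rewrite normrM mulrC ler_wpM2r.
have mf : measurable_fun setT (fun p : 'rV[R]_n * 'rV[R]_n => H p.1 * (V p.2 * K (p.1 - p.2))).
  apply: measurable_funM; first by apply: measurableT_comp => //; exact: measurable_fst.
  apply: measurable_funM; first by apply: measurableT_comp => //; exact: measurable_snd.
  by apply: measurableT_comp => //; exact: measurable_subr2.
have ix x : intble (fun z => H x * (V z * K (x - z))) by exact: intbleZ.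
have iz z : intble (fun x => H x * (V z * K (x - z))).
  by under eq_fun do rewrite mulrCA; exact: intbleZ.
have foo : (\int[mu]_x \int[mu]_z `|H x * (V z * K (x - z))|%:E < +oo)%E.
  apply: (@le_lt_trans _ _ (\int[mu]_x (`|H x|%:E * \int[mu]_z (G z)%:E))%E).
    have mG : measurable_fun setT (fun z => (G z)%:E) by case/integrableP: (iG).
    apply: ge0_le_integral => //.
    + by move=> x _; apply: integral_ge0 => z _; rewrite lee_fin.
    + apply: (@measurable_fun_fubini_tonelli_F _ _ _ _ _ mu
        (fun p => (`|H p.1 * (V p.2 * K (p.1 - p.2))|)%:E)); last by move=> p; rewrite lee_fin.
      by apply/measurable_EFinP; exact: measurableT_comp.
    + by apply: emeasurable_funM => //; apply/measurable_EFinP; exact: measurableT_comp.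
    + move=> x _; rewrite -ge0_integralZl// => [|z _]; last by rewrite lee_fin.
      apply: ge0_le_integral => //.
      * apply/measurable_EFinP; apply: measurableT_comp => //.
        by apply: measurable_funM => //; exact: intble_measurable.
      * exact: measurable_funeM.
      * by move=> z _; rewrite -EFinM lee_fin.
  rewrite ge0_integralZr//.
  - rewrite lte_mul_pinfty//.
    + by apply: integral_ge0 => x _; rewrite lee_fin.
    + exact: (integrable_fin_num measurableT (intble_norm iH)).
    + by have /integrableP[_] := iG; under eq_integral do rewrite gee0_abs ?lee_fin//.
  - by apply/measurable_EFinP; exact: measurableT_comp.
  - by apply: integral_ge0 => z _; rewrite lee_fin.
have E z : \int[mu]_x (H x * (V z * K (x - z))) = V z * \int[mu]_x (H x * K (x - z)).
  by rewrite -(Rintegral_mull _ (iKz z)); apply: eq_Rintegral => x _; rewrite mulrCA.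
split; first by rewrite -(funext E); exact: Rfubini_intble.
transitivity (\int[mu]_x \int[mu]_z (H x * (V z * K (x - z)))).
  by apply: eq_Rintegral => x _; rewrite (Rintegral_mull _ (iKx x)).
by rewrite Rfubini//; exact: eq_Rintegral.
Qed.

(** The substitution z = x - y, then Fubini's theorem. By Young's inequality and translation
    invariance, the inner integral of [|H x * g (x - y)|] is at most C, whatever y. *)
Lemma convolution_translate H b B K g (M B' : R) : compactly_dominated H b B ->
  measurable_fun setT K -> 0 <= M -> intble K ->
  (forall x, `|K x| <= M) -> (forall x, K x != 0 -> `|x| <= B') -> in_Lp g ->
  intble (fun y => K y * \int[mu]_x (H x * g (x - y))) /\
  \int[mu]_x (H x * \int[mu]_z (g z * K (x - z))) =
  \int[mu]_y (K y * \int[mu]_x (H x * g (x - y))).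
Proof.
move=> cH mK M0 iK KM KB Lg; have [mH Lb b0 Hb HB] := cH; have [mg _] := Lg.
have ic x : intble (fun z => g z * K (x - z)) by exact: (convolution_intble x mK M0 KM KB Lg).
have icr x : intble (fun y => g (x - y) * K y).
  by have := intble_reflect x (ic x); under eq_fun do rewrite subKr.
have mf : measurable_fun setT (fun p : 'rV[R]_n * 'rV[R]_n => H p.1 * (g (p.1 - p.2) * K p.2)).
  apply: measurable_funM; first by apply: measurableT_comp => //; exact: measurable_fst.
  apply: measurable_funM; first by apply: measurableT_comp => //; exact: measurable_subr2.
  by apply: measurableT_comp => //; exact: measurable_snd.
have iHg y : intble (fun x => H x * g (x - y)).
  by apply: compactly_dominated_mul cH _; exact: in_Lp_translate.
have ix x : intble (fun y => H x * (g (x - y) * K y)) by exact: intbleZ.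
have iy y : intble (fun x => H x * (g (x - y) * K y)).
  rewrite (_ : (fun x => _) = fun x => K y * (H x * g (x - y))); first exact: intbleZ.
  by apply/funext => x; rewrite mulrA mulrC.
have foo : (\int[mu]_x \int[mu]_y `|H x * (g (x - y) * K y)|%:E < +oo)%E.
  have mF : measurable_fun setT (fun p : 'rV[R]_n * 'rV[R]_n => (`|H p.1 * (g (p.1 - p.2) * K p.2)|)%:E).
    by apply/measurable_EFinP; exact: measurableT_comp.
  rewrite (@fubini_tonelli _ _ _ _ _ mu mu (fun p => (`|H p.1 * (g (p.1 - p.2) * K p.2)|)%:E))//=.
  pose C := (\int[mu]_x (`|b x| ^+ q.+1)%:E + \int[mu]_x (`|g x| ^+ q.+1)%:E)%E.
  have mb := measurable_pow q.+1 Lb.1.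
  apply: (@le_lt_trans _ _ (\int[mu]_y (`|K y|%:E * C))%E).
    apply: ge0_le_integral => //.
    + by move=> y _; apply: integral_ge0 => z _; rewrite lee_fin.
    + have mG := @measurable_fun_fubini_tonelli_G _ _ _ _ _ mu _ mF.
      by apply: mG => p; rewrite lee_fin.
    + by apply: emeasurable_funM => //; apply/measurable_EFinP; exact: measurableT_comp.
    + move=> y _.
      have mgy := measurable_pow q.+1 (measurable_fun_translate y mg).
      have -> : C = (\int[mu]_x ((`|b x| ^+ q.+1)%:E + (`|g (x - y)| ^+ q.+1)%:E))%E.
        rewrite ge0_integralD//; congr (_ + _)%E.
        exact: (esym (pow_int_translate q.+1 y mg)).
      rewrite -ge0_integralZl//.
      * apply: ge0_le_integral => //.
        - apply/measurable_EFinP; apply: measurableT_comp => //.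
          apply: measurable_funM => //; apply: measurable_funM => //.
          exact: measurable_fun_translate.
        - by apply: measurable_funeM; exact: emeasurable_funD.
        - move=> x _; rewrite -EFinD -EFinM lee_fin mulrA normrM mulrC ler_wpM2l//.
          exact: (compactly_dominated_mul_le (fun x => g (x - y)) x cH).
      * exact: emeasurable_funD.
      * by move=> x _; rewrite -EFinD lee_fin addr_ge0// exprn_ge0.
  rewrite ge0_integralZr//.
  - rewrite lte_mul_pinfty//.
    + by apply: integral_ge0 => x _; rewrite lee_fin.
    + exact: (integrable_fin_num measurableT (intble_norm iK)).
    + by rewrite lte_add_pinfty//; [exact: Lb.2|exact: Lg.2].
  - by apply/measurable_EFinP; exact: measurableT_comp.
  - by rewrite adde_ge0//; exact: pow_int_ge0.
have E y : \int[mu]_x (H x * (g (x - y) * K y)) = K y * \int[mu]_x (H x * g (x - y)).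
  by rewrite -(Rintegral_mull _ (iHg y)); apply: eq_Rintegral => x _; rewrite mulrA mulrC.
split; first by rewrite -(funext E); exact: Rfubini_intble.
transitivity (\int[mu]_x \int[mu]_y (H x * (g (x - y) * K y))).
  apply: eq_Rintegral => x _; rewrite (Rintegral_mull _ (icr x)); congr (_ * _).
  rewrite -(Rintegral_reflect x (ic x)).
  by apply: eq_Rintegral => y _; rewrite subKr.
by rewrite Rfubini//; exact: eq_Rintegral.
Qed.

End weak_closure.

(** * Passing from gradients of test functions to weak gradients *)

Section weak_gradient_pairing.
Context (R : realType) (n q : nat).
Local Notation mu := (@lebesgue_rV R n).
Implicit Types (f g H V b K : 'rV[R]_n -> R) (x y z : 'rV[R]_n).

Lemma partial_affine f (a c : R) x j y : c != 0 -> smooth f ->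
  partial j (fun z => a * f (c *: (x - z))) y = - (a * c) * partial j f (c *: (x - y)).
Proof. by move=> c0 sf; have /= -> := partials_affine a x [:: j] c0 sf; rewrite mulrN. Qed.

Lemma test_function_support phi : test_function phi ->
  exists B, forall s x, partials s phi x != 0 -> `|x| <= B.
Proof.
move=> /test_functionP[sphi [B phiB]]; exists B => s x; apply: contraNT; rewrite -ltNge => Bx.
apply/eqP; apply: partials_supp => /(closure_support phiB).
by rewrite /cube/= leNgt Bx.
Qed.

Lemma test_function_reflect K x : test_function K -> test_function (fun z => K (x - z)).
Proof.
move=> tK; rewrite (_ : (fun z => _) = fun z => 1 * K (1 *: (x - z))).
  exact: test_function_affine.
by apply/funext => z; rewrite mul1r scale1r.
Qed.

Lemma partial_reflect K x j z : smooth K ->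
  partial j (fun z => K (x - z)) z = - partial j K (x - z).
Proof.
move=> sK; rewrite (_ : (fun z => _) = fun z => 1 * K (1 *: (x - z))).
  by rewrite partial_affine// scale1r mulr1 mulN1r.
by apply/funext => {}z; rewrite mul1r scale1r.
Qed.

Lemma test_function_translate K z : test_function K -> test_function (fun x => K (x - z)).
Proof.
move=> tK; rewrite (_ : (fun x => _) = fun x => 1 * K (-1 *: (z - x))).
  by apply: test_function_affine => //; rewrite oppr_eq0 oner_neq0.
by apply/funext => x; rewrite mul1r scaleN1r opprB.
Qed.

Lemma partial_translate K z j x : smooth K ->
  partial j (fun x => K (x - z)) x = partial j K (x - z).
Proof.
move=> sK; rewrite (_ : (fun x => _) = fun x => 1 * K (-1 *: (z - x))).
  by rewrite partial_affine ?oppr_eq0 ?oner_neq0// mul1r opprK mul1r scaleN1r opprB.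
by apply/funext => {}x; rewrite mul1r scaleN1r opprB.
Qed.

Lemma test_function_scale K (e : R) : e != 0 -> test_function K ->
  test_function (fun x => K (e *: x)).
Proof.
move=> e0 tK; rewrite (_ : (fun x => _) = fun x => 1 * K (- e *: (0 - x))).
  by apply: test_function_affine => //; rewrite oppr_eq0.
by apply/funext => x; rewrite mul1r sub0r scalerN scaleNr opprK.
Qed.

Lemma test_function_compact K : test_function K -> exists M B,
  [/\ measurable_fun setT K, 0 <= M, forall x, `|K x| <= M & forall x, K x != 0 -> `|x| <= B].
Proof.
move=> tK; have [M M0 KM] := test_function_bound tK.
have /test_functionP[sK [B KB]] := tK.
by exists M, B; split => //; exact: test_function_measurable.
Qed.

Lemma test_function_intble K : test_function K -> intble K.
Proof.
move=> /test_function_compact[M [B [mK M0 KM KB]]].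
apply: intble_le mK (intble_cube n M B) _ => x.
have [->|Kx] := eqVneq (K x) 0; first by rewrite normr0 mulr_ge0// indicE.
by rewrite indicE (_ : x \in _ = true) ?mulr1//; exact/mem_set/KB.
Qed.

Lemma in_Lp_test_function_intble V K : in_Lp q V -> test_function K ->
  intble (fun x => V x * K x).
Proof.
move=> LV /test_function_compact[M [B [mK M0 KM KB]]].
apply: intble_le (intbleZ M (in_Lp_local B LV)) _.
  by apply: measurable_funM => //; exact: LV.1.
move=> x; have [->|Kx] := eqVneq (K x) 0.
  by rewrite mulr0 normr0 !mulr_ge0// indicE.
rewrite indicE (_ : x \in _ = true) ?mulr1; last exact/mem_set/KB.
by rewrite normrM mulrC ler_wpM2r.
Qed.

(** The function [z |-> K (x - z)] is a test function; the sign from its derivative cancels the sign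
    in [weak_partial]. *)
Lemma convolution_weak_partial V g K j x : test_function K ->
  in_Lp q V -> weak_partial j V g ->
  \int[mu]_z (g z * K (x - z)) = \int[mu]_z (V z * partial j K (x - z)).
Proof.
move=> tK LV wVg; have := wVg _ (test_function_reflect x tK).
move=> /(congr1 -%R); rewrite opprK => <-; rewrite -mulN1r -Rintegral_mull.
  apply: eq_Rintegral => z _; rewrite partial_reflect; last exact: test_functionS.
  by rewrite mulrN mulN1r opprK.
by apply: in_Lp_test_function_intble => //; apply: test_function_partial; exact: test_function_reflect.
Qed.

(** The derivative is put on the kernel and V is pulled out by [convolution_swap]. What remains for
    fixed z is the hypothesis for the test function [v x = K (x - z)]. *)
Lemma convolution_pairing_eq0 (H : 'I_n -> 'rV[R]_n -> R) b (B : R) V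
    (g : 'I_n -> 'rV[R]_n -> R) K :
  (forall j, compactly_dominated q (H j) b B) ->
  in_Lp q V -> (forall j, in_Lp q (g j)) -> (forall j, weak_partial j V (g j)) ->
  (forall v, test_function v -> \sum_j \int[mu]_x (H j x * partial j v x) = 0) ->
  test_function K ->
  \sum_j \int[mu]_y (K y * \int[mu]_x (H j x * g j (x - y))) = 0.
Proof.
move=> cH LV Lg wg Hv tK.
have [M [B' [mK M0 KM KB]]] := test_function_compact tK.
have iK := test_function_intble tK.
have swap j : intble (fun z => V z * \int[mu]_x (H j x * partial j K (x - z))) /\
    \int[mu]_y (K y * \int[mu]_x (H j x * g j (x - y))) =
    \int[mu]_z (V z * \int[mu]_x (H j x * partial j K (x - z))).
  have [_ <-] := convolution_translate (cH j) mK M0 iK KM KB (Lg j).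
  have [M' [B'' [mdK M'0 dKM dKB]]] := test_function_compact (test_function_partial j tK).
  have [iV <-] := convolution_swap (cH j) mdK M'0 dKM dKB LV; split; first exact: iV.
  by apply: eq_Rintegral => x _; rewrite (convolution_weak_partial _ tK LV (wg j)).
rewrite (eq_bigr _ (fun j _ => (swap j).2)) -Rintegral_sum => [|j _]; last exact: (swap j).1.
transitivity (\int[mu]_z (0 : R)); last by rewrite Rintegral_cst// mul0r.
apply: eq_Rintegral => z _; rewrite -mulr_sumr; apply/eqP; rewrite mulf_eq0; apply/orP; right.
apply/eqP; apply: etrans (Hv _ (test_function_translate z tK)); apply: eq_bigr => j _.
by apply: eq_Rintegral => x _; rewrite partial_translate//; exact: test_functionS.
Qed.

(* Mollifying [V] by [eta] at scale [e], the pairing with the mollified gradient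
   vanishes by Fubini's theorem, and it tends to the pairing with [g]. *)
Lemma weak_gradient_pairing (eta : 'rV[R]_n -> R) (H : 'I_n -> 'rV[R]_n -> R) b (B : R) V
    (g : 'I_n -> 'rV[R]_n -> R) :
  test_function eta -> \int[mu]_x eta x != 0 ->
  (forall j, compactly_dominated q (H j) b B) ->
  in_Lp q V -> (forall j, in_Lp q (g j)) -> (forall j, weak_partial j V (g j)) ->
  (forall v, test_function v -> \sum_j \int[mu]_x (H j x * partial j v x) = 0) ->
  \sum_j \int[mu]_x (H j x * g j x) = 0.
Proof.
move=> teta eta0 cH LV Lg wg Hv; set S := \sum_j _.
pose I := \int[mu]_x eta x; pose J := \int[mu]_x `|eta x|.
have J0 : 0 <= J by exact: Rintegral_ge0.
(* Here d bounds the oscillation of each of the n pairings under small translations of g, and J is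
   the integral of [|eta|]. *)
suff SI d : 0 < d -> `|S| * `|I| <= d * (n%:R * J).
  apply/eqP; rewrite -(mulIr_eq0 _ (mulIf eta0)) -normr_le0 normrM.
  apply/ler_addgt0Pr => e e0; rewrite add0r.
  have nJ0 : 0 < n%:R * J + 1 by rewrite ltr_wpDl// mulr_ge0.
  apply: le_trans (SI _ (divr_gt0 e0 nJ0)) _.
  by rewrite mulrAC ler_pdivrMr// ler_wpM2l ?lerDl// ltW.
move=> d0.
have /choice[r rP] j := translation_pairing_cont (cH j) (Lg j) d0.
pose r0 := \big[Num.min/1]_j r j.
have r00 : 0 < r0 by apply: lt_bigmin => // j _; exact: (rP j).1.
have [M [B' [meta M0 etaM etaB]]] := test_function_compact teta.
(* The scale at which [K] is supported in the cube of radius r0, where all the pairings oscillate by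
   at most d. *)
pose e := (`|B'| + 1) / r0; have e0 : 0 < e by rewrite divr_gt0// ltr_wpDl.
pose K x := eta (e *: x).
have tK : test_function K by apply: test_function_scale => //; rewrite gt_eqF.
have iK := test_function_intble tK.
have KB x : K x != 0 -> `|x| <= r0.
  move=> /etaB; rewrite normrZ gtr0_norm// -ler_pdivlMl// => /le_trans; apply.
  rewrite /e invf_div mulrAC ler_pdivrMr ?ltr_wpDl// ler_wpM2l ?ltW//.
  by rewrite (le_lt_trans (ler_norm _))// ltrDl.
pose c : R := `|e| ^- n; have c0 : 0 < c by rewrite invr_gt0 exprn_gt0// normr_gt0 gt_eqF.
have intK : \int[mu]_x K x = c * I.
  rewrite -(Rintegral_affine 0 (lt0r_neq0 e0) (test_function_intble teta)).
  by apply: eq_Rintegral => x _; rewrite addr0.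
have intnK : \int[mu]_x `|K x| = c * J.
  rewrite -(Rintegral_affine 0 (lt0r_neq0 e0) (intble_norm (test_function_intble teta))).
  by apply: eq_Rintegral => x _; rewrite addr0.
have [MK [BK [mK MK0 KMK KBK]]] := test_function_compact tK.
have iKP j : intble (fun y => K y * \int[mu]_x (H j x * g j (x - y))).
  exact: (convolution_translate (cH j) mK MK0 iK KMK KBK (Lg j)).1.
rewrite -(ler_pM2l c0) mulrCA -(gtr0_norm c0) -normrM -normrM -intK.
(* The subtracted terms add up to 0 by [convolution_pairing_eq0]; they turn each pairing into an
   increment. *)
have -> : S * \int[mu]_x K x = \sum_j \int[mu]_y (K y * \int[mu]_x (H j x * g j x) -
    K y * \int[mu]_x (H j x * g j (x - y))).
  transitivity (\sum_j (\int[mu]_y (K y * \int[mu]_x (H j x * g j x)) -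
      \int[mu]_y (K y * \int[mu]_x (H j x * g j (x - y))))).
    rewrite sumrB (convolution_pairing_eq0 cH LV Lg wg Hv tK) subr0 mulr_suml.
    apply: eq_bigr => j _; rewrite -(Rintegral_mull _ iK).
    by apply: eq_Rintegral => y _; exact: mulrC.
  apply: eq_bigr => j _; rewrite RintegralB//; last exact: iKP.
  rewrite (_ : _ \o _ = EFin \o (fun y => \int[mu]_x (H j x * g j x) * K y)).
    exact: intbleZ.
  by apply/funext => y /=; rewrite mulrC.
rewrite (le_trans (ler_norm_sum _ _ _))//.
have -> : `|c| * (d * (n%:R * J)) = \sum_(j < n) \int[mu]_y (d * `|K y|).
  rewrite sumr_const card_ord (Rintegral_mull _ (intble_norm iK)) intnK gtr0_norm//.
  by rewrite -mulr_natr; ring.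
apply: ler_sum => j _; apply: ler_norm_Rintegral.
- apply: measurable_funB; last exact: intble_measurable.
  by apply: measurable_funM => //; exact: intble_measurable.
- by apply: intbleZ; exact: intble_norm.
move=> y; rewrite -mulrBr normrM [d * _]mulrC.
have [->|Ky] := eqVneq (K y) 0; first by rewrite normr0 !mul0r.
rewrite ler_wpM2l// distrC; apply: (rP j).2; apply: le_trans (KB _ Ky) _.
exact: bigmin_le_cond.
Qed.

End weak_gradient_pairing.

(** * Jacobians *)

Section determinants.
Context (R : realType) (n : nat).
Implicit Types (M : 'M[R]_n) (v : 'I_n -> R) (i j k : 'I_n).

Definition setrow k v M : 'M[R]_n := \matrix_(i, j) if i == k then v j else M i j.

Lemma cofactor_setrow k v M j : cofactor (setrow k v M) k j = cofactor M k j.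
Proof.
rewrite /cofactor; congr (_ * \det _); apply/matrixP => i l.
by rewrite !mxE eq_sym (negbTE (neq_lift _ _)).
Qed.

Lemma det_setrow k v M : \det (setrow k v M) = \sum_j v j * cofactor M k j.
Proof.
rewrite (expand_det_row _ k); apply: eq_bigr => j _.
by rewrite cofactor_setrow mxE eqxx.
Qed.

(** In this form bounds and measurability of minors follow from those of determinants. *)
Lemma cofactorE k j M : cofactor M k j = \det (setrow k (fun l => (l == j)%:R) M).
Proof.
rewrite det_setrow (bigD1 j)//= eqxx mul1r big1 ?addr0// => l /negbTE ->.
by rewrite mul0r.
Qed.

Lemma setrowC k l v w M : k != l -> setrow k v (setrow l w M) = setrow l w (setrow k v M).
Proof.
move=> kl; apply/matrixP => i j; rewrite !mxE.
by case: (i =P k) => // ->; rewrite (negbTE kl).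
Qed.

Lemma setrow_id k M : setrow k (M k) M = M.
Proof. by apply/matrixP => i j; rewrite mxE; case: eqP => [->|]. Qed.

Lemma scale_det_setrow k (c : R) v M :
  c * \det (setrow k v M) = \det (setrow k (fun j => c * v j) M).
Proof.
by rewrite !det_setrow mulr_sumr; apply: eq_bigr => j _; rewrite mulrA.
Qed.

Lemma det_norm_le M (D : R) : (forall s : {perm 'I_n}, `|\prod_i M i (s i)| <= D) ->
  `|\det M| <= n`!%:R * D.
Proof.
move=> MD; rewrite /determinant (le_trans (ler_norm_sum _ _ _))//.
have -> : n`!%:R * D = \sum_(s : {perm 'I_n}) D by rewrite sumr_const card_Sn mulr_natl.
by apply: ler_sum => s _; rewrite normrM normrX normrN normr1 expr1n mul1r.
Qed.

(** Each factor is at most S^(1/n); comparing n-th powers avoids the root. It bounds a product of n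
    functions of L^n by a single integrable one. *)
Lemma prod_le_root (a : 'I_n -> R) (S : R) : (0 < n)%N -> 0 <= S -> (forall i, 0 <= a i) ->
  (forall i, a i ^+ n <= S) -> \prod_i a i <= S.
Proof.
move=> n0 S0 a0 aS; rewrite -(@ler_pXn2r _ n)// ?nnegrE ?prodr_ge0//.
rewrite -prodrXl -[X in _ <= S ^+ X]card_ord -prodr_const.
by apply: ler_prod => i _; rewrite exprn_ge0//=.
Qed.

Lemma det_le_prod M (a : 'I_n -> R) : (forall i j, `|M i j| <= a i) ->
  `|\det M| <= n`!%:R * \prod_i a i.
Proof.
move=> Ma; apply: det_norm_le => s; rewrite normr_prod.
by apply: ler_prod => i _; rewrite normr_ge0 Ma.
Qed.

Lemma measurable_det d (T : measurableType d) (G : T -> 'M[R]_n) :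
  (forall i j, measurable_fun setT (fun x => G x i j)) ->
  measurable_fun setT (fun x => \det (G x)).
Proof.
move=> mG; rewrite /determinant.
apply: measurable_sum => s; apply: measurable_funM; first exact: measurable_cst.
exact: measurable_prod.
Qed.

Lemma measurable_setrow d (T : measurableType d) k (v : 'I_n -> T -> R) (G : T -> 'M[R]_n) :
  (forall j, measurable_fun setT (v j)) ->
  (forall i j, measurable_fun setT (fun x => G x i j)) ->
  forall i j, measurable_fun setT (fun x => setrow k (v^~ x) (G x) i j).
Proof.
move=> mv mG i j; have [->|/negbTE ik] := eqVneq i k.
  by under eq_fun do rewrite mxE eqxx; exact: mv.
by under eq_fun do rewrite mxE ik; exact: mG.
Qed.

Lemma measurable_cofactor d (T : measurableType d) (G : T -> 'M[R]_n) k j :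
  (forall i j, measurable_fun setT (fun x => G x i j)) ->
  measurable_fun setT (fun x => cofactor (G x) k j).
Proof.
move=> mG; under eq_fun do rewrite cofactorE; apply: measurable_det.
by apply: (@measurable_setrow _ _ k (fun l => cst (l == j)%:R)) => // l; exact: measurable_cst.
Qed.

End determinants.

(** * Piola's identity *)

Section piola.
Context (R : realType) (q : nat).
Local Notation n := q.+1.
Implicit Types (V : 'I_n -> 'rV[R]_n -> R) (x : 'rV[R]_n).

(** The cofactor at [(ord0, j)] of the matrix with rows the gradients of the [V i]. It is built from
    functions so that the rules for [partial] apply, and from the rows other than the first, which
    alone are smooth. *)
Definition jacobi_cofactor V (j : 'I_n) : 'rV[R]_n -> R :=
  \sum_(s : {perm 'I_n} | s ord0 == j) cst ((-1) ^+ s) *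
    \prod_(i in [set~ ord0 : 'I_n]%SET) partial (s i) (V i).

Lemma smooth_jacobi_cofactor V j : (forall i, i != ord0 -> smooth (V i)) ->
  smooth (jacobi_cofactor V j).
Proof.
move=> sV; apply: smooth_sum => s _; apply: smoothM; first exact: smooth_cst.
by apply: smooth_prod => i; rewrite !inE => /sV; exact: smooth_partial.
Qed.

Lemma jacobi_cofactorE V j x (M : 'M[R]_n) :
  (forall i, i != ord0 -> forall l, M i l = partial l (V i) x) ->
  jacobi_cofactor V j x = cofactor M ord0 j.
Proof.
move=> MV; rewrite cofactorE /determinant /jacobi_cofactor fct_sumE big_mkcond/=.
apply: eq_bigr => s _; rewrite [in RHS](bigD1 ord0)//= mxE eqxx.
case: eqP => _; last by rewrite mul0r mulr0.
rewrite mul1r; congr (_ * _); rewrite prod_apply; apply: eq_big => i; rewrite !inE//.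
by move=> i0; rewrite !mxE (negbTE i0) MV.
Qed.

(* Exchanging the roles of [ord0] and [k] in a permutation changes its sign but
   not the product, because mixed derivatives commute. *)
Lemma piola V x : (forall i, i != ord0 -> smooth (V i)) ->
  \sum_j partial j (jacobi_cofactor V j) x = 0.
Proof.
move=> sV; have spV s i : i \in [set~ ord0 : 'I_n]%SET -> smooth (partial (s i) (V i)).
  by rewrite !inE => /sV; exact: smooth_partial.
pose T (s : {perm 'I_n}) k := partial (s ord0) (partial (s k) (V k)) x *
  \prod_(i in ([set~ ord0] :\ k)%SET) partial (s i) (V i) x.
transitivity (\sum_j \sum_(s : {perm 'I_n} | s ord0 == j)
    \sum_(k in [set~ ord0 : 'I_n]%SET) (-1) ^+ s * T s k).
  apply: eq_bigr => j _; rewrite partial_sum => [|s _]; last first.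
    by apply: smoothM; [exact: smooth_cst|apply: smooth_prod => i; exact: spV].
  apply: eq_bigr => s /eqP sj.
  have sp : smooth (\prod_(i in [set~ ord0 : 'I_n]%SET) partial (s i) (V i)).
    by apply: smooth_prod => i; exact: spV.
  rewrite partialM; [|by apply: smooth_derivable; exact: smooth_cst|exact: smooth_derivable].
  rewrite partial_cst mul0r add0r partial_prod; last by move=> i; exact: spV.
  by rewrite mulr_sumr; apply: eq_bigr => k _; rewrite /T sj.
transitivity (\sum_(s : {perm 'I_n}) \sum_(k in [set~ ord0 : 'I_n]%SET) (-1) ^+ s * T s k).
  by rewrite [RHS](partition_big (fun s : {perm 'I_n} => s ord0) xpredT).
rewrite exchange_big/=.
apply: big1 => k; rewrite !inE => k0.
set S := \sum_s _; suff : S = - S by move=> /eqP; rewrite -subr_eq0 opprK -mulr2n mulrn_eq0 => /eqP.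
rewrite {1}/S (reindex_inj (mulgI (tperm ord0 k))) -sumrN; apply: eq_bigr => s _ /=.
rewrite odd_permM odd_tperm eq_sym k0 addTb signrN mulNr; congr (- (_ * _)).
rewrite /T !permM tpermL tpermR partial_commute; last exact: sV.
congr (_ * _); apply: eq_bigr => i; rewrite !inE => /andP[ik i0].
by rewrite permM tpermD// eq_sym.
Qed.

End piola.

(** * Integration by parts for determinants of weak gradients *)

Section jacobian_pairing.
Context (R : realType) (q : nat).
Hypothesis q0 : (0 < q)%N.
Local Notation n := q.+1.
Local Notation mu := (@lebesgue_rV R n).
Implicit Types (V f g phi : 'rV[R]_n -> R) (x y z : 'rV[R]_n) (G : 'rV[R]_n -> 'M[R]_n).

Lemma in_LpD f g : in_Lp q f -> in_Lp q g -> in_Lp q (fun x => f x + g x).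
Proof.
move=> [mf foo] [mg goo]; split; first exact: measurable_funD.
apply: le_lt_trans (pow_intD _ mf mg) _.
by rewrite lte_mul_pinfty// ?lee_fin ?exprn_ge0// lte_add_pinfty.
Qed.

Lemma in_LpZ c f : in_Lp q f -> in_Lp q (fun x => c * f x).
Proof.
move=> [mf foo]; split; first exact: measurable_funM.
by rewrite pow_intZ// lte_mul_pinfty// lee_fin exprn_ge0.
Qed.

Lemma in_Lp_norm f : in_Lp q f -> in_Lp q (fun x => `|f x|).
Proof.
move=> [mf foo]; split; first exact: measurableT_comp.
by rewrite /pow_int; under eq_integral do rewrite normr_id.
Qed.

Lemma in_Lp_sum (I : Type) (r : seq I) (F : I -> 'rV[R]_n -> R) :
  (forall i, in_Lp q (F i)) -> in_Lp q (fun x => \sum_(i <- r) F i x).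
Proof.
move=> LF; elim: r => [|i r IH]; last first.
  by under eq_fun do rewrite big_cons; exact: in_LpD.
under eq_fun do rewrite big_nil; split; first exact: measurable_cst.
by rewrite /pow_int; under eq_integral do rewrite normr0 expr0n/=; rewrite integral0.
Qed.

Lemma test_function_in_Lp f : test_function f -> in_Lp q f.
Proof.
move=> /test_function_compact[M [B [mf M0 fM fB]]]; split => //.
have : intble (fun x => `|f x| ^+ n).
  apply: intble_le (intble_cube n (M ^+ n) B) _.
    by apply: measurable_funX; exact: measurableT_comp.
  move=> x; rewrite ger0_norm ?exprn_ge0//.
  have [->|fx] := eqVneq (f x) 0.
    by rewrite normr0 expr0n/= mulr_ge0// ?exprn_ge0// indicE.
  rewrite indicE (_ : x \in _ = true) ?mulr1; last exact/mem_set/fB.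
  by rewrite lerXn2r ?nnegrE.
move=> /integrableP[_]; congr (_ < _)%E.
by apply: eq_integral => x _ /=; rewrite ger0_norm// exprn_ge0.
Qed.

(** The integrand of [jacobian_pairing] is linear in the row k, for k other than [ord0]; this is its
    coefficient at the j-th entry of that row. It serves as [H j] in [weak_gradient_pairing]. *)
Definition minor_pair phi V G k j x := phi x * cofactor (G x) k j +
  V x * cofactor (setrow ord0 (fun l => partial l phi x) (G x)) k j.

Lemma minor_pairE phi V G k x (v : 'I_n -> R) : k != ord0 ->
  phi x * \det (setrow k v (G x)) +
    V x * \det (setrow ord0 (fun l => partial l phi x) (setrow k v (G x))) =
  \sum_j minor_pair phi V G k j x * v j.
Proof.
move=> k0; rewrite -setrowC// !det_setrow !mulr_sumr -big_split/=.
by apply: eq_bigr => j _; rewrite /minor_pair mulrDl ![v j * _]mulrC !mulrA.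
Qed.

Lemma minor_le G k j x (s : R) : 0 <= s -> (forall i l, i != k -> `|G x i l| <= s) ->
  `|cofactor (G x) k j| <= n`!%:R * s ^+ q.
Proof.
move=> s0 Gs; rewrite cofactorE.
apply: le_trans (@det_le_prod _ _ _ (fun i => if i == k then 1 else s) _) _.
  move=> i l; rewrite mxE; case: eqVneq => [_|ik]; last exact: Gs.
  by rewrite normr_nat lern1 leq_b1.
rewrite (bigD1 k)//= eqxx mul1r (eq_bigr (fun=> s)) => [|i /negbTE ->//].
by rewrite prodr_const cardC1 card_ord.
Qed.

Definition entry_sum V G x := `|V x| + \sum_i \sum_j `|G x i j|.

Lemma entry_le V G x i j : `|G x i j| <= entry_sum V G x.
Proof.
rewrite /entry_sum (bigD1 i)//= (bigD1 j)//= addrCA -!addrA lerDl.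
by rewrite !addr_ge0//; repeat (apply: sumr_ge0 => ? _).
Qed.

Lemma entry_sum_ge0 V G x : 0 <= entry_sum V G x.
Proof. by rewrite addr_ge0//; repeat (apply: sumr_ge0 => ? _). Qed.

(** Both terms are minors with q rows of size s, so they are bounded by a constant times s^q; the
    support is that of phi. As c >= 1 and q > 0, the constant c enters the power:
    [c * s ^+ q <= (c * s) ^+ q]. *)
Lemma minor_pair_dominated phi V G : test_function phi -> in_Lp q V ->
  (forall i j, in_Lp q (fun x => G x i j)) ->
  exists b B, forall k j, k != ord0 -> compactly_dominated q (minor_pair phi V G k j) b B.
Proof.
move=> tphi LV LG.
have [M [M0 phiM]] := test_function_bounded 1 tphi.
have [B phiB] := test_function_support tphi.
pose s x := (M + 1) * entry_sum V G x.
have Ls : in_Lp q s.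
  apply: in_LpZ; apply: in_LpD; first exact: in_Lp_norm.
  by apply: (@in_Lp_sum _ _) => i; apply: (@in_Lp_sum _ _) => j; exact: in_Lp_norm.
pose c : R := n`!%:R * (M + 1).
have c1 : 1 <= c by rewrite /c mulr_ege1// ?ler1n ?fact_gt0// lerDr.
have s0 x : 0 <= s x by rewrite mulr_ge0 ?entry_sum_ge0// addr_ge0.
have es x : entry_sum V G x <= s x by rewrite /s ler_peMl ?entry_sum_ge0// lerDr.
exists (fun x => c * s x), B => k j k0; split.
- apply: measurable_funD; apply: measurable_funM.
  + exact: test_function_measurable.
  + by apply: measurable_cofactor => i l; exact: (LG i l).1.
  + exact: LV.1.
  + apply: measurable_cofactor; apply: (@measurable_setrow _ _ _ _ _ (fun l => partial l phi)) => [l|i l].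
      by apply: test_function_measurable; exact: test_function_partial.
    exact: (LG i l).1.
- exact: in_LpZ.
- by move=> x; rewrite mulr_ge0// (le_trans _ c1).
- move=> x; apply: (@le_trans _ _ (c * s x ^+ q)); last first.
    by rewrite [leRHS]exprMn; apply: ler_wpM2r; [exact: exprn_ge0|exact: ler_eXnr].
  have -> : c * s x ^+ q = M * (n`!%:R * s x ^+ q) + n`!%:R * s x ^+ q by rewrite /c; ring.
  rewrite (le_trans (ler_normD _ _))// lerD//.
    rewrite normrM ler_pM//; first exact: (phiM [::]).
    by apply: minor_le => // i l _; exact: le_trans (entry_le V G x i l) (es x).
  (* The factor [V x] is moved into the row of derivatives of phi, whose entries then have size at
     most s like the others. *)
  rewrite cofactorE setrowC// scale_det_setrow -setrowC// -cofactorE.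
  apply: (@minor_le (fun x => setrow ord0 _ (G x))) => // i l ik.
  rewrite mxE; case: eqP => _; last exact: le_trans (entry_le V G x i l) (es x).
  rewrite normrM mulrC /s ler_pM//.
    by rewrite (le_trans (phiM [:: l] x _))// lerDl.
  by rewrite /entry_sum lerDl; repeat (apply: sumr_ge0 => ? _).
- move=> x; apply: contraNT; rewrite -ltNge => Bx.
  have phi0 t : partials t phi x = 0.
    by apply/eqP; move: Bx; apply: contraLR => /phiB; rewrite -leNgt.
  rewrite /minor_pair [phi x](phi0 [::]) mul0r add0r cofactorE setrowC// det_setrow.
  by rewrite big1 ?mulr0// => l _; rewrite [partial l phi x](phi0 [:: l]) mul0r.
Qed.

(** The two kinds of rows in [jacobian_pairing_eq0]. In [test_slot] the gradient is an equality of
    functions, so that rows of that kind can be differentiated again in [piola]. *)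
Definition weak_slot V (g : 'I_n -> 'rV[R]_n -> R) :=
  in_Lp q V /\ forall j, in_Lp q (g j) /\ weak_partial j V (g j).

Definition test_slot V (g : 'I_n -> 'rV[R]_n -> R) :=
  test_function V /\ forall j, g j = partial j V.

Lemma test_slot_in_Lp V (g : 'I_n -> 'rV[R]_n -> R) : test_slot V g ->
  in_Lp q V /\ forall j, in_Lp q (g j).
Proof.
move=> [tV gV]; split => [|j]; first exact: test_function_in_Lp.
by rewrite gV; apply: test_function_in_Lp; exact: test_function_partial.
Qed.

(* When the rows of [G] after the first are gradients, the vanishing of this
   integral is the integration by parts of the first row against [phi]. *)
Definition jacobian_pairing phi V G : R := \int[mu]_x (phi x * \det (G x) +
    V x * \det (setrow ord0 (fun j => partial j phi x) (G x))).

Lemma jacobian_pairing_row phi V G k v : k != ord0 -> test_function phi ->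
  in_Lp q V -> (forall i j, in_Lp q (fun x => G x i j)) -> (forall j, in_Lp q (v j)) ->
  jacobian_pairing phi V (fun x => setrow k (v^~ x) (G x)) =
  \sum_j \int[mu]_x (minor_pair phi V G k j x * v j x).
Proof.
move=> k0 tphi LV LG Lv; have [b [B H]] := minor_pair_dominated tphi LV LG.
rewrite -Rintegral_sum => [|j _]; last exact: compactly_dominated_mul (H k j k0) (Lv j).
by apply: eq_Rintegral => x _; rewrite minor_pairE.
Qed.

(** The rows after the first being smooth, each [phi * C j] is a test function, on which the weak
    derivatives of [V ord0] may be tested. Summed over j, the derivatives of the cofactors cancel by
    [piola], and the terms [partial j phi * C j] form the determinant whose first row is the
    gradient of phi. *)
Lemma jacobian_pairing_base phi (V : 'I_n -> 'rV[R]_n -> R) G : test_function phi ->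
  weak_slot (V ord0) (fun j x => G x ord0 j) ->
  (forall i, i != ord0 -> test_slot (V i) (fun j x => G x i j)) ->
  jacobian_pairing phi (V ord0) G = 0.
Proof.
move=> tphi [LV Lg] tV.
have sV i : i != ord0 -> smooth (V i) by move=> /tV[/test_functionS].
pose C := jacobi_cofactor V.
have sC j : smooth (C j) by exact: smooth_jacobi_cofactor.
have CE x j : C j x = cofactor (G x) ord0 j.
  by apply: jacobi_cofactorE => i i0 l; have [_ /(_ l) <-] := tV i i0.
have tpsi j : test_function (phi * C j) by exact: test_function_mulr.
have i1 j : intble (fun x => G x ord0 j * (phi * C j) x).
  exact: in_Lp_test_function_intble (Lg j).1 (tpsi j).
have i2 j : intble (fun x => V ord0 x * partial j (phi * C j) x).
  exact: in_Lp_test_function_intble LV (test_function_partial j (tpsi j)).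
transitivity (\sum_j (\int[mu]_x (G x ord0 j * (phi * C j) x) +
    \int[mu]_x (V ord0 x * partial j (phi * C j) x))); last first.
  by apply: big1 => j _; rewrite ((Lg j).2 _ (tpsi j)) subrr.
transitivity (\sum_j \int[mu]_x (G x ord0 j * (phi * C j) x +
    V ord0 x * partial j (phi * C j) x)); last first.
  by apply: eq_bigr => j _; rewrite RintegralD//; [exact: i1|exact: i2].
rewrite -Rintegral_sum => [|j _]; last exact: intbleD.
apply: eq_Rintegral => x _; rewrite big_split/=; congr (_ + _).
  rewrite (expand_det_row _ ord0) mulr_sumr; apply: eq_bigr => j _.
  by rewrite -CE mulrCA.
rewrite -mulr_sumr det_setrow; congr (_ * _).
transitivity (\sum_j (partial j phi x * C j x + phi x * partial j (C j) x)).
  rewrite big_split/= -mulr_sumr piola// mulr0 addr0.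
  by apply: eq_bigr => j _; rewrite CE.
apply: eq_bigr => j _; rewrite partialM//; last exact: smooth_derivable.
exact: smooth_derivable (test_functionS tphi).
Qed.

(* Induction on the number of rows that are gradients only in the weak sense:
   the base case is Piola's identity, and [weak_gradient_pairing] allows a row
   of smooth gradients to be replaced by a weak one. *)
Lemma jacobian_pairing_eq0 (eta : 'rV[R]_n -> R) k phi (V : 'I_n -> 'rV[R]_n -> R) G :
  test_function eta -> \int[mu]_x eta x != 0 -> test_function phi ->
  (forall i : 'I_n, (i <= k)%N -> weak_slot (V i) (fun j x => G x i j)) ->
  (forall i : 'I_n, (k < i)%N -> test_slot (V i) (fun j x => G x i j)) ->
  jacobian_pairing phi (V ord0) G = 0.
Proof.
move=> teta eta0 tphi; elim: k V G => [|k IH] V G wV tV.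
  by apply: jacobian_pairing_base => // [|i i0]; [exact: wV|apply: tV; rewrite lt0n].
have [kn|nk] := ltnP k.+1 n; last first.
  apply: IH => i ik; first by apply: wV; exact: leqW.
  by have := leq_ltn_trans nk (leq_ltn_trans ik (ltn_ord i)); rewrite ltnn.
pose kk := Ordinal kn; have kk0 : kk != ord0 by [].
have LV : in_Lp q (V ord0) by exact: (wV ord0 _).1.
have LG i j : in_Lp q (fun x => G x i j).
  have [ik|ki] := leqP i k.+1; first exact: ((wV i ik).2 j).1.
  exact: (test_slot_in_Lp (tV i ki)).2.
have [b [B cH]] := minor_pair_dominated tphi LV LG.
have -> : G = fun x => setrow kk (G x kk) (G x).
  by apply/funext => x; rewrite setrow_id.
rewrite (jacobian_pairing_row kk0 tphi LV LG (LG kk)).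
have [LVk wk] := wV kk (leqnn _).
(* It remains to treat the row [kk] made of the gradient of a test function v: this leaves one weak
   row fewer, with [V'] as the new list of functions. *)
apply: (weak_gradient_pairing teta eta0 (fun j => cH kk j kk0) LVk (LG kk) (fun j => (wk j).2)) => v tv.
have Lv j : in_Lp q (partial j v).
  by apply: test_function_in_Lp; exact: test_function_partial.
rewrite -(jacobian_pairing_row kk0 tphi LV LG Lv).
pose V' i := if i == kk then v else V i.
have -> : V ord0 = V' ord0 by rewrite /V' eq_sym (negbTE kk0).
apply: IH => i ik.
  have ikk : i != kk by apply: contraTneq ik => ->; rewrite -ltnNge.
  rewrite /V' (negbTE ikk); under eq_fun do under eq_fun do rewrite mxE (negbTE ikk).
  by apply: wV; exact: leqW.
rewrite /V'; have [ei|ikk] := eqVneq i kk.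
  split => // j; apply/funext => x; by rewrite mxE ei eqxx.
under eq_fun do under eq_fun do rewrite mxE (negbTE ikk).
apply: tV; rewrite ltn_neqAle ik andbT; apply: contraNneq ikk => ei.
by apply/eqP/val_inj.
Qed.

End jacobian_pairing.

(** * Bounds by the Sobolev norm *)

Section sobolev_bound.
Context (R : realType) (q : nat).
Hypothesis q0 : (0 < q)%N.
Local Notation n := q.+1.
Local Notation mu := (@lebesgue_rV R n).
Implicit Types (u : 'rV[R]_n -> 'rV[R]_n) (Du : 'rV[R]_n -> 'M[R]_n) (x : 'rV[R]_n).

Lemma Lfun_in_Lp (f : 'rV[R]_n -> R) : f \in Lfun mu (n%:R)%:E -> in_Lp q f.
Proof.
move=> Lf; have mf : measurable_fun setT f.
  by have := sub_Lfun_mfun Lf; rewrite inE.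
split => //; have n1 : 1 <= n%:R :> R by rewrite ler1n.
have /integrableP[_] := Lfun_integrable n1 Lf; congr (_ < _)%E.
apply: eq_integral => x _ /=.
by rewrite ger0_norm ?powR_ge0// powR_mulrn.
Qed.

Lemma sobolev_weak_slot u Du i : sobolev u Du ->
  weak_slot (fun x => u x ord0 i) (fun j x => Du x i j).
Proof.
move=> /(_ i)[Lu Du_]; split; first exact: Lfun_in_Lp.
by move=> j; have [LDu wu] := Du_ j; split => //; exact: Lfun_in_Lp.
Qed.

(** Its integral is the n-th power of the Sobolev norm. It dominates the n-th power of every
    component of u and of every entry of [Du]. *)
Definition sobolev_density u Du x := euclidean_norm (u x) ^+ n + \sum_i \sum_j `|Du x i j| ^+ n.

Lemma euclidean_norm_ge (v : 'rV[R]_n) i : `|v ord0 i| <= euclidean_norm v.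
Proof.
rewrite -sqrtr_sqr /euclidean_norm ler_wsqrtr// (bigD1 i)//= lerDl.
by apply: sumr_ge0 => j _; exact: sqr_ge0.
Qed.

Lemma euclidean_norm_ge0 (v : 'rV[R]_n) : 0 <= euclidean_norm v.
Proof. exact: sqrtr_ge0. Qed.

Lemma sobolev_density_ge0 u Du x : 0 <= sobolev_density u Du x.
Proof.
rewrite addr_ge0// ?exprn_ge0 ?euclidean_norm_ge0//.
by do 2 (apply: sumr_ge0 => ? _); exact: exprn_ge0.
Qed.

Lemma sobolev_density_u u Du x i : `|u x ord0 i| ^+ n <= sobolev_density u Du x.
Proof.
apply: (@le_trans _ _ (euclidean_norm (u x) ^+ n)).
  by rewrite lerXn2r ?nnegrE ?euclidean_norm_ge0// euclidean_norm_ge.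
by rewrite lerDl; do 2 (apply: sumr_ge0 => ? _); exact: exprn_ge0.
Qed.

Lemma sobolev_density_Du u Du x i j : `|Du x i j| ^+ n <= sobolev_density u Du x.
Proof.
rewrite /sobolev_density (bigD1 i)//= (bigD1 j)//= addrCA -!addrA lerDl.
rewrite !addr_ge0//; try (by do ?(apply: sumr_ge0 => ? _); exact: exprn_ge0).
by rewrite exprn_ge0 ?euclidean_norm_ge0.
Qed.

Lemma measurable_euclidean_norm u : (forall i, measurable_fun setT (fun x => u x ord0 i)) ->
  measurable_fun setT (fun x => euclidean_norm (u x)).
Proof.
move=> mu'; have ms : measurable_fun setT (@Num.sqrt R).
  by apply: continuous_measurable_fun; exact: sqrt_continuous.
apply: (measurableT_comp ms); apply: measurable_sum => i.
exact: measurable_funX.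
Qed.

Lemma sobolev_density_integral u Du : sobolev u Du -> (sobolev_norm u Du <= 1)%E ->
  intble (sobolev_density u Du) /\ \int[mu]_x sobolev_density u Du x <= 1.
Proof.
move=> su u1.
have mu' i : measurable_fun setT (fun x => u x ord0 i) by exact: (sobolev_weak_slot i su).1.1.
have mDu i j : measurable_fun setT (fun x => Du x i j).
  by have [_ /(_ j)[[]]] := sobolev_weak_slot i su.
have me : measurable_fun setT (fun x => (euclidean_norm (u x) ^+ n)%:E).
  by apply/measurable_EFinP; apply: measurable_funX; exact: measurable_euclidean_norm.
have md i j : measurable_fun setT (fun x => (`|Du x i j| ^+ n)%:E) by exact: measurable_pow.
have m : measurable_fun setT (sobolev_density u Du).
  apply: measurable_funD; first exact/measurable_EFinP.
  apply: measurable_sum => i; apply: measurable_sum => j.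
  by apply: measurable_funX; exact: measurableT_comp.
have E : (\int[mu]_x (sobolev_density u Du x)%:E = \int[mu]_x (euclidean_norm (u x) ^+ n)%:E +
    \sum_(i < n) \sum_(j < n) \int[mu]_x (`|Du x i j| ^+ n)%:E)%E.
  transitivity (\int[mu]_x ((euclidean_norm (u x) ^+ n)%:E +
      \sum_(i < n) \sum_(j < n) (`|Du x i j| ^+ n)%:E))%E.
    apply: eq_integral => x _; rewrite EFinD -sumEFin; congr (_ + _)%E.
    by apply: eq_bigr => i _; rewrite sumEFin.
  have s0 i x : (0 <= \sum_(j < n) (`|Du x i j| ^+ n)%:E)%E.
    by apply: sume_ge0 => j _; rewrite lee_fin exprn_ge0.
  rewrite ge0_integralD//.
  - congr (_ + _)%E; rewrite ge0_integral_sum//.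
      by apply: eq_bigr => i _; rewrite ge0_integral_sum.
    by move=> i; apply: emeasurable_sum => j.
  - by move=> x _; rewrite lee_fin exprn_ge0// euclidean_norm_ge0.
  - by move=> x _; apply: sume_ge0.
  - by do 2 (apply: emeasurable_sum => ?).
have le1 : (\int[mu]_x (sobolev_density u Du x)%:E <= 1)%E.
  move: u1; rewrite /sobolev_norm -E; set A := integral _ _ _ => A1.
  have A0 : (0 <= A)%E by apply: integral_ge0 => x _; rewrite lee_fin sobolev_density_ge0.
  have n0 : n%:R != 0 :> R by rewrite pnatr_eq0.
  have -> : A = ((A `^ n%:R^-1) `^ n%:R)%E by rewrite -poweRrM mulVf// poweRe1.
  rewrite -[leRHS](poweR1r n%:R).
  by apply: gt0_ler_poweR; rewrite ?in_itv/= ?leey ?andbT ?poweR_ge0.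
have i : intble (sobolev_density u Du).
  apply: intble_lty => // [x|]; first exact: sobolev_density_ge0.
  by rewrite (le_lt_trans le1)// ltry.
by split => //; rewrite -lee_fin fineK//; exact: (integrable_fin_num measurableT i).
Qed.

Lemma jacobian_le_density u Du x : `|jacobian_det Du x| <= n`!%:R * sobolev_density u Du x.
Proof.
apply: det_norm_le => s; rewrite normr_prod; apply: prod_le_root => //.
- exact: sobolev_density_ge0.
- by move=> i; exact: sobolev_density_Du.
Qed.

Lemma jacobian_intble u Du : sobolev u Du -> (sobolev_norm u Du <= 1)%E ->
  intble (jacobian_det Du).
Proof.
move=> su u1; have [iS _] := sobolev_density_integral su u1.
apply: intble_le (intbleZ n`!%:R iS) (jacobian_le_density u Du).
apply: measurable_det => i j.
by have [_ /(_ j)[[]]] := sobolev_weak_slot i su.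
Qed.

(** After the integration by parts each term of Leibniz's formula contains one derivative of phi, at
    most M, the component [u x ord0 ord0] and q entries of [Du x]. The latter are n factors, whose
    product is at most the density by [prod_le_root]. *)
Lemma jacobian_test_le (eta : 'rV[R]_n -> R) u Du phi (M : R) :
  test_function eta -> \int[mu]_x eta x != 0 ->
  sobolev u Du -> (sobolev_norm u Du <= 1)%E -> test_function phi ->
  0 <= M -> (forall j x, `|partial j phi x| <= M) ->
  `|\int[mu]_x (jacobian_det Du x * phi x)| <= n`!%:R * M.
Proof.
move=> teta eta0 su u1 tphi M0 phiM.
have [iS S1] := sobolev_density_integral su u1.
have S0 x := sobolev_density_ge0 u Du x.
have sl i := sobolev_weak_slot i su.
have mDu i j : measurable_fun setT (fun x => Du x i j) by have [_ /(_ j)[[]]] := sl i.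
have E : jacobian_pairing phi (fun x => u x ord0 ord0) Du = 0.
  (* With k = n every row is a weak gradient and no test slot is left. *)
  apply: (jacobian_pairing_eq0 q0 (k := n) (V := fun i x => u x ord0 i) teta eta0 tphi) => // i.
  by rewrite ltnNge ltnW.
pose D x := \det (setrow ord0 (fun j => partial j phi x) (Du x)).
pose F x := u x ord0 ord0 * D x.
have iJ : intble (fun x => phi x * \det (Du x)).
  have [N [B [mphi N0 phiN _]]] := test_function_compact tphi.
  apply: intble_le (intbleZ N (intble_norm (jacobian_intble su u1))) _.
    apply: measurable_funM => //; exact: measurable_det.
  by move=> x; rewrite normrM ler_wpM2r.
have FS x : `|F x| <= n`!%:R * M * sobolev_density u Du x.
  rewrite /F /D scale_det_setrow -mulrA; apply: det_norm_le => s.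
  rewrite normr_prod (bigD1 ord0)//= mxE eqxx normrM.
  rewrite mulrAC [X in X <= _]mulrC; apply: ler_pM => //.
    by rewrite mulr_ge0// prodr_ge0.
  pose a (i : 'I_n) := if i == ord0 then `|u x ord0 ord0| else `|Du x i (s i)|.
  have -> : `|u x ord0 ord0| * \prod_(i < n | i != ord0) `|setrow ord0
      (fun j => u x ord0 ord0 * partial j phi x) (Du x) i (s i)| = \prod_i a i.
    rewrite [RHS](bigD1 ord0)//= {1}/a eqxx; congr (_ * _).
    by apply: eq_bigr => i /negbTE i0; rewrite mxE /a i0.
  apply: prod_le_root => // i; rewrite /a; case: ifP => _ //.
    exact: sobolev_density_u.
  exact: sobolev_density_Du.
have mF : measurable_fun setT F.
  apply: measurable_funM; first exact: (sl ord0).1.1.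
  apply: measurable_det; apply: (@measurable_setrow _ _ _ _ _ (fun j => partial j phi)) => // j.
  by apply: test_function_measurable; exact: test_function_partial.
have iF : intble F by exact: intble_le mF (intbleZ (n`!%:R * M) iS) FS.
have -> : \int[mu]_x (jacobian_det Du x * phi x) = - \int[mu]_x F x.
  apply/eqP; rewrite -addr_eq0 -RintegralD//.
    by apply/eqP; rewrite -[RHS]E; apply: eq_Rintegral => x _; rewrite mulrC.
  rewrite (_ : _ \o _ = EFin \o (fun x => phi x * \det (Du x)))//.
  by apply/funext => x /=; rewrite mulrC.
rewrite normrN (le_trans (ler_norm_Rintegral mF (intbleZ (n`!%:R * M) iS) FS))//.
by rewrite Rintegral_mull// ler_piMr// mulr_ge0.
Qed.

End sobolev_bound.

(** * Tempered distributions and the Hardy norm *)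

Section tempered_facts.
Context (R : realType) (n : nat) (eta : test_fun R n).
Local Notation mu := (@lebesgue_rV R n).
Local Notation schwartz := (schwartz R n).
Implicit Types (T : schwartz -> R) (x y : 'rV[R]_n) (t : {posnum R}).

Lemma partialsB s (f g : 'rV[R]_n -> R) : smooth f -> smooth g ->
  partials s (f - g) = partials s f - partials s g.
Proof.
by move=> sf sg; rewrite addrC -scaleN1r partials_lin// scaleN1r addrC.
Qed.

Lemma eta_atE t x :
  eta_at eta t x = (fun y => t%:num ^- n * eta (t%:num^-1 *: (x - y))) :> ('rV[R]_n -> R).
Proof. by []. Qed.

Lemma schwartz_valB (phi psi : schwartz) :
  phi - psi = schwartz_val phi - schwartz_val psi :> ('rV[R]_n -> R).
Proof. by []. Qed.

(** Local Lipschitz continuity of [x |-> eta_at t x] in each seminorm. It makes the convolution of a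
    tempered distribution with [eta_t] a continuous function. *)
Lemma eta_at_lipschitz t x k : exists C : R, 0 <= C /\ forall x', `|x' - x| <= 1 ->
  (schwartz_seminorm k (eta_at eta t x' - eta_at eta t x)%R <= (C * `|x' - x|)%:E)%E.
Proof.
have teta := test_valP eta; have seta := test_functionS teta.
(* One order more than k, because the derivatives up to order k must be Lipschitz. *)
have [M [M0 etaM]] := test_function_bounded k.+1 teta.
have [B etaB] := test_function_support teta.
have t0 : 0 < t%:num by []; have tV0 : t%:num^-1 != 0 by rewrite invr_neq0// gt_eqF.
have tn0 : 0 <= t%:num ^- n by rewrite invr_ge0 exprn_ge0.
(* W bounds the weight on the supports, which stay in a fixed cube as [|x' - x| <= 1]; D bounds the
   powers of 1/t from the normalisation and the chain rule. *)
pose W := (1 + (`|x| + 1 + t%:num * `|B|)) ^+ k.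
have W0 : 0 <= W by rewrite exprn_ge0// !addr_ge0// mulr_ge0.
pose D := t%:num ^- n * (1 + t%:num^-1) ^+ k.
have D0 : 0 <= D by rewrite mulr_ge0// exprn_ge0// addr_ge0// invr_ge0.
exists (W * (D * (n%:R * M * t%:num^-1))); split.
  by rewrite !mulr_ge0// invr_ge0.
move=> x' xx'; apply: schwartz_seminorm_le => s y sk.
rewrite schwartz_valB !eta_atE partialsB; [|exact: smooth_affine..].
rewrite !partials_affine// [X in `|X|]/= -[(_ - _) y]/(_ y - _ y) -mulrBr.
set a := partials s eta _; set b := partials s eta _.
have [ab|ab] := eqVneq a b; first by rewrite ab subrr mulr0 normr0 mulr0 !mulr_ge0// invr_ge0.
have yB : `|y| <= `|x| + 1 + t%:num * `|B|.
  have supp z : partials s eta (t%:num^-1 *: (z - y)) != 0 -> `|z| <= `|x| + 1 ->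
      `|y| <= `|x| + 1 + t%:num * `|B|.
    move=> /etaB; rewrite normrZ gtr0_norm ?invr_gt0// ler_pdivrMl// => zy zx.
    rewrite -[y](subKr z) (le_trans (ler_normB _ _))// lerD//.
    by rewrite (le_trans zy)// ler_wpM2l ?ler_norm// ltW.
  have [b0|b0] := eqVneq b 0; last by apply: supp b0 _; rewrite lerDl.
  apply: (supp x'); first by rewrite -/a; move: ab; rewrite b0.
  by rewrite -[x'](subrK x) addrC (le_trans (ler_normD _ _))// lerD.
rewrite -!mulrA; apply: ler_pM; rewrite ?exprn_ge0 ?addr_ge0//.
  by rewrite lerXn2r ?nnegrE ?addr_ge0 ?mulr_ge0// lerD2l.
rewrite !normrM normrX normrN (ger0_norm tn0); apply: ler_wpM2l => //.
apply: ler_pM; [by rewrite exprn_ge0|exact: normr_ge0| |].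
  rewrite gtr0_norm ?invr_gt0//; apply: (@le_trans _ _ ((1 + t%:num^-1) ^+ size s)).
    by rewrite lerXn2r ?nnegrE ?addr_ge0 ?invr_ge0// lerDr.
  by apply: ler_weXn2l => //; rewrite lerDl invr_ge0.
apply: le_trans (@partials_lipschitz _ _ (partials s eta) M _ _ _ _) _.
- by move=> i z; exact: (seta s).2.
- by move=> i z; exact: (etaM (i :: s)).
rewrite -scalerBr normrZ opprB addrA subrK gtr0_norm ?invr_gt0//.
by rewrite !mulrA.
Qed.

Lemma tempered_eta_continuous T t : tempered T -> continuous (fun x => T (eta_at eta t x)).
Proof.
move=> [_ cT] x; apply/(@cvgrPdist_lt _ _ _ (nbhs x)) => e e0.
have : nbhs (eta_at eta t x) [set phi | `|T (eta_at eta t x) - T phi| < e].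
  by move/cvgrPdist_lt : (cT (eta_at eta t x)) => /(_ _ e0).
rewrite nbhsE => -[U [oU Ux] UT].
have [k [d [d0 dU]]] := oU _ Ux.
have [C [C0 CP]] := eta_at_lipschitz t x k.
have C10 : 0 < C + 1 by rewrite ltr_wpDl.
apply/nbhs_ballP; exists (Num.min 1 (d / (C + 1))) => /=.
  by rewrite lt_min ltr01 divr_gt0.
move=> x'; rewrite ball_rVE ?lt_min ?ltr01 ?divr_gt0// => /=; rewrite lt_min; case/andP=> x1 xd.
apply: UT; apply: dU; rewrite distrC in x1 xd.
apply: le_lt_trans (CP x' (ltW x1)) _; rewrite lte_fin.
apply: (@le_lt_trans _ _ ((C + 1) * `|x' - x|)); first by rewrite ler_wpM2r// lerDl.
by rewrite mulrC -ltr_pdivlMr.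
Qed.

Lemma measurable_hardy_maximal T : tempered T -> measurable_fun setT (hardy_maximal eta T).
Proof.
move=> tT; apply: lower_semicontinuous_measurable_rV => a.
rewrite (_ : [set x | _] = \bigcup_(t : {posnum R}) [set x | a < `|T (eta_at eta t x)|]).
  apply: bigcup_open => t _.
  apply: (@open_comp _ _ (fun x => `|T (eta_at eta t x)|) [set r | a < r]); last exact: open_gt.
  move=> x _; apply: (@continuous_comp _ _ _ (fun x => T (eta_at eta t x)) Num.norm).
    exact: tempered_eta_continuous.
  exact: norm_continuous.
apply/seteqP; split => x /=.
  by move=> /ereal_sup_gt[_ [t _ <-]]; rewrite lte_fin => at_; exists t.
move=> [t _ /= at_]; apply: (@lt_le_trans _ _ (`|T (eta_at eta t x)|%:E)).
  by rewrite lte_fin.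
by apply: ereal_sup_ubound; exists t.
Qed.

Lemma hardy_maximal_ge0 T x : (0 <= hardy_maximal eta T x)%E.
Proof.
apply: (@le_trans _ _ (`|T (eta_at eta 1%:pos x)|%:E)); first by rewrite lee_fin.
by apply: ereal_sup_ubound; exists 1%:pos.
Qed.

Lemma hardy_norm_ge T t x (r d : R) : tempered T -> 0 <= r -> 0 <= d ->
  (forall x', `|x' - x| <= r -> d <= `|T (eta_at eta t x')|) ->
  ((d * (2 * r) ^+ n)%:E <= hardy_norm eta T)%E.
Proof.
move=> tT r0 d0 Td; have mc := measurable_cube x r.
rewrite EFinM -(lebesgue_rV_cube x r0) -[X in (_ * mu X)%E]setIT -integral_indic//.
have mI : measurable_fun setT (\1_[set x' | `|x' - x| <= r] : 'rV[R]_n -> R).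
  exact: measurable_indic.
rewrite -ge0_integralZl//; last exact/measurable_EFinP.
apply: ge0_le_integral => //.
- by move=> y _; rewrite lee_fin mulr_ge0.
- by apply: measurable_funeM; exact/measurable_EFinP.
- exact: measurable_hardy_maximal.
move=> x' _; rewrite indicE; have [/set_mem x'r|_] := boolP (x' \in _); last first.
  by rewrite mule0 hardy_maximal_ge0.
rewrite mule1; apply: (@le_trans _ _ (`|T (eta_at eta t x')|%:E)).
  by rewrite lee_fin Td.
by apply: ereal_sup_ubound; exists t.
Qed.

Lemma hardy_maximalB T T' x : hardy_maximal eta (T - T') x = hardy_maximal eta (T' - T) x.
Proof.
congr (ereal_sup _); apply/funext => z; rewrite propeqE.
by split => -[t _ <-]; exists t => //=; rewrite distrC.
Qed.

Lemma hardy_normB T T' : hardy_norm eta (T - T') = hardy_norm eta (T' - T).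
Proof. by apply: eq_integral => x _; exact: hardy_maximalB. Qed.

Lemma tempered0 : tempered (0 : schwartz -> R).
Proof. by split => [a u v|]; [rewrite mulr0 addr0|exact: cst_continuous]. Qed.

Lemma tempered_lin (a : R) T T' : tempered T -> tempered T' -> tempered (T + a *: T').
Proof.
move=> [lT cT] [lT' cT']; split.
  move=> c u v; rewrite -[LHS]/(T (c *: u + v) + a * T' (c *: u + v)) lT lT'.
  by rewrite -[RHS]/(c * (T u + a * T' u) + (T v + a * T' v)); ring.
move=> x; apply: continuousD; first exact: cT.
exact: (continuousZl_tmp (k := a) (cT' x)).
Qed.

Lemma temperedZ (a : R) T : tempered T -> tempered (a *: T).
Proof. by move=> tT; rewrite -[a *: T]add0r; exact: tempered_lin tempered0 tT. Qed.

Lemma temperedB T T' : tempered T -> tempered T' -> tempered (T - T').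
Proof. by move=> tT tT'; rewrite -scaleN1r; exact: tempered_lin. Qed.

(* The set where [T] exceeds [K] is open, so a distribution that stays below [K]
   cannot be close to [T] in the Hardy norm. *)
Lemma hardy_separation T t x (K : R) : tempered T -> K < `|T (eta_at eta t x)| ->
  exists2 c : R, 0 < c & forall T', tempered T' ->
    (forall x', `|T' (eta_at eta t x')| <= K) -> (c%:E <= hardy_norm eta (T - T')%R)%E.
Proof.
move=> tT KT; pose d := (`|T (eta_at eta t x)| - K) / 2.
have d0 : 0 < d by rewrite divr_gt0// subr_gt0.
have /nbhs_ballP[r /= r0 rP] : \forall x' \near x, `|T (eta_at eta t x) - T (eta_at eta t x')| < d.
  by have /(@cvgrPdist_lt _ _ _ (nbhs x))/(_ _ d0) := tempered_eta_continuous (t := t) tT (x := x).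
have r20 : 0 < r / 2 by rewrite divr_gt0.
exists (d * (2 * (r / 2)) ^+ n); first by rewrite mulr_gt0// exprn_gt0// mulr_gt0.
move=> T' tT' T'K; apply: (@hardy_norm_ge _ t x) => //; [exact: temperedB|exact: ltW|exact: ltW|].
move=> x' x'r; have : ball x r x'.
  by rewrite ball_rVE//= distrC (le_lt_trans x'r)// ltr_pdivrMr// ltr_pMr// ltr1n.
move=> /rP /=; rewrite -[(T - T') _]/(T _ - T' _) => Tx.
have h1 := lerB_dist (T (eta_at eta t x)) (T (eta_at eta t x')).
have h2 := lerB_dist (T (eta_at eta t x')) (T' (eta_at eta t x')).
have h3 := T'K x'.
rewrite /d in Tx *; lra.
Qed.

Lemma schwartz_smooth (phi : schwartz) : smooth phi.
Proof. by case: phi => f /=; rewrite inE => -[]. Qed.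

Lemma schwartz_bound (phi : schwartz) : exists2 M, 0 <= M & forall x, `|phi x| <= M.
Proof.
case: phi => f /=; rewrite inE => -[sf /(_ 0%N)/schwartz_seminorm_ltyP[M fM]].
exists M => [|x]; last by have := fM [::] x isT; rewrite expr0 mul1r.
by have := fM [::] 0 isT; rewrite expr0 mul1r; exact: le_trans.
Qed.

Lemma schwartz_measurable (phi : schwartz) : measurable_fun setT phi.
Proof. by apply: continuous_measurable_rV; apply: smooth_continuous; exact: schwartz_smooth. Qed.

Lemma intble_schwartz f (phi : schwartz) : intble f -> intble (fun x => f x * phi x).
Proof.
move=> fi; have [M M0 phiM] := schwartz_bound phi.
apply: intble_le (intbleZ M (intble_norm fi)) _.
  by apply: measurable_funM; [exact: intble_measurable|exact: schwartz_measurable].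
by move=> x; rewrite normrM mulrC ler_wpM2r.
Qed.

Lemma regular_distribution_tempered (f : 'rV[R]_n -> R) : intble f ->
  tempered (regular_distribution f).
Proof.
move=> fi; split.
  move=> a u v; rewrite /regular_distribution -Rintegral_mull; last exact: intble_schwartz.
  rewrite -RintegralD//; [|exact: intbleZ (intble_schwartz u fi)|exact: (intble_schwartz v fi)].
  by apply: eq_Rintegral => x _; rewrite -[schwartz_val _ x]/(a * u x + v x); ring.
apply/continuousP => A oA; change (schwartz_open (regular_distribution f @^-1` A)).
move=> phi /= Aphi.
have /nbhs_ballP[e /= e0 eA] : nbhs (regular_distribution f phi) A by exact: open_nbhs_nbhs.
pose I := \int[mu]_x `|f x|; have I0 : 0 <= I by exact: Rintegral_ge0.
have I10 : 0 < I + 1 by rewrite ltr_wpDl.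
exists 0%N, (e / (I + 1)); split; first by rewrite divr_gt0.
move=> psi psiphi; apply: eA; rewrite -ball_normE/= distrC /regular_distribution.
rewrite -RintegralB//; [|exact: intble_schwartz..].
have le x : `|f x * psi x - f x * phi x| <= e / (I + 1) * `|f x|.
  rewrite -mulrBr normrM mulrC ler_wpM2r// -lee_fin ltW// (le_lt_trans _ psiphi)//.
  by have := @schwartz_seminorm_ub R n 0 (psi - phi) [::] x isT; rewrite expr0 mul1r.
apply: le_lt_trans (ler_norm_Rintegral _ (intbleZ _ (intble_norm fi)) le) _.
  by apply: intble_measurable; apply: intbleB; exact: intble_schwartz.
rewrite Rintegral_mull; last exact: intble_norm.
by rewrite -/I mulrAC ltr_pdivrMr// ltr_pM2l// ltrDl.
Qed.

End tempered_facts.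

(** * Atoms *)

Section decay.
Context (R : realType) (n : nat).
Local Notation mu := (@lebesgue_rV R n).

(** Decay of order |x|^(-n-1) in dyadic form. The function is at most the sum of the [c k] times the
    indicators of cubes of volume (2 L)^n 2^(k n), so the integrals form a geometric series in
    2^(-k). *)
Lemma dyadic_decay_integral (g : 'rV[R]_n -> \bar R) (C L : R) : 0 <= C -> 0 < L ->
  measurable_fun setT g -> (forall x, 0 <= g x)%E -> (forall x, g x <= C%:E)%E ->
  (forall x k, L * 2 ^+ k < `|x| -> (g x <= (C * 2^-1 ^+ (k * n.+1))%:E)%E) ->
  (\int[mu]_x g x < +oo)%E.
Proof.
move=> C0 L0 mg g0 gC gdecay.
(* On [Q k.+1] outside [Q k] only the decay of index k is available; the factor [2 ^+ n.+1] makes up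
   for the shift. *)
pose c k : R := C * 2 ^+ n.+1 * 2^-1 ^+ (k * n.+1).
have c0 k : 0 <= c k by rewrite !mulr_ge0// exprn_ge0// invr_ge0.
pose Q k : set 'rV[R]_n := cube (L * 2 ^+ k).
have mQ k : measurable (Q k) by exact: measurable_cube0.
pose F k x : \bar R := (c k * \1_(Q k) x)%:E.
have F0 k x : (0 <= F k x)%E by rewrite lee_fin mulr_ge0.
have mF k : measurable_fun setT (F k).
  by apply/measurable_EFinP; apply: measurable_funM => //; exact: measurable_indic.
have gF x : (g x <= \sum_(0 <= k <oo) F k x)%E.
  have FQ k : Q k x -> (g x <= (c k)%:E)%E -> (g x <= \sum_(0 <= k <oo) F k x)%E.
    move=> Qx gck; apply: (le_trans gck).
    have := @nneseries_lim_ge R (fun k => F k x) xpredT 0 k.+1 (fun k _ _ => F0 k x).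
    apply: le_trans; rewrite big_nat_recr//= -[X in (X <= _)%E]add0e leeD ?sume_ge0//.
    by rewrite /F indicE mem_set// mulr1.
  have exk : exists k, `|x| <= L * 2 ^+ k.
    exists (Num.bound (`|x| / L)); rewrite mulrC -ler_pdivrMr//.
    exact/ltW/upper_nthrootP.
  case: (ex_minnP exk) => -[|k] xk xmin.
    apply: (FQ 0%N) => //; apply: le_trans (gC x) _; rewrite lee_fin /c mul0n expr0 mulr1.
    by rewrite ler_peMr// exprn_ege1// ler1n.
  apply: (FQ k.+1) => //; apply: (le_trans (gdecay x k _)).
    by rewrite ltNge; apply/negP => /xmin; rewrite ltnn.
  rewrite lee_fin /c mulSn exprD -mulrA; apply: ler_wpM2l => //.
  by rewrite mulrA -exprMn divff// expr1n mul1r.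
apply: (@le_lt_trans _ _ (\int[mu]_x \sum_(0 <= k <oo) F k x)%E).
  by apply: ge0_le_integral => //; exact: ge0_emeasurable_sum.
rewrite integral_nneseries//.
(* The last factor 2 compensates the exponent [k.+1], the form of the series summed by
   [epsilon_trick0]. *)
have intF k : (\int[mu]_x F k x = ((C * 2 ^+ n.+1 * (2 * L) ^+ n * 2) / (2 ^ k.+1)%:R)%:E)%E.
  under eq_integral do rewrite /F EFinM.
  rewrite ge0_integralZl//; [|by apply/measurable_EFinP; exact: measurable_indic|by rewrite lee_fin].
  rewrite integral_indic// setIT.
  have B0 : 0 <= L * 2 ^+ k by rewrite mulr_ge0 ?exprn_ge0// ltW.
  rewrite [X in (_ * X)%E](lebesgue_cube n B0).
  rewrite -EFinM; congr (_%:E); rewrite /c mulnS exprD.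
  rewrite [2 * (L * _)]mulrA (exprMn _ (2 * L)) -exprM natrX (exprS _ k).
  have e2 : 2^-1 ^+ (k * n) * 2 ^+ (k * n) = 1 :> R by rewrite -exprMn mulVf// expr1n.
  rewrite [LHS](_ : _ = C * 2 ^+ n.+1 * 2^-1 ^+ k * (2 * L) ^+ n *
    (2^-1 ^+ (k * n) * 2 ^+ (k * n))); last by ring.
  rewrite e2 exprVn; field.
  by rewrite expf_neq0.
apply: (@le_lt_trans _ _ (C * 2 ^+ n.+1 * (2 * L) ^+ n * 2)%:E); last by rewrite ltry.
under eq_eseriesr do rewrite intF.
apply: epsilon_trick0; rewrite !mulr_ge0// exprn_ge0// mulr_ge0//; exact: ltW.
Qed.
End decay.

Section atoms.
Context (R : realType) (n : nat) (eta : test_fun R n).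
Local Notation mu := (@lebesgue_rV R n).
Implicit Types (f k : 'rV[R]_n -> R) (x y w : 'rV[R]_n) (t : {posnum R}).

Lemma hardy_maximal_le (T : schwartz R n -> R) x (C : R) :
  (forall t, `|T (eta_at eta t x)| <= C) -> (hardy_maximal eta T x <= C%:E)%E.
Proof. by move=> TC; apply: ge_ereal_sup => _ [t _ <-]; rewrite lee_fin. Qed.

Lemma intble_mul_eta_at k t x : test_function k -> intble (fun y => k y * eta_at eta t x y).
Proof. by move=> tk; apply: intble_schwartz; exact: test_function_intble. Qed.

(** The L^1 norm of [eta_at eta t x] is that of [eta], so the bound is uniform in the scale. *)
Lemma pairing_bound f t x (M : R) : intble f -> (forall y, `|f y| <= M) ->
  `|regular_distribution f (eta_at eta t x)| <= M * \int[mu]_y `|eta y|.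
Proof.
move=> fi fM; have t0 : 0 < t%:num by [].
have tV0 : - t%:num^-1 != 0 by rewrite oppr_eq0 invr_neq0// gt_eqF.
have ieta := intble_norm (test_function_intble (test_valP eta)).
have iG := intbleZ (t%:num ^- n) (intble_affine (t%:num^-1 *: x) tV0 ieta).
have GE y : `|eta_at eta t x y| = t%:num ^- n * `|eta (- t%:num^-1 *: y + t%:num^-1 *: x)|.
  rewrite eta_atE normrM ger0_norm ?invr_ge0 ?exprn_ge0//.
  by rewrite scalerBr scaleNr [in RHS]addrC.
apply: le_trans (ler_norm_Rintegral _ (intbleZ M iG) _) _.
- exact: intble_measurable (intble_schwartz _ fi).
- by move=> y; rewrite normrM GE; apply: ler_wpM2r => //; rewrite mulr_ge0// invr_ge0 exprn_ge0.
have iA := intble_affine (t%:num^-1 *: x) tV0 ieta.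
rewrite (Rintegral_mull _ iG) (Rintegral_mull _ iA) (Rintegral_affine _ tV0 ieta).
rewrite normrN gtr0_norm ?invr_gt0// exprVn invrK mulKf ?expf_neq0//.
Qed.

(* Moving the translation onto [eta_t] shows that the mean of an atom vanishes. *)
Lemma atom_pairing_lipschitz k w t x (M : R) : test_function k ->
  (forall i y, `|partial i eta y| <= M) ->
  `|regular_distribution (fun y => k y - k (y - w)) (eta_at eta t x)| <=
  n%:R * M * `|w| * (\int[mu]_y `|k y|) * t%:num ^- n.+1.
Proof.
move=> tk etaM; have t0 : 0 < t%:num by [].
have ik := test_function_intble tk.
have seta := test_functionS (test_valP eta).
have tn0 : 0 <= t%:num ^- n by rewrite invr_ge0 exprn_ge0.
pose G := eta_at eta t x.
have iGw : intble (fun y => k y * G (y + w)).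
  have := intble_translate (- w) (intble_mul_eta_at t x (test_function_translate w tk)).
  by under eq_fun do rewrite opprK addrK.
rewrite (_ : regular_distribution _ _ = \int[mu]_y (k y * (G y - G (y + w)))); last first.
  under [RHS]eq_Rintegral do rewrite mulrBr.
  rewrite RintegralB//; last exact: (intble_mul_eta_at t x tk).
  rewrite -(Rintegral_translate w iGw) -RintegralB//.
  - by apply: eq_Rintegral => y _; rewrite subrK mulrBl.
  - exact: (intble_mul_eta_at t x tk).
  - by have := intble_translate w iGw; under eq_fun do rewrite subrK.
pose c := t%:num ^- n * (n%:R * M * (t%:num^-1 * `|w|)).
apply: le_trans (ler_norm_Rintegral _ (intbleZ c (intble_norm ik)) _) _.
- under eq_fun do rewrite mulrBr.
  by apply: measurable_funB; apply: intble_measurable => //; exact: (intble_mul_eta_at t x tk).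
- move=> y; rewrite normrM mulrC; apply: ler_wpM2r => //.
  rewrite /G !eta_atE -mulrBr normrM ger0_norm//; apply: ler_wpM2l => //.
  apply: le_trans (partials_lipschitz (fun i z => (seta [::]).2 i z) etaM _ _) _.
  rewrite -scalerBr normrZ gtr0_norm ?invr_gt0// (_ : x - y - _ = w)//.
  by rewrite opprB addrC addrA subrK addrAC subrr add0r.
rewrite Rintegral_mull; last exact: intble_norm.
by rewrite /c exprS invfM le_eqVlt; apply/orP; left; apply/eqP; ring.
Qed.

(** At a point x far away, a scale t with [t * B < |x| / 2] does not reach the atom and gives 0. For
    the other scales, [atom_pairing_lipschitz] gives t^(-n-1), at most (2 B / |x|)^(n+1) up to a
    constant. *)
Lemma atom_hardy_norm_lty k w : test_function k ->
  (hardy_norm eta (regular_distribution (fun y => k y - k (y - w))%R) < +oo)%E.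
Proof.
move=> tk; have teta := test_valP eta.
have [M1 [M10 etaM]] := test_function_bounded 1 teta.
have [M M0 kM] := test_function_bound tk.
have [Bk kB] := test_function_support tk.
have [Be eB] := test_function_support teta.
have ik := test_function_intble tk.
have ifk : intble (fun y => k y - k (y - w)) by apply: intbleB => //; exact: intble_translate.
set T := regular_distribution _.
pose I := \int[mu]_y `|eta y|; have I0 : 0 <= I by exact: Rintegral_ge0.
pose J := \int[mu]_y `|k y|; have J0 : 0 <= J by exact: Rintegral_ge0.
pose C2 := n%:R * M1 * `|w| * J; have C20 : 0 <= C2 by rewrite !mulr_ge0.
pose B := `|Be| + 1; have B0 : 0 < B by rewrite ltr_wpDl.
(* The atom lives in a cube of radius less than L / 2, so for [|x| > L] it is at distance more than
   [|x| / 2] from x. *)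
pose L := 2 * (`|Bk| + `|w| + 1); have L0 : 0 < L by rewrite mulr_gt0// ltr_wpDl// addr_ge0.
pose C3 := C2 * (2 * B / L) ^+ n.+1.
have C30 : 0 <= C3 by rewrite mulr_ge0// exprn_ge0// divr_ge0// ?mulr_ge0// ltW.
have C0 : 0 <= (M + M) * I + C3 by rewrite addr_ge0// mulr_ge0// addr_ge0.
apply: (dyadic_decay_integral C0 L0).
- by apply: measurable_hardy_maximal; exact: regular_distribution_tempered.
- exact: hardy_maximal_ge0.
- move=> x; apply: hardy_maximal_le => t.
  apply: le_trans (pairing_bound t x ifk (_ : forall y, _ <= M + M)) _; last by rewrite lerDl.
  by move=> y; rewrite (le_trans (ler_normB _ _))// lerD.
move=> x m xL; apply: hardy_maximal_le => t; have t0 : 0 < t%:num by [].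
have xL1 : L < `|x| by rewrite (le_lt_trans _ xL)// ler_peMr ?(ltW L0)// exprn_ege1// ler1n.
have x0 : 0 < `|x| by exact: lt_trans xL1.
have Cm0 : 0 <= ((M + M) * I + C3) * 2^-1 ^+ (m * n.+1).
  by rewrite mulr_ge0// exprn_ge0// invr_ge0.
have [tx|tx] := ltP (t%:num * B) (`|x| / 2).
  rewrite (_ : T _ = 0) ?normr0// /T /regular_distribution.
  rewrite (_ : (fun y => _) = cst 0); first by rewrite /Rintegral integral0.
  apply/funext => y; apply/eqP/negPn/negP.
  rewrite mulf_eq0 negb_or => /andP[fy Gy].
  have yL : `|y| <= `|Bk| + `|w|.
    have [ky|ky] := eqVneq (k y) 0; last first.
      by rewrite (le_trans (kB [::] y ky))// (le_trans (ler_norm _))// lerDl.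
    have kyw : k (y - w) != 0 by move: fy; rewrite ky sub0r oppr_eq0.
    rewrite -[y](subrK w) (le_trans (ler_normD _ _))// lerD2r.
    by rewrite (le_trans (kB [::] _ kyw))// ler_norm.
  have xy : `|x - y| <= t%:num * B.
    move: Gy; rewrite eta_atE mulf_eq0 negb_or => /andP[_ /(eB [::])].
    rewrite normrZ gtr0_norm ?invr_gt0// ler_pdivrMl// => /le_trans; apply.
    by rewrite ler_wpM2l ?(ltW t0)// (le_trans (ler_norm _))// lerDl.
  have := ler_normD (x - y) y; rewrite subrK => xD.
  have : L = 2 * (`|Bk| + `|w| + 1) by [].
  lra.
have etaM1 i y : `|partial i eta y| <= M1 by exact: (etaM [:: i]).
apply: le_trans (atom_pairing_lipschitz w t x tk etaM1) _.
apply: (@le_trans _ _ (C3 * 2^-1 ^+ (m * n.+1))); last first.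
  by apply: ler_wpM2r; [rewrite exprn_ge0// invr_ge0|rewrite lerDr mulr_ge0// addr_ge0].
rewrite -/J -/C2 /C3 -mulrA; apply: ler_wpM2l => //.
rewrite exprM -exprMn -exprVn lerXn2r ?nnegrE ?invr_ge0//.
  by rewrite mulr_ge0// ?exprn_ge0 ?invr_ge0// divr_ge0 ?mulr_ge0// ltW.
rewrite exprVn -div1r ler_pdivrMr// mulrAC ler_pdivlMr ?exprn_gt0// mul1r.
rewrite mulrAC ler_pdivlMr//; lra.
Qed.

End atoms.

(** * Dilations of atoms *)

Section atom_scaling.
Context (R : realType) (n : nat) (eta : test_fun R n).
Local Notation mu := (@lebesgue_rV R n).
Implicit Types (f k : 'rV[R]_n -> R) (x y w : 'rV[R]_n) (t r : {posnum R}).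

(** The substitution y = r z produces r^n, which turns the normalisation t^(-n) into s^(-n). The
    dilate itself is not normalised, hence the factor r^n in [hardy_norm_dilation]. *)
Lemma regular_distribution_dilation f r s t x : intble f -> t%:num = r%:num * s%:num ->
  regular_distribution (fun y => f (r%:num^-1 *: y)) (eta_at eta t x) =
  regular_distribution f (eta_at eta s (r%:num^-1 *: x)).
Proof.
move=> fi trs; have r0 : r%:num != 0 by rewrite gt_eqF.
have rV0 : r%:num^-1 != 0 by rewrite invr_neq0.
have rn0 : r%:num ^+ n != 0 by rewrite expf_neq0.
pose g y := f y * eta_at eta s (r%:num^-1 *: x) y.
have gi : intble g by exact: intble_schwartz.
have := Rintegral_affine 0 rV0 gi.
rewrite gtr0_norm ?invr_gt0// exprVn invrK => gE.
rewrite -[RHS]/(\int[mu]_y g y) -(mulKf rn0 (\int[mu]_y g y)) -gE.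
rewrite -Rintegral_mull; last exact: intble_affine.
apply: eq_Rintegral => y _; rewrite addr0 /g !eta_atE /= -scalerBr scalerA trs.
by rewrite [RHS]mulrCA; congr (_ * _); rewrite mulrA exprMn !invfM (mulrC s%:num^-1).
Qed.

Lemma hardy_maximal_dilation f r x : intble f ->
  hardy_maximal eta (regular_distribution (fun y => f (r%:num^-1 *: y))) x =
  hardy_maximal eta (regular_distribution f) (r%:num^-1 *: x).
Proof.
move=> fi; congr (ereal_sup _); apply/seteqP; split => z [t _ <-].
  exists (r%:num^-1 * t%:num)%:pos; [exact: I|]; congr (`|_|%:E); apply/esym.
  by apply: regular_distribution_dilation; rewrite //= mulVKf// gt_eqF.
exists (r%:num * t%:num)%:pos; [exact: I|]; congr (`|_|%:E).
exact: regular_distribution_dilation.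
Qed.

Lemma hardy_norm_dilation f r : intble f ->
  hardy_norm eta (regular_distribution (fun y => f (r%:num^-1 *: y))) =
  ((r%:num ^+ n)%:E * hardy_norm eta (regular_distribution f))%E.
Proof.
move=> fi; rewrite /hardy_norm; under eq_integral do rewrite hardy_maximal_dilation//.
have rV0 : r%:num^-1 != 0 by rewrite invr_neq0// gt_eqF.
have mM := measurable_hardy_maximal eta (regular_distribution_tempered fi).
have M0 := hardy_maximal_ge0 eta (regular_distribution f).
set M := hardy_maximal _ _ in mM M0 *; clearbody M.
have := ge0_integral_affine 0 rV0 mM M0.
rewrite gtr0_norm ?invr_gt0// exprVn invrK => <-.
by apply: eq_integral => x _; rewrite addr0.
Qed.

Lemma hardy_maximalD_le (T T' : schwartz R n -> R) x :
  (hardy_maximal eta (T + T')%R x <= hardy_maximal eta T x + hardy_maximal eta T' x)%E.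
Proof.
apply: ge_ereal_sup => _ [t _ <-].
apply: (@le_trans _ _ (`|T (eta_at eta t x)|%:E + `|T' (eta_at eta t x)|%:E)%E).
  by rewrite -EFinD lee_fin; exact: ler_normD.
by apply: leeD; apply: ereal_sup_ubound; exists t.
Qed.

Lemma hardy_maximalZ_le (a : R) (T : schwartz R n -> R) x :
  (hardy_maximal eta (a *: T)%R x <= `|a|%:E * hardy_maximal eta T x)%E.
Proof.
apply: ge_ereal_sup => _ [t _ <-].
rewrite [X in `|X|](_ : _ = a * T (eta_at eta t x))// normrM EFinM.
apply: lee_wpmul2l; first by rewrite lee_fin.
by apply: ereal_sup_ubound; exists t.
Qed.

Lemma hardy_normD_le (T T' : schwartz R n -> R) : tempered T -> tempered T' ->
  (hardy_norm eta (T + T')%R <= hardy_norm eta T + hardy_norm eta T')%E.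
Proof.
move=> tT tT'; have mT := measurable_hardy_maximal eta tT.
have mT' := measurable_hardy_maximal eta tT'.
rewrite -ge0_integralD//; [|by move=> x _; exact: hardy_maximal_ge0..].
apply: ge0_le_integral => //.
- by move=> x _; exact: hardy_maximal_ge0.
- by apply: measurable_hardy_maximal; rewrite -[T']scale1r; exact: tempered_lin.
- exact: emeasurable_funD.
by move=> x _; exact: hardy_maximalD_le.
Qed.

Lemma hardy_normZ_le (a : R) (T : schwartz R n -> R) : tempered T ->
  (hardy_norm eta (a *: T)%R <= `|a|%:E * hardy_norm eta T)%E.
Proof.
move=> tT; have mT := measurable_hardy_maximal eta tT.
rewrite -ge0_integralZl//; last by move=> x _; exact: hardy_maximal_ge0.
apply: ge0_le_integral => //.
- by move=> x _; exact: hardy_maximal_ge0.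
- by apply: measurable_hardy_maximal; exact: temperedZ.
- exact: measurable_funeM.
by move=> x _; exact: hardy_maximalZ_le.
Qed.

Lemma integrable_hardy_maximal (T : schwartz R n -> R) : tempered T ->
  (hardy_norm eta T < +oo)%E -> mu.-integrable setT (hardy_maximal eta T).
Proof.
move=> tT Too; apply/integrableP; split; first exact: measurable_hardy_maximal.
under eq_integral do rewrite gee0_abs ?hardy_maximal_ge0//.
exact: Too.
Qed.

(** On its support, [|f| <= s * f ^+ 2 + s^-1] for all s > 0. If the integral of the square
    vanished, that of f would be at most V / s in absolute value for every s, V being the volume of
    a cube containing the support. *)
Lemma integral_sqr_gt0 f : test_function f -> \int[mu]_x f x != 0 -> 0 < \int[mu]_x (f x * f x).
Proof.
move=> tf f0; have [B fB] := test_function_support tf.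
have iff : intble (fun x => f x * f x).
  exact: test_function_intble (test_function_mulr tf (test_functionS tf)).
rewrite lt_def Rintegral_ge0 ?andbT//; last by move=> x _; rewrite -expr2 sqr_ge0.
apply: contraNneq f0 => ff0.
have fle s : 0 < s -> `|\int[mu]_x f x| <= s^-1 * \int[mu]_x (1 * \1_(cube B) x).
  move=> s0; have sV0 : 0 < s^-1 by rewrite invr_gt0.
  have iC := intble_cube n 1 B.
  have := ler_norm_Rintegral (test_function_measurable tf) (intbleD (intbleZ s iff) (intbleZ s^-1 iC)).
  rewrite RintegralD//; [|exact: (intbleZ s iff)|exact: (intbleZ s^-1 iC)].
  rewrite (Rintegral_mull s iff) ff0 mulr0 add0r (Rintegral_mull s^-1 iC); apply => x.
  have [->|fx] := eqVneq (f x) 0; first by rewrite normr0 mul0r mulr0 add0r !mulr_ge0// ltW.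
  rewrite indicE mem_set ?mulr1; last exact: (fB [::] x fx).
  rewrite -subr_ge0; have -> : s * (f x * f x) + s^-1 - `|f x| =
      s^-1 * ((s * `|f x| - 2^-1) ^+ 2 + 3 / 4).
    rewrite -expr2 -real_normK ?num_real//; field; exact: lt0r_neq0.
  by rewrite mulr_ge0 ?(ltW sV0)// addr_ge0 ?sqr_ge0// divr_ge0.
set I := \int[mu]_x _ in fle *; set V := \int[mu]_x _ in fle.
apply: contraT => I0; have I1 : 0 < `|I| by rewrite normr_gt0.
have V0 : 0 <= V by have := fle 1 ltr01; rewrite invr1 mul1r; exact: le_trans.
have V1 : 0 < V + 1 by rewrite ltr_wpDl.
(* This s gives [|I| <= |I| * V / (V + 1)], which is absurd. *)
have := fle ((V + 1) / `|I|) (divr_gt0 V1 I1).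
by rewrite invf_div mulrAC ler_pdivlMr// ler_pM2l// gerDl leNgt ltr01.
Qed.

End atom_scaling.

(** * Decaying distributions *)

Section decaying.
Context (R : realType) (n : nat) (eta : test_fun R n).
Local Notation mu := (@lebesgue_rV R n).
Implicit Types (h g : hardy eta) (x y w : 'rV[R]_n) (t r : {posnum R}) (K : R).

Definition decaying K : set (hardy eta) :=
  [set h | forall t x, `|hardy_val h (eta_at eta t x)| <= K * t%:num ^- n.+1].

(** If h violates the bound at some t and x, [hardy_separation] at the scale t yields a ball around
    h that contains no element of the set. *)
Lemma closed_decaying K : closed (decaying K).
Proof.
rewrite -[decaying K]setCK; apply: open_closedC.
change (hardy_open (~` decaying K)) => h /existsNP[t /existsNP[x /negP]].
rewrite -ltNge => Kh; have [c c0 sep] := hardy_separation (hardy_tempered h) Kh.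
exists c; split => // g gh gK.
have := sep _ (hardy_tempered g) (gK t).
by rewrite hardy_normB leNgt gh.
Qed.

Hypothesis n0 : (0 < n)%N.
Hypothesis heta : \int[mu]_x eta x != 0.

(* The two translates in the atom have disjoint supports, so pairing the atom
   with the reflected [eta] leaves the integral of [eta ^ 2]. *)
Lemma nonvanishing_atom : exists f, [/\ intble f,
  (hardy_norm eta (regular_distribution f) < +oo)%E &
  regular_distribution f (eta_at eta 1%:pos 0) != 0].
Proof.
have teta := test_valP eta; have [B etaB] := test_function_support teta.
pose k y := eta (0 - y); have tk : test_function k by exact: test_function_reflect.
have kB y : k y != 0 -> `|y| <= `|B|.
  by move=> /(etaB [::]); rewrite sub0r normrN => /le_trans; apply; exact: ler_norm.
pose w : 'rV[R]_n := const_mx (2 * `|B| + 1).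
have wB : 2 * `|B| < `|w|.
  have := rV_coord_le w (Ordinal n0); rewrite mxE ger0_norm ?addr_ge0 ?mulr_ge0//.
  by apply: lt_le_trans; rewrite ltrDl.
exists (fun y => k y - k (y - w)); split.
- by apply: intbleB; [|apply: intble_translate]; exact: test_function_intble.
- exact: atom_hardy_norm_lty.
rewrite (_ : regular_distribution _ _ = \int[mu]_y (eta y * eta y)).
  exact: lt0r_neq0 (integral_sqr_gt0 teta heta).
rewrite -(Rintegral_reflect 0); last first.
  exact: test_function_intble (test_function_mulr teta (test_functionS teta)).
apply: eq_Rintegral => y _; rewrite eta_atE /= invr1 scale1r expr1n invr1 mul1r -[eta (0 - y)]/(k y).
have [->|ky] := eqVneq (k y) 0; first by rewrite !mulr0.
have [->|kyw] := eqVneq (k (y - w)) 0; first by rewrite subr0.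
have := ler_normB y (y - w); rewrite opprB addrC subrK => ww.
have := kB _ ky; have := kB _ kyw; lra.
Qed.

(** If h and [h + a *: T] both lie in the set, [a *: T] satisfies the bound with 2 K. At the origin
    and at scale r this reads c r^(-n) |b| <= 2 K r^(-n-1), which fails for large r. *)
Lemma decaying_interior K : (decaying K)° = set0.
Proof.
rewrite -subset0 => h hK; have hd := interior_subset hK.
move: hK; rewrite /interior/= nbhsE => -[U [oU Uh] UK].
have [e [e0 eU]] := oU _ Uh.
have [f [fi foo f0]] := nonvanishing_atom.
set b := regular_distribution f _ in f0.
pose A := fine (hardy_norm eta (regular_distribution f)).
have A0 : 0 <= A by apply: fine_ge0; apply: integral_ge0 => x _; exact: hardy_maximal_ge0.
have AE : hardy_norm eta (regular_distribution f) = A%:E.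
  rewrite fineK// ge0_fin_numE//; apply: integral_ge0 => x _; exact: hardy_maximal_ge0.
(* Then c A < e, and c A bounds the Hardy norm of the perturbation for every r. *)
pose c := e / (A + 1); have c0 : 0 < c by rewrite divr_gt0// ltr_wpDl.
have cA : c * A < e by rewrite /c mulrAC ltr_pdivrMr ?ltr_wpDl// ltr_pM2l// ltrDl.
have b0 : 0 < `|b| by rewrite normr_gt0.
suff key (r : {posnum R}) : c * `|b| * r%:num <= 2 * K.
  have K0 : 0 < `|2 * K| + 1 by rewrite ltr_wpDl.
  have cb0 : 0 < c * `|b| by rewrite mulr_gt0.
  have := key (PosNum (divr_gt0 K0 cb0)); rewrite /= mulrC divfK ?gt_eqF// leNgt => /negP; apply.
  by rewrite ltr_pwDr// ler_norm.
have r0 : 0 < r%:num by [].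
pose a := c * r%:num ^- n.
have a0 : 0 < a by rewrite mulr_gt0// invr_gt0 exprn_gt0.
pose fr y := f (r%:num^-1 *: y).
have ifr : intble fr.
  have rV0 : r%:num^-1 != 0 by rewrite invr_neq0// gt_eqF.
  by have := intble_affine 0 rV0 fi; under eq_fun do rewrite addr0.
pose T := regular_distribution fr.
have tT : tempered T by exact: regular_distribution_tempered.
have Tle : (hardy_norm eta (a *: T)%R <= (c * A)%:E)%E.
  apply: le_trans (hardy_normZ_le eta a tT) _.
  rewrite /T hardy_norm_dilation// AE -!EFinM lee_fin gtr0_norm// /a mulrA divfK//.
have tg : tempered (hardy_val h + a *: T) by apply: tempered_lin => //; exact: hardy_tempered.
have goo : (hardy_norm eta (hardy_val h + a *: T)%R < +oo)%E.
  apply: le_lt_trans (hardy_normD_le eta (hardy_tempered h) (temperedZ a tT)) _.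
  rewrite lte_add_pinfty//; last by rewrite (le_lt_trans Tle)// ltry.
  have /integrableP[_] := hardy_integrable h.
  by under eq_integral do rewrite gee0_abs ?hardy_maximal_ge0//.
pose g : hardy eta := Hardy tg (integrable_hardy_maximal tg goo).
have gd : decaying K g.
  apply: UK; apply: eU; rewrite /= addrAC subrr add0r.
  by apply: (le_lt_trans Tle); rewrite lte_fin.
have := gd r 0; have := hd r 0; rewrite /g /=.
rewrite [in X in _ -> X](_ : (_ + _) _ = hardy_val h (eta_at eta r 0) + a * T (eta_at eta r 0))//.
have -> : T (eta_at eta r 0) = b.
  by rewrite /T (@regular_distribution_dilation _ _ _ _ _ 1%:pos) ?scaler0//= mulr1.
move=> h1 h2.
have : a * `|b| <= 2 * K * r%:num ^- n.+1.
  have := ler_normB (hardy_val h (eta_at eta r 0) + a * b) (hardy_val h (eta_at eta r 0)).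
  rewrite addrAC subrr add0r normrM (gtr0_norm a0); lra.
rewrite ler_pdivlMr ?exprn_gt0//; congr (_ <= _).
by rewrite /a exprS; field; rewrite gt_eqF.
Qed.

End decaying.

(** * Decay of the sums of Jacobians *)

Section jacobian_series_decay.
Context (R : realType) (q : nat) (eta : test_fun R q.+1).
Local Notation n := q.+1.
Local Notation mu := (@lebesgue_rV R n).
Hypothesis q0 : (0 < q)%N.
Hypothesis heta : \int[mu]_x eta x != 0.

(** The first derivatives of [eta_at eta t x] are at most M t^(-n-1): the chain rule adds one factor
    1/t to the normalisation. *)
Lemma jacobian_eta_at_le (M : R) u Du t (x : 'rV[R]_n) : 0 <= M ->
  (forall i y, `|partial i eta y| <= M) -> sobolev u Du -> (sobolev_norm u Du <= 1)%E ->
  `|regular_distribution (jacobian_det Du) (eta_at eta t x)| <= n`!%:R * M * t%:num ^- n.+1.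
Proof.
move=> M0 etaM su Du1; have t0 : 0 < t%:num by [].
have tV0 : t%:num^-1 != 0 by rewrite invr_neq0// gt_eqF.
have seta := test_functionS (test_valP eta).
rewrite -mulrA; apply: (jacobian_test_le q0 (test_valP eta) heta su Du1).
- exact: test_function_affine tV0 (test_valP eta).
- by rewrite mulr_ge0// invr_ge0 exprn_ge0.
move=> j y; rewrite eta_atE partial_affine// normrM normrN mulrC ler_pM//.
by rewrite [in leRHS]exprSr invfM ger0_norm.
Qed.

(** The partial sums obey the bound uniformly in N. If h violated it, [hardy_separation] would keep
    them at a distance at least c > 0 from h, although they converge to h. *)
Lemma jacobian_series_decaying : exists C : R, forall h, jacobian_series eta h ->
  exists k : nat, decaying (k%:R * C) h.
Proof.
have [M [M0 etaM]] := test_function_bounded 1 (test_valP eta).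
pose C : R := n`!%:R * M; have C0 : 0 <= C by rewrite mulr_ge0.
exists C => h [u [Du [lambda [uP lambdaS hS]]]].
pose S := limn (series (fun j => `|lambda j|)).
have partial_sum N : \sum_(j < N) `|lambda j| <= S.
  have := @nondecreasing_cvgn_le _ (series (fun j => `|lambda j|)) _ lambdaS N.
  by rewrite /series/= big_mkord; apply; apply: nondecreasing_series => i _.
(* An integer above the sum of the absolute values of the coefficients, so that countably many sets
   cover everything. *)
exists (Num.bound S) => t x; rewrite leNgt; apply/negP => hx.
have [c c0 sep] := hardy_separation (hardy_tempered h) hx.
suff : (c%:E <= 0)%E by rewrite lee_fin leNgt c0.
apply: (cvge_ge _ hS); apply: nearW => N; apply: sep.
  elim: N => [|N IH]; first by rewrite big_ord0; exact: tempered0.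
  rewrite big_ord_recr/=; apply: tempered_lin => //.
  have [su Du1] := uP N; apply: regular_distribution_tempered.
  exact: jacobian_intble su Du1.
move=> x'; rewrite fct_sumE.
apply: le_trans (ler_norm_sum _ _ _) _.
have tn0 : 0 <= t%:num ^- n.+1 by rewrite invr_ge0 exprn_ge0.
apply: (@le_trans _ _ (\sum_(j < N) `|lambda j| * (C * t%:num ^- n.+1))).
  apply: ler_sum => j _.
  rewrite [X in `|X|](_ : _ = lambda j *
    regular_distribution (jacobian_det (Du j)) (eta_at eta t x'))//.
  rewrite normrM; apply: ler_wpM2l => //; have [su Du1] := uP j.
  by apply: jacobian_eta_at_le => // i y; exact: (etaM [:: i]).
rewrite -mulr_suml -mulrA; apply: ler_wpM2r; first by rewrite mulr_ge0.
apply: (le_trans (partial_sum N)); apply: ltW; apply: archi_boundP.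
by apply: le_trans (partial_sum 0%N); rewrite big_ord0.
Qed.

End jacobian_series_decay.

Theorem theorem1p2 (R : realType) (n : nat) (hn : (2 <= n)%N)
    (eta : test_fun R n) (heta : \int[@lebesgue_rV R n]_x eta x != 0) :
  first_category (jacobian_series eta).
Proof.
case: n hn eta heta => [//|q] q0 eta heta.
have [C JC] := jacobian_series_decaying q0 heta.
(* The intersections are taken because [first_category] asks for an equality with the union, not a
   covering. *)
exists (fun k => jacobian_series eta `&` decaying (k%:R * C)); split.
  move=> k; rewrite /nowhere_dense -subset0 -(decaying_interior (ltn0Sn q) heta (k%:R * C)).
  apply: interiorS; rewrite [X in _ `<=` X](closure_id _).1; last exact: closed_decaying.
  by apply: closureS; exact: subIsetr.
apply/seteqP; split => [h hJ|h [k _ []]//].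
by have [k hk] := JC _ hJ; exists k.
Qed.
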